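(* Let $T>0$ and $s>5/2$. Let $u_1,u_2$ be real-valued solutions of the Benjamin-Ono equation $$\partial_t u-\mathcal H\partial_x^2u+u\,\partial_xu=0,\qquad (x,t)\in\mathbb R\times[0,T],$$ such that $$u_1,u_2\in C([0,T]:H^s(\mathbb R))\cap C^1((0,T):H^{s-2}(\mathbb R)).$$ Suppose there exists an open set $I\subset\mathbb R$ with $0\in I$ such that $$u_1(x,0)=u_2(x,0)\quad\text{for all }x\in I,$$ and that for each positive integer $N$ there is a constant $c_N$ such that $$\int_{|x|\le R}|\partial_tu_1(x,0)-\partial_tu_2(x,0)|^2\,dx\le c_N R^N\quad\text{as }R\downarrow0$$ (i.e. for all sufficiently small $R>0$). Then $u_1(x,t)=u_2(x,t)$ for all $(x,t)\in\mathbb R\times[0,T]$.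
   Context: $H^s(\mathbb R)$ is the usual $L^2$-based Sobolev space. $\mathcal H$ is the Hilbert transform on $\mathbb R$, $$\mathcal Hf(x)=\frac1\pi\lim_{\epsilon\downarrow0}\int_{|y|>\epsilon}\frac{f(x-y)}{y}\,dy,\qquad \widehat{\mathcal Hf}(\xi)=-i\,\mathrm{sgn}(\xi)\widehat f(\xi).$$ $C([0,T]:X)$ and $C^1((0,T):X)$ denote continuous, respectively continuously differentiable, functions of $t$ with values in the Banach space $X$. The equation holds pointwise, including at $t=0$, where $\partial_tu_j(\cdot,0)$ is the one-sided time derivative, so $\partial_tu_j(\cdot,0)=\mathcal H\partial_x^2u_j(\cdot,0)-u_j(\cdot,0)\partial_xu_j(\cdot,0)$. *)

(* Defs.v *)
From HB Require Import structures.
From mathcomp Require Import all_boot all_order all_algebra.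
From mathcomp Require Import all_classical all_reals all_analysis.
From mathcomp Require Import complex.
Set Implicit Arguments.
Unset Strict Implicit.
Unset Printing Implicit Defensive.
Import Order.TTheory GRing.Theory Num.Theory.
Import numFieldNormedType.Exports.
Local Open Scope classical_set_scope.
Local Open Scope ring_scope.

Section benjamin_ono.
Context {R : realType}.
Local Notation mu := (@lebesgue_measure R).

Definition L2 (f : R -> R) : Prop := f \in Lfun mu 2%:E.

(* \int_(-n)^n f(x) e^(- i xi x) dx, for real-valued f *)
Definition fourier_trunc (n : nat) (f : R -> R) (xi : R) : R[i] :=
  Complex (\int[mu]_(x in `[- n%:R, n%:R]) (f x * cos (xi * x)))
          (- \int[mu]_(x in `[- n%:R, n%:R]) (f x * sin (xi * x))).

(* g represents the Fourier-Plancherel transform of f \in L^2, defined as the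
   limit in L^2 of the transforms of the truncations of f. *)
Definition is_fourier (f : R -> R) (g : R -> R[i]) : Prop :=
  [/\ L2 (fun xi => complex.Re (g xi)), L2 (fun xi => complex.Im (g xi)) &
      Lnorm mu 2%:E (fun xi => (ComplexField.Normc.normc
         (g xi - fourier_trunc n f xi))%:E) @[n --> \oo] --> 0%E].

(* A representative of the transform, which is unique up to a null set. *)
Definition fourier (f : R -> R) : R -> R[i] :=
  xget (fun=> 0) [set g | is_fourier f g].

(* Meaningful when f has a Fourier-Plancherel transform, which is the case
   for every f \in L^2. *)
Definition sobolev_norm (s : R) (f : R -> R) : \bar R :=
  Lnorm mu 2%:E (fun xi => ((1 + xi ^+ 2) `^ (s / 2) *
                           ComplexField.Normc.normc (fourier f xi))%:E).

(* f represents an element of H^s, for s >= 0 (so that H^s is contained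
   in L^2). By Plancherel's theorem the second clause follows from the first;
   it records that fourier f is not the default value of xget. *)
Definition sobolev (s : R) (f : R -> R) : Prop :=
  [/\ L2 f, is_fourier f (fourier f) & (sobolev_norm s f < +oo)%E].

(* Below, a function u of (x, t) is viewed as the curve t |-> u ^~ t. *)

(* u \in C(A : H^s) *)
Definition C_sobolev (A : set R) (s : R) (u : R -> R -> R) : Prop :=
  (forall t, A t -> sobolev s (u ^~ t)) /\
  (forall t0, A t0 ->
     sobolev_norm s (fun x => u x t - u x t0)
       @[t --> within A (nbhs t0)] --> 0%E).

(* u \in C^1(A : H^s), for A open; v is the derivative of u with respect to
   the norm of H^s. *)
Definition C1_sobolev (A : set R) (s : R) (u : R -> R -> R) : Prop :=
  (forall t, A t -> sobolev s (u ^~ t)) /\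
  exists v : R -> R -> R, C_sobolev A s v /\
    (forall t, A t ->
       sobolev_norm s (fun x => h^-1 * (u x (t + h) - u x t) - v x t)
         @[h --> 0^'] --> 0%E).

Definition hilbert_trunc (f : R -> R) (x e : R) : R :=
  \int[mu]_(y in [set y | e < `|y|]) (f (x - y) / y).

Definition hilbert (f : R -> R) (x : R) : R :=
  pi^-1 * lim (hilbert_trunc f x e @[e --> 0^'+]).

Definition time_quotient (u : R -> R -> R) (x t h : R) : R :=
  h^-1 * (u x (t + h) - u x t).

(* The increments h that keep t + h in [0, T]: the time derivative is
   two-sided on ]0, T[ and one-sided at the end points. *)
Definition time_increments (T t : R) : set_system R :=
  within [set h | 0 <= t + h <= T] 0^'.

Definition time_deriv (T : R) (u : R -> R -> R) (x t : R) : R :=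
  lim (time_quotient u x t h @[h --> time_increments T t]).

(* The Benjamin-Ono equation holds at every point of R x [0, T], all the
   limits involved in it being required to exist. In particular each u ^~ t
   is the continuous representative of its class in H^s. *)
Definition BO_solution (T : R) (u : R -> R -> R) : Prop :=
  forall x t : R, 0 <= t <= T ->
  [/\ derivable (u ^~ t) x 1,
      derivable (derive1 (u ^~ t)) x 1,
      cvg (hilbert_trunc (derive1n 2 (u ^~ t)) x e @[e --> 0^'+]),
      cvg (time_quotient u x t h @[h --> time_increments T t]) &
      time_deriv T u x t - hilbert (derive1n 2 (u ^~ t)) x
        + u x t * derive1 (u ^~ t) x = 0].

End benjamin_ono.

(* Main.v *)
Require Import Defs.
From mathcomp Require Import all_boot all_order all_algebra.
From mathcomp Require Import all_classical all_reals all_analysis.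
From mathcomp Require Import complex measurable_realfun ring lra.
Set Implicit Arguments.
Unset Strict Implicit.
Unset Printing Implicit Defensive.
Import Order.TTheory GRing.Theory Num.Theory.
Import numFieldNormedType.Exports.
Local Open Scope classical_set_scope.
Local Open Scope ring_scope.

(* Write w = u1 - u2. At time 0 the function w vanishes on some ]-a, a[, so that there w_t is the
   Hilbert transform of f = w'', and f is supported in |z| >= a. Near the origin
   pi * (H f)(x) = \int f(z) / (x - z) dz expands in powers of x, with the moments
   - \int f(z) / z^(n+1) dz as coefficients; vanishing to infinite order forces all of them to be 0.
   Testing f(z) / z against high powers of a polynomial in 1 / z which peaks at a given 1 / z0
   yields f = 0, hence w(., 0) = 0. For later times the energy E = \int w^2 satisfies E' <= K E,
   since H d_x^2 is skew-adjoint and the transport terms are integrated by parts, the first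
   derivatives being bounded for s > 3/2; so E = 0 by Gronwall's lemma.
   The Fourier side is handled with the real-valued Hartley transform of kernel
   cas (x xi) = cos (x xi) + sin (x xi); every slice of a solution is the transform of an h such
   that (1 + xi^2) h is integrable and square-integrable. *)

Section real_integral.
Context d (T : measurableType d) {R : realType} (mu : {measure set T -> \bar R}).
Implicit Types f g h : T -> R.

Definition ig f := mu.-integrable setT (EFin \o f).

Lemma ig_meas f : ig f -> measurable_fun setT f.
Proof. by move=> /integrableP[/measurable_EFinP]. Qed.

Lemma ig_le f g : measurable_fun setT f -> ig g ->
  (forall x, `|f x| <= g x) -> ig f.
Proof.
move=> mf ig_g fg; apply: le_integrable ig_g => //; first exact/measurable_EFinP.
by move=> x _ /=; rewrite lee_fin (le_trans (fg x)) // ler_norm.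
Qed.

Lemma igD f g : ig f -> ig g -> ig (fun x => f x + g x).
Proof. by move=> if_ ig_; have := integrableD measurableT if_ ig_. Qed.

Lemma igB f g : ig f -> ig g -> ig (fun x => f x - g x).
Proof. by move=> if_ ig_; have := integrableB measurableT if_ ig_. Qed.

Lemma igZ (c : R) f : ig f -> ig (fun x => c * f x).
Proof. by move=> if_; have := integrableZl measurableT c if_. Qed.

Lemma ig_norm f : ig f -> ig (fun x => `|f x|).
Proof. by move=> if_; have := integrable_abse if_. Qed.

Lemma ig_eq f g : f =1 g -> ig f -> ig g.
Proof. by move=> /funext ->. Qed.

Lemma ig_Mbd (M : R) f g : ig f -> measurable_fun setT g ->
  (forall x, `|g x| <= M) -> ig (fun x => f x * g x).
Proof.
move=> if_ mg gM; apply: (@ig_le _ (fun x => M * `|f x|)).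
- by apply: measurable_funM => //; exact: ig_meas.
- exact/igZ/ig_norm.
- by move=> x; rewrite normrM mulrC ler_wpM2r.
Qed.

Lemma ge0_igP f : measurable_fun setT f -> (forall x, 0 <= f x) ->
  (\int[mu]_x (f x)%:E < +oo)%E -> ig f.
Proof.
move=> mf f0 h; apply/integrableP; split; first exact/measurable_EFinP.
by under eq_integral => x _ do rewrite /= ger0_norm //.
Qed.

Lemma ig_EFin f : ig f -> (\int[mu]_x (f x)%:E)%E = (\int[mu]_x f x)%:E.
Proof. by move=> if_; rewrite /Rintegral fineK //; exact: (integrable_fin_num measurableT if_). Qed.

Lemma le_int f g : ig f -> ig g -> (forall x, f x <= g x) ->
  \int[mu]_x f x <= \int[mu]_x g x.
Proof. by move=> *; apply: le_Rintegral. Qed.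

Lemma eq_int f g : f =1 g -> \int[mu]_x f x = \int[mu]_x g x.
Proof. by move=> /funext ->. Qed.

Lemma int_ge0 f : (forall x, 0 <= f x) -> 0 <= \int[mu]_x f x.
Proof. by move=> f0; apply: Rintegral_ge0. Qed.

Lemma intD f g : ig f -> ig g ->
  \int[mu]_x (f x + g x) = \int[mu]_x f x + \int[mu]_x g x.
Proof. by move=> *; apply: RintegralD. Qed.

Lemma intB f g : ig f -> ig g ->
  \int[mu]_x (f x - g x) = \int[mu]_x f x - \int[mu]_x g x.
Proof. by move=> *; apply: RintegralB. Qed.

Lemma intZ (c : R) f : ig f -> \int[mu]_x (c * f x) = c * \int[mu]_x f x.
Proof. by move=> *; apply: RintegralZl. Qed.

Lemma intN f : ig f -> \int[mu]_x (- f x) = - \int[mu]_x f x.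
Proof.
by move=> if_; rewrite -mulN1r -intZ //; apply: eq_int => x; rewrite mulN1r.
Qed.

Lemma igN f : ig f -> ig (fun x => - f x).
Proof. by move=> if_; apply: ig_eq (igZ (-1) if_) => x; rewrite mulN1r. Qed.

Lemma le_norm_int f : ig f -> `|\int[mu]_x f x| <= \int[mu]_x `|f x|.
Proof. by move=> if_; apply: le_normr_Rintegral. Qed.

Lemma le_norm_int_le f g : ig f -> ig g -> (forall x, `|f x| <= g x) ->
  `|\int[mu]_x f x| <= \int[mu]_x g x.
Proof.
move=> if_ ig_ fg; apply: le_trans (le_norm_int if_) _.
by apply: le_int => //; exact: ig_norm.
Qed.

Lemma int_cvg (f_ : nat -> T -> R) f g :
  (forall n, measurable_fun setT (f_ n)) ->
  (forall x, f_ n x @[n --> \oo] --> f x) -> ig g ->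
  (forall n x, `|f_ n x| <= g x) ->
  ig f /\ \int[mu]_x f_ n x @[n --> \oo] --> \int[mu]_x f x.
Proof.
move=> mf cf ig_ fg.
have mf' : measurable_fun setT f.
  by apply: measurable_fun_cvg (fun x _ => cf x).
have if_ : ig f.
  apply: ig_le mf' ig_ _ => x; have c : `|f_ n x| @[n --> \oo] --> `|f x| by apply: cvg_norm; exact: cf.
  rewrite -(cvg_lim _ c) //; apply: limr_le; first by apply/cvg_ex; eexists; exact: c.
  by apply: nearW => n; exact: fg.
split => //.
have ifn n : ig (f_ n) by apply: ig_le ig_ _.
have [] := @dominated_convergence _ _ _ mu setT measurableT
  (fun n => EFin \o f_ n) (EFin \o f) (EFin \o g).
- by move=> n; exact/measurable_EFinP.
- exact/measurable_EFinP.
- by apply: aeW => x _ /=; apply: cvg_EFin; [exact: nearW|exact: cf].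
- exact: ig_.
- by apply: aeW => x n _ /=; rewrite lee_fin.
move=> _ _ /=; rewrite ig_EFin //.
under eq_fun do rewrite ig_EFin //.
by move/fine_cvgP => -[_ /=].
Qed.

Lemma int_fatou (f_ : nat -> T -> R) f (M : R) :
  (forall n, ig (f_ n)) -> (forall n x, 0 <= f_ n x) ->
  (forall x, f_ n x @[n --> \oo] --> f x) ->
  (forall n, \int[mu]_x f_ n x <= M) ->
  ig f /\ \int[mu]_x f x <= M.
Proof.
move=> ifn f0 cf fM.
have mf' : measurable_fun setT f.
  apply: measurable_fun_cvg (fun x _ => cf x) => n.
  exact: ig_meas.
have f_ge0 x : 0 <= f x.
  rewrite -(cvg_lim _ (cf x)) //; apply: limr_ge; first by apply/cvg_ex; eexists; exact: cf.
  exact: nearW.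
have le : (\int[mu]_x (f x)%:E <= M%:E)%E.
  have H : (\int[mu]_x limn_einf (fun n => (f_ n x)%:E) <=
            limn_einf (fun n => \int[mu]_x (f_ n x)%:E))%E.
    apply: fatou => //.
    - by move=> n; apply/measurable_EFinP; exact: ig_meas.
    - by move=> n x _; rewrite lee_fin.
  rewrite (eq_integral (fun x => limn_einf (fun n => (f_ n x)%:E))); last first.
    move=> x _; apply/esym; rewrite (cvg_limn_einf_sup (l := (f x)%:E)) //.
    by apply: cvg_EFin; [exact: nearW|exact: cf].
  apply: le_trans H _; rewrite limn_einf_lim; apply: lime_le.
    exact: is_cvg_einfs.
  apply: nearW => n; apply: (@le_trans _ _ (\int[mu]_x (f_ n x)%:E)%E).
    by apply: ereal_inf_lbound; exists n => /=.
  by rewrite ig_EFin // lee_fin.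
have if_ : ig f by apply: ge0_igP => //; apply: le_lt_trans le _; rewrite ltry.
by split => //; rewrite -lee_fin -ig_EFin.
Qed.

Lemma int_eq0_measure0 f : ig f -> (forall x, 0 <= f x) -> \int[mu]_x f x = 0 ->
  forall A : set T, measurable A -> forall e : R, 0 < e ->
  (forall x, A x -> e <= f x) -> mu A = 0%E.
Proof.
move=> if_ f0 int0 A mA e e0 Ae.
have H : (e%:E * mu A <= 0)%E.
  rewrite -integral_cst //.
  apply: (@le_trans _ _ (\int[mu]_(x in A) (f x)%:E)%E).
    apply: ge0_le_integral => //; try by move=> x _; rewrite lee_fin ltW.
    all: try by apply/measurable_EFinP; apply: measurable_funTS; exact: ig_meas.
  apply: (@le_trans _ _ (\int[mu]_x (f x)%:E)%E); last by rewrite ig_EFin // int0.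
  apply: ge0_subset_integral => //; first by apply/measurable_EFinP; exact: ig_meas.
  by move=> x _; rewrite lee_fin.
apply/eqP; rewrite eq_le measure_ge0 andbT.
by move: H; rewrite pmule_rle0 // lte_fin.
Qed.

End real_integral.

Section lebesgue_tools.
Context {R : realType}.
Local Notation mu := (@lebesgue_measure R).
Implicit Types f g h : R -> R.

Lemma cont_meas f : continuous f -> measurable_fun setT f.
Proof. exact: continuous_measurable_fun. Qed.

Lemma affine_measure (a b : R) : 0 < a -> forall A : set R, measurable A ->
  mu A = (a%:E * mu ((fun x => a * x + b)%R @^-1` A))%E.
Proof.
move=> a0.
have mphi : measurable_fun [set: measurableTypeR R]
    (fun x : measurableTypeR R => a * x + b : measurableTypeR R).
  apply: cont_meas => x; apply: cvgD; last exact: cvg_cst.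
  by apply: cvgM; [exact: cvg_cst|exact: cvg_id].
pose phi := fun x : measurableTypeR R => a * x + b : measurableTypeR R.
unshelve epose (nu := mscale (NngNum (ltW a0)) (pushforward mu phi)
  : {measure set (measurableTypeR R) -> \bar R}); first exact: mphi.
move=> A mA; rewrite (@lebesgue_measure_unique R nu) //.
move=> _ [[c e]] _ <-; rewrite /nu.
have E : (fun x => a * x + b) @^-1` `]c, e]%classic = `](c - b) / a, (e - b) / a]%classic.
  apply/seteqP; split => x /=; rewrite !in_itv/= ltr_pdivrMr // ler_pdivlMr //;
    by rewrite ltrBlDr lerBrDr (mulrC x).
transitivity (a%:E * mu `]((c - b) / a)%R, ((e - b) / a)%R]%classic)%E; last by rewrite -E.
rewrite !lebesgue_measure_itv /= !lte_fin ltr_pM2r ?invr_gt0 // ltrD2r.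
case: ifP => _; last by rewrite mule0.
by rewrite -EFinD -EFinM; congr EFin; field; rewrite gt_eqF.
Qed.

Lemma affine_ge0 (a b : R) f : 0 < a -> measurable_fun setT f ->
  (forall x, 0 <= f x) ->
  (\int[mu]_x (f x)%:E = a%:E * \int[mu]_x (f (a * x + b)%R)%:E)%E.
Proof.
move=> a0 mf f0.
have mphi : measurable_fun [set: measurableTypeR R]
    (fun x : measurableTypeR R => a * x + b : measurableTypeR R).
  apply: cont_meas => x; apply: cvgD; last exact: cvg_cst.
  by apply: cvgM; [exact: cvg_cst|exact: cvg_id].
pose phi := fun x : measurableTypeR R => a * x + b : measurableTypeR R.
have mf' : measurable_fun [set: measurableTypeR R] (EFin \o f) by exact/measurable_EFinP.
unshelve epose (nu := (pushforward mu phi)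
  : {measure set (measurableTypeR R) -> \bar R}); first exact: mphi.
have f0' x : setT x -> (0 <= (EFin \o f) x)%E by move=> _; rewrite lee_fin.
have H := @ge0_integral_mscale _ _ _ nu setT measurableT (NngNum (ltW a0)) _ mf' f0'.
have P := @ge0_integral_pushforward _ _ _ _ R phi mphi mu setT (EFin \o f) measurableT mf'.
rewrite preimage_setT in P.
rewrite -[X in (a%:E * X)%E]P; last by move=> x _; rewrite lee_fin.
rewrite -H; apply: eq_measure_integral => //= A mA _.
by rewrite (affine_measure b a0 mA).
Qed.

Lemma opp_ge0 f : measurable_fun setT f -> (forall x, 0 <= f x) ->
  (\int[mu]_x (f x)%:E = \int[mu]_x (f (- x)%R)%:E)%E.
Proof.
move=> mf f0.
have mphi : measurable_fun [set: measurableTypeR R]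
    (-%R : measurableTypeR R -> measurableTypeR R).
  by apply: cont_meas; exact: opp_continuous.
pose phi := (-%R : measurableTypeR R -> measurableTypeR R).
have mf' : measurable_fun [set: measurableTypeR R] (EFin \o f) by exact/measurable_EFinP.
have P := @ge0_integral_pushforward _ _ _ _ R phi mphi mu setT (EFin \o f) measurableT mf'.
rewrite preimage_setT in P.
rewrite -[RHS]P; last by move=> x _; rewrite lee_fin.
by apply: eq_measure_integral => //= A mA _; exact/esym/lebesgue_measureN.
Qed.

Lemma ig_affine (a b : R) f : 0 < a -> ig mu f -> ig mu (fun x : R => f (a * x + b)).
Proof.
move=> a0 if_; have mf := ig_meas if_.
have mphi : measurable_fun setT (fun x : R => a * x + b).
  apply: cont_meas => x; apply: cvgD; last exact: cvg_cst.
  by apply: cvgM; [exact: cvg_cst|exact: cvg_id].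
have mfp : measurable_fun setT (fun x => f (a * x + b)) by apply: measurableT_comp.
apply/integrableP; split; first exact/measurable_EFinP.
have := affine_ge0 b a0 (measurableT_comp (@normr_measurable R setT) mf) (fun x => normr_ge0 _).
rewrite /comp /= => E.
have -> : (\int[mu]_x `|(EFin \o (fun x => f (a * x + b)%R)) x| =
          (a^-1)%:E * \int[mu]_x (`|f x|)%:E)%E.
  by rewrite E muleA -EFinM mulVf ?gt_eqF // mul1e.
move: if_ => /integrableP[_] H.
by apply: lte_mul_pinfty => //; rewrite lee_fin invr_ge0 ltW.
Qed.

Lemma ig_opp f : ig mu f -> ig mu (fun x : R => f (- x)).
Proof.
move=> if_; have mf := ig_meas if_.
have mfp : measurable_fun setT (fun x : R => f (- x)).
  by apply: measurableT_comp => //; apply: cont_meas; exact: opp_continuous.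
apply/integrableP; split; first exact/measurable_EFinP.
have := opp_ge0 (measurableT_comp (@normr_measurable R setT) mf) (fun x => normr_ge0 _).
rewrite /comp /= => <-.
by move: if_ => /integrableP[_].
Qed.

Lemma int_split_ge0 f : ig mu f ->
  \int[mu]_x f x = \int[mu]_x (`|f x| + f x) - \int[mu]_x `|f x|.
Proof.
by move=> if_; rewrite intD //; [rewrite addrC addKr|exact: ig_norm].
Qed.

Lemma int_affine (a b : R) f : 0 < a -> ig mu f ->
  \int[mu]_x f (a * x + b) = a^-1 * \int[mu]_x f x.
Proof.
move=> a0 if_; have ip := ig_affine b a0 if_.
have key g : ig mu g -> (forall x, 0 <= g x) ->
    \int[mu]_x g (a * x + b) = a^-1 * \int[mu]_x g x.
  move=> ig_ g0; apply: EFin_inj; rewrite EFinM -ig_EFin; last exact: ig_affine.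
  rewrite -ig_EFin // (affine_ge0 b a0 (ig_meas ig_) g0).
  by rewrite muleA -EFinM mulVf ?gt_eqF // mul1e.
rewrite int_split_ge0 // (int_split_ge0 if_) mulrBr.
have nf0 x : 0 <= `|f x| + f x by rewrite -lerBlDr sub0r -normrN ler_norm.
rewrite -(key _ (igD (ig_norm if_) if_)) //.
by rewrite -(key _ (ig_norm if_)).
Qed.

Lemma int_opp f : ig mu f -> \int[mu]_x f (- x) = \int[mu]_x f x.
Proof.
move=> if_; have ip := ig_opp if_.
have key g : ig mu g -> (forall x, 0 <= g x) ->
    \int[mu]_x g (- x) = \int[mu]_x g x.
  move=> ig_ g0; apply: EFin_inj; rewrite -ig_EFin; last exact: ig_opp.
  by rewrite -ig_EFin // (opp_ge0 (ig_meas ig_) g0).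
rewrite int_split_ge0 // (int_split_ge0 if_).
have nf0 x : 0 <= `|f x| + f x by rewrite -lerBlDr sub0r -normrN ler_norm.
rewrite -(key _ (igD (ig_norm if_) if_)) //.
by rewrite -(key _ (ig_norm if_)).
Qed.

Lemma ig_refl (c : R) f : ig mu f -> ig mu (fun x : R => f (c - x)).
Proof.
move=> if_; apply: ig_eq (ig_opp (ig_affine c ltr01 if_)) => x /=.
by rewrite mul1r addrC.
Qed.

Lemma int_refl (c : R) f : ig mu f -> \int[mu]_x f (c - x) = \int[mu]_x f x.
Proof.
move=> if_; have := int_affine c ltr01 if_; rewrite invr1 mul1r => <-.
rewrite -(int_opp (ig_affine c ltr01 if_)); apply: eq_int => x.
by rewrite mul1r addrC.
Qed.

Section fubini.
Local Notation RR := (measurableTypeR R * measurableTypeR R)%type.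
Implicit Types k : RR -> R.

Lemma ig2_prod f g : ig mu f -> ig mu g ->
  ig (mu \x mu)%E (fun z : RR => f z.1 * g z.2).
Proof.
move=> if_ ig_.
have mk : measurable_fun setT (fun z : RR => f z.1 * g z.2).
  apply: measurable_funM.
    exact: (measurableT_comp (ig_meas if_) measurable_fst).
  exact: (measurableT_comp (ig_meas ig_) measurable_snd).
apply/integrable12ltyP; first exact/measurable_EFinP.
have -> : (\int[mu]_x \int[mu]_y `|(EFin \o (fun z : RR => f z.1 * g z.2)%R) (x, y)| =
   \int[mu]_x (`|f x| * \int[mu]_y `|g y|)%:E)%E.
  apply: eq_integral => x _.
  rewrite -(intZ _ (ig_norm ig_)) -(ig_EFin (igZ `|f x| (ig_norm ig_))).
  by apply: eq_integral => y _ /=; rewrite normrM.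
have H : ig mu (fun x => `|f x| * \int[mu]_y `|g y|).
  by apply: ig_eq (igZ (\int[mu]_y `|g y|) (ig_norm if_)) => x; rewrite mulrC.
by rewrite (ig_EFin H) ltry.
Qed.

Lemma ig2_le k f g : measurable_fun setT k -> ig mu f -> ig mu g ->
  (forall x y, `|k (x, y)| <= f x * g y) -> ig (mu \x mu)%E k.
Proof.
move=> mk if_ ig_ kfg; apply: ig_le mk (ig2_prod if_ ig_) _.
by move=> [x y]; exact: kfg.
Qed.

Lemma ig2_ge0 k : measurable_fun setT k -> (forall z, 0 <= k z) ->
  (forall x, ig mu (fun y => k (x, y))) ->
  ig mu (fun x => \int[mu]_y k (x, y)) -> ig (mu \x mu)%E k.
Proof.
move=> mk k0 kx H; apply/integrable12ltyP; first exact/measurable_EFinP.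
rewrite (eq_integral (fun x => (\int[mu]_y k (x, y))%:E)).
  by rewrite (ig_EFin H) ltry.
move=> x _; rewrite -(ig_EFin (kx x)); apply: eq_integral => y _ /=.
by rewrite ger0_norm.
Qed.

Lemma fubini1 k : ig (mu \x mu)%E k -> (forall x, ig mu (fun y => k (x, y))) ->
  ig mu (fun x => \int[mu]_y k (x, y)) /\
  \int[mu]_x \int[mu]_y k (x, y) = \int[(mu \x mu)%E]_z k z.
Proof.
move=> ik kx.
have E : (fun x => (\int[mu]_y (k (x, y))%:E)%E) =
    EFin \o (fun x => \int[mu]_y k (x, y)).
  by apply/funext => x /=; rewrite (ig_EFin (kx x)).
split; first by rewrite /ig -E; exact: (integrable_fubini_F ik).
transitivity (fine (\int[mu]_x (\int[mu]_y (k (x, y))%:E))%E).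
  by rewrite E.
by congr fine; exact: (integral12_prod_meas1 ik).
Qed.

Lemma ig2_swap k : ig (mu \x mu)%E k ->
  ig (mu \x mu)%E (fun z : RR => k (z.2, z.1)).
Proof.
move=> ik; have mk := ig_meas ik.
have mk' : measurable_fun setT (fun z : RR => k (z.2, z.1)).
  by apply: (measurableT_comp mk); exact: measurable_fun_pair.
apply/integrable12ltyP; first exact/measurable_EFinP.
have mk2 : measurable_fun setT (EFin \o k) by exact/measurable_EFinP.
by have := (integrable21ltyP mu mu mk2).1 ik.
Qed.

Lemma fubini2 k : ig (mu \x mu)%E k -> (forall y, ig mu (fun x => k (x, y))) ->
  ig mu (fun y => \int[mu]_x k (x, y)) /\
  \int[mu]_y \int[mu]_x k (x, y) = \int[(mu \x mu)%E]_z k z.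
Proof.
move=> ik kx.
have E : (fun y => (\int[mu]_x (k (x, y))%:E)%E) =
    EFin \o (fun y => \int[mu]_x k (x, y)).
  by apply/funext => y /=; rewrite (ig_EFin (kx y)).
split; first exact: (fubini1 (ig2_swap ik) kx).1.
transitivity (fine (\int[mu]_y (\int[mu]_x (k (x, y))%:E))%E).
  by rewrite E.
by congr fine; exact: (integral21_prod_meas1 ik).
Qed.

Lemma fubini_int k :  ig (mu \x mu)%E k -> (forall x, ig mu (fun y => k (x, y))) ->
  (forall y, ig mu (fun x => k (x, y))) ->
  \int[mu]_x \int[mu]_y k (x, y) = \int[mu]_y \int[mu]_x k (x, y).
Proof. by move=> ik k1 k2; rewrite (fubini1 ik k1).2 (fubini2 ik k2).2. Qed.

End fubini.
End lebesgue_tools.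

Section square_integrable.
Context {R : realType}.
Local Notation mu := (@lebesgue_measure R).
Implicit Types f g h : R -> R.

Definition l2 f := measurable_fun setT f /\ ig mu (fun x => f x ^+ 2).

Lemma L2P f : L2 f <-> l2 f.
Proof.
split=> [Lf|[mf if2]].
  split; last exact: Lfun2_integrable_sqr.
  by move: Lf; rewrite /L2 inE => /andP[/[!inE]].
rewrite /L2 inE; apply/andP; split; rewrite inE //=.
rewrite /finite_norm unlock /=.
apply: poweR_lty.
move: if2 => /integrableP[_]; apply: le_lt_trans.
rewrite le_eqVlt; apply/orP; left; apply/eqP; apply: eq_integral => x _ /=.
by rewrite powR_mulrn // normrX.
Qed.

Lemma l2_mul f g : l2 f -> l2 g -> ig mu (fun x => f x * g x).
Proof.
move=> [mf f2] [mg g2]; apply: ig_le (igD f2 g2) _; first exact: measurable_funM.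
move=> x; rewrite normrM -(real_normK (num_real (f x))) -(real_normK (num_real (g x))).
have := sqr_ge0 (`|f x| - `|g x|); have := normr_ge0 (f x); have := normr_ge0 (g x); nra.
Qed.

Lemma l2Z (c : R) f : l2 f -> l2 (fun x => c * f x).
Proof.
move=> [mf f2]; split; first exact: measurable_funM.
by apply: ig_eq (igZ (c ^+ 2) f2) => x; rewrite exprMn.
Qed.

Lemma l2D f g : l2 f -> l2 g -> l2 (fun x => f x + g x).
Proof.
move=> lf lg; split; first by apply: measurable_funD; [exact: lf.1|exact: lg.1].
apply: ig_eq (igD (igD lf.2 (igZ 2 (l2_mul lf lg))) lg.2) => x; ring.
Qed.

Lemma l2B f g : l2 f -> l2 g -> l2 (fun x => f x - g x).
Proof.
move=> lf lg; have [m i] := l2D lf (l2Z (-1) lg).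
by have E : (fun x => f x + -1 * g x) = (fun x => f x - g x)
  by [apply/funext => x; rewrite mulN1r]; rewrite -E.
Qed.

Lemma l2_Mbd (M : R) f g : l2 f -> measurable_fun setT g ->
  (forall x, `|g x| <= M) -> l2 (fun x => f x * g x).
Proof.
move=> [mf f2] mg gM; split; first exact: measurable_funM.
have M0 : 0 <= M by apply: le_trans (gM 0).
have H : ig mu (fun x => f x ^+ 2 * g x ^+ 2).
  apply: (ig_Mbd (M := M ^+ 2)) => //; first exact: measurable_funX.
  by move=> x; rewrite normrX lerXn2r ?nnegrE.
by apply: ig_eq H => x; rewrite exprMn.
Qed.

Lemma l2_le f g : measurable_fun setT f -> l2 g ->
  (forall x, `|f x| <= `|g x|) -> l2 f.
Proof.
move=> mf [mg g2] fg; split => //; apply: ig_le g2 _; first exact: measurable_funX.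
by move=> x; rewrite normrX -(real_normK (num_real (g x))) lerXn2r ?nnegrE.
Qed.

Lemma ig_bd_l2 (M : R) f : ig mu f -> (forall x, `|f x| <= M) -> l2 f.
Proof.
move=> if_ fM; split; first exact: ig_meas if_.
by apply: ig_eq (ig_Mbd if_ (ig_meas if_) fM) => x; rewrite expr2.
Qed.

Lemma cauchy_schwarz_int f g : l2 f -> l2 g ->
  (\int[mu]_x (f x * g x)) ^+ 2 <=
  (\int[mu]_x (f x ^+ 2)) * (\int[mu]_x (g x ^+ 2)).
Proof.
move=> lf lg; set a := \int[mu]_x (f x ^+ 2); set c := \int[mu]_x (g x ^+ 2).
set b := \int[mu]_x (f x * g x).
have q t : 0 <= a + (t * b) *+ 2 + t ^+ 2 * c.
  have -> : a + (t * b) *+ 2 + t ^+ 2 * c = \int[mu]_x ((f x + t * g x) ^+ 2).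
    transitivity (\int[mu]_x (f x ^+ 2 + (t * 2) * (f x * g x) + t ^+ 2 * g x ^+ 2)).
      rewrite intD; [|exact: igD lf.2 (igZ _ (l2_mul lf lg))|exact: igZ lg.2].
      rewrite intD; [|exact: lf.2|exact: igZ (l2_mul lf lg)].
      rewrite !intZ; [|exact: lg.2|exact: l2_mul].
      by rewrite -/a -/b -/c; ring.
    by apply: eq_int => x; ring.
  by apply: int_ge0 => x; exact: sqr_ge0.
have a0 : 0 <= a by apply: int_ge0 => x; exact: sqr_ge0.
have c0 : 0 <= c by apply: int_ge0 => x; exact: sqr_ge0.
have [c_eq0|c_neq0] := eqVneq c 0; last first.
  have cp : 0 < c by rewrite lt_def c_neq0.
  have := mulr_ge0 (q (- b / c)) c0.
  have -> : (a + (- b / c * b) *+ 2 + (- b / c) ^+ 2 * c) * c = a * c - b ^+ 2 by field.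
  by rewrite subr_ge0.
have [->|b0] := eqVneq b 0; first by rewrite expr0n /= mulr_ge0.
have := q (- (a + 1) / b); rewrite c_eq0 mulr0 addr0 divfK //.
lra.
Qed.

Lemma l2_bound (A B : R) f g : l2 f -> l2 g ->
  \int[mu]_x (f x ^+ 2) <= A ^+ 2 -> \int[mu]_x (g x ^+ 2) <= B ^+ 2 ->
  0 <= A -> 0 <= B -> `|\int[mu]_x (f x * g x)| <= A * B.
Proof.
move=> lf lg fA gB A0 B0; rewrite -(@ler_pXn2r _ 2) ?nnegrE ?mulr_ge0 //.
rewrite real_normK ?num_real // exprMn; apply: le_trans (cauchy_schwarz_int lf lg) _.
by apply: ler_pM => //; apply: int_ge0 => x; exact: sqr_ge0.
Qed.

Lemma int_restrict (A : set R) f : \int[mu]_(x in A) f x = \int[mu]_x (f x * \1_A x).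
Proof.
rewrite Rintegral_mkcond; apply: eq_Rintegral => x _.
by rewrite /patch indicE; case: (x \in A); rewrite ?mulr1 ?mulr0.
Qed.

Lemma ig_restrict (A : set R) f : measurable A ->
  mu.-integrable A (EFin \o f) <-> ig mu (fun x => f x * \1_A x).
Proof.
move=> mA; have E : (EFin \o f) \_ A = EFin \o (fun x => f x * \1_A x).
  apply/funext => x; rewrite /patch /= indicE.
  by case: (x \in A); rewrite ?mulr1 ?mulr0.
have mA' : measurable (A : set (measurableTypeR R)) by [].
split=> [/(integrable_mkcond _ mA')|H]; first by rewrite E.
by apply/(integrable_mkcond _ mA'); rewrite E.
Qed.

Lemma indic_le1 (A : set R) x : `|\1_A x : R| <= 1.
Proof. by rewrite indicE; case: (_ \in _); rewrite ?normr1 ?normr0. Qed.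

Lemma ig_indic (A : set R) f : measurable A -> ig mu f -> ig mu (fun x => f x * \1_A x).
Proof.
move=> mA if_; apply: (ig_Mbd (M := 1) if_); first exact: measurable_indic.
exact: indic_le1.
Qed.

Lemma meas_indic (A : set R) : measurable A -> measurable_fun setT (\1_A : R -> R).
Proof. by move=> mA; exact: measurable_indic. Qed.

Lemma l2_indic (A : set R) f : measurable A -> l2 f -> l2 (fun x => f x * \1_A x).
Proof. by move=> mA lf; apply: (l2_Mbd lf (meas_indic mA)) => x; exact: indic_le1. Qed.

Lemma ig_itv (a b : R) f : {within `[a, b], continuous f} ->
  ig mu (fun x => f x * \1_`[a, b] x).
Proof.
move=> cf; apply: (ig_restrict f (measurable_itv `[a, b])).1.
exact: (continuous_compact_integrable (@segment_compact _ a b) cf).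
Qed.

Lemma FTC_itv (f F : R -> R) a b : a <= b -> {within `[a, b], continuous f} ->
  (forall x, a <= x <= b -> is_derive x 1 F (f x)) ->
  \int[mu]_(x in `[a, b]) f x = F b - F a.
Proof.
rewrite le_eqVlt => /predU1P[<- _ _|ab cf dF].
  by rewrite set_itv1 Rintegral_set1 subrr.
have cF x : a <= x <= b -> F y @[y --> x] --> F x.
  by move=> /dF d; apply: differentiable_continuous; apply/derivable1_diffP.
rewrite /Rintegral (@continuous_FTC2 _ f F) //.
  split.
  - by move=> x; rewrite in_itv/= => /andP[ax xb]; have := dF x; rewrite !ltW // => /(_ isT) d.
  - by apply: cvg_at_right_filter; apply: cF; rewrite lexx ltW.
  - by apply: cvg_at_left_filter; apply: cF; rewrite lexx ltW.
move=> x; rewrite in_itv/= => /andP[ax xb]; rewrite derive1E.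
by have := dF x; rewrite !ltW // => /(_ isT) d; rewrite derive_val.
Qed.

Lemma even_FTC (f F : R -> R) (l : R) : continuous f -> (forall x, 0 <= f x) ->
  (forall x, f (- x) = f x) -> (forall x : R, 0 <= x -> is_derive x 1 F (f x)) ->
  F x @[x --> +oo%R] --> l -> ig mu f /\ \int[mu]_x f x = 2 * (l - F 0).
Proof.
move=> cf f0 ef dF Fl.
have E : (\int[mu]_x (f x)%:E = (2 * (l - F 0))%:E)%E.
  rewrite ge0_symfun_integralT //; last by move=> x; rewrite /= ef.
  rewrite -set_itvcy (@ge0_continuous_FTC2y _ f F 0 l) //.
  - by apply: continuous_subspaceT => x; exact: cf.
  - by move=> x x0; have := dF x (ltW x0) => d.
  - apply: cvg_at_right_filter; apply: differentiable_continuous.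
    by apply/derivable1_diffP; have := dF 0 (lexx _) => d.
  - by move=> x; rewrite in_itv/= andbT derive1E => /ltW/dF d; rewrite derive_val.
have if_ : ig mu f by apply: ge0_igP => //; [exact: cont_meas|rewrite E ltry].
by split => //; apply: EFin_inj; rewrite -ig_EFin.
Qed.

End square_integrable.

Section derivatives.
Context {R : realType}.
Implicit Types (f g : R -> R) (x a b : R).

Lemma derD f g x a b : is_derive x 1 f a -> is_derive x 1 g b ->
  is_derive x 1 (fun y => f y + g y) (a + b).
Proof. by move=> fa gb; exact: is_deriveD. Qed.

Lemma derB f g x a b : is_derive x 1 f a -> is_derive x 1 g b ->
  is_derive x 1 (fun y => f y - g y) (a - b).
Proof. by move=> fa gb; exact: is_deriveB. Qed.

Lemma derM f g x a b : is_derive x 1 f a -> is_derive x 1 g b ->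
  is_derive x 1 (fun y => f y * g y) (f x * b + a * g x).
Proof. by move=> fa gb; apply: is_derive_eq; rewrite [a * _]mulrC. Qed.

Lemma derZ c f x a : is_derive x 1 f a -> is_derive x 1 (fun y => c * f y) (c * a).
Proof. by move=> fa; exact: is_deriveZ. Qed.

Lemma derC c x : is_derive x 1 (fun=> c : R) 0.
Proof. exact: is_derive_cst. Qed.

Lemma derI x : is_derive x 1 (fun y : R => y) 1.
Proof. exact: is_derive_id. Qed.

Lemma derComp f g x a b : is_derive (g x) 1 f a -> is_derive x 1 g b ->
  is_derive x 1 (fun y => f (g y)) (a * b).
Proof. by move=> fa gb; have := is_derive1_comp fa gb; rewrite mulrC. Qed.

Lemma der_eq f x a b : is_derive x 1 f a -> a = b -> is_derive x 1 f b.
Proof. by move=> d <-. Qed.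

Lemma derN f x a : is_derive x 1 f a -> is_derive x 1 (fun y => - f y) (- a).
Proof. by move=> fa; exact: is_deriveN. Qed.

Lemma der_cont f x a : is_derive x 1 f a -> {for x, continuous f}.
Proof. by move=> d; apply: differentiable_continuous; apply/derivable1_diffP. Qed.

End derivatives.

Section hartley_kernel.
Context {R : realType}.
Local Notation mu := (@lebesgue_measure R).
Implicit Types (f g h : R -> R) (x y z d : R).

Definition cas x := cos x + sin x.

Lemma cas_le2 x : `|cas x| <= 2.
Proof.
rewrite (le_trans (ler_normD _ _)) // (_ : 2 = 1 + 1) // lerD //.
  by rewrite ler_norml cos_geN1 cos_le1.
by rewrite ler_norml sin_geN1 sin_le1.
Qed.

Lemma cas_cont : continuous cas.
Proof. by move=> x; apply: cvgD; [exact: continuous_cos|exact: continuous_sin]. Qed.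

Lemma cas_meas : measurable_fun setT cas.
Proof. exact: cont_meas cas_cont. Qed.

Lemma casM x y : cas x * cas y = cos (x - y) + sin (x + y).
Proof. rewrite /cas cosB sinD; ring. Qed.

Lemma cas_der x : is_derive x 1 cas (cas (- x)).
Proof.
have H : is_derive x 1 cas (- sin x + cos x) := derD (is_derive_cos x) (is_derive_sin x).
apply: is_derive_eq.
by rewrite /cas cosN sinN addrC.
Qed.

Definition phi d x := expR (- (d * `|x|)).
Definition pois d z := 2 * d / (d ^+ 2 + z ^+ 2).

Lemma phi_gt0 d x : 0 < phi d x. Proof. exact: expR_gt0. Qed.

Lemma phi_le1 d x : 0 < d -> phi d x <= 1.
Proof. by move=> d0; rewrite -expR0 ler_expR oppr_le0 mulr_ge0 // ltW. Qed.

Lemma phi_cont d : continuous (phi d).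
Proof.
move=> x; apply: continuous_comp; last exact: continuous_expR.
apply: cvgN; apply: cvgM; first exact: cvg_cst.
exact: norm_continuous.
Qed.

Lemma phi_meas d : measurable_fun setT (phi d).
Proof. exact: cont_meas (@phi_cont d). Qed.

Lemma expR_dcay d : 0 < d -> expR (- (d * x)) @[x --> +oo%R] --> (0 : R).
Proof.
move=> d0; apply: (@cvg_comp _ _ _ (fun x => d * x) (fun y => expR (- y)) _ +oo%R); last exact: cvgr_expR.
by apply: gt0_cvgMry => //; exact: cvg_id.
Qed.

Lemma sin_bd x : `|sin x| <= 1. Proof. by rewrite ler_norml sin_geN1 sin_le1. Qed.
Lemma cos_bd x : `|cos x| <= 1. Proof. by rewrite ler_norml cos_geN1 cos_le1. Qed.

Let G d z x := expR (- (d * x)) * (z * sin (x * z) - d * cos (x * z)) / (d ^+ 2 + z ^+ 2).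

Let dz_gt0 d z : 0 < d -> 0 < d ^+ 2 + z ^+ 2.
Proof. by move=> d0; rewrite ltr_pwDl ?exprn_gt0 // sqr_ge0. Qed.

Let expd d x : is_derive x 1 (fun y => expR (- (d * y))) (expR (- (d * x)) * - d).
Proof.
apply: (@derComp _ expR (fun y => - (d * y))).
by apply: (der_eq (derN (derZ d (derI x)))); rewrite mulr1.
Qed.

Let G_der d z x : 0 < d -> is_derive x 1 (G d z) (expR (- (d * x)) * cos (x * z)).
Proof.
move=> d0; have D := dz_gt0 z d0.
have dxz : is_derive x 1 (fun y => y * z) z.
  by apply: (der_eq (derM (derI x) (derC z x))); rewrite mulr0 add0r mul1r.
have ds := @derComp _ sin (fun y => y * z) _ _ _ (is_derive_sin (x * z)) dxz.
have dc := @derComp _ cos (fun y => y * z) _ _ _ (is_derive_cos (x * z)) dxz.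
have H := derM (derM (expd d x) (derB (derZ z ds) (derZ d dc))) (derC ((d ^+ 2 + z ^+ 2)^-1) x).
apply: (der_eq H).
by field; rewrite gt_eqF.
Qed.

Let G_lim d z : 0 < d -> G d z x @[x --> +oo%R] --> (0 : R).
Proof.
move=> d0; have D := dz_gt0 z d0.
pose C := (`|z| + d) / (d ^+ 2 + z ^+ 2).
have H : C * expR (- (d * x)) @[x --> +oo%R] --> (0 : R).
  by rewrite -(mulr0 C); apply: cvgMr; exact: expR_dcay.
apply: norm_cvg0; apply: (@squeeze_cvgr _ _ _ _ (fun=> 0) (fun x => C * expR (- (d * x)))) => //.
  apply: nearW => x; rewrite normr_ge0 /=.
  rewrite /G !normrM normfV (gtr0_norm D) (gtr0_norm (expR_gt0 _)) /C.
  rewrite [leRHS]mulrC mulrA ler_pM2r ?invr_gt0 // ler_pM2l ?expR_gt0 //.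
  apply: le_trans (ler_normB _ _) _; rewrite !normrM (gtr0_norm d0) lerD //.
    by rewrite -[leRHS]mulr1 ler_wpM2l ?sin_bd.
  by rewrite -[leRHS]mulr1 ler_wpM2l ?cos_bd // ltW.
exact: cvg_cst.
Qed.

Lemma phi_int d : 0 < d -> ig mu (phi d) /\ \int[mu]_x phi d x = 2 / d.
Proof.
move=> d0; have [|||||] := @even_FTC _ (phi d) (fun x => - d^-1 * expR (- (d * x))) 0.
- exact: phi_cont.
- by move=> x; apply/ltW/phi_gt0.
- by move=> x; rewrite /phi normrN.
- move=> x x0; apply: (der_eq (derZ _ (expd d x))).
  by rewrite /phi ger0_norm //; field; rewrite gt_eqF.
- by rewrite -(mulr0 (- d^-1)); apply: cvgMr; exact: expR_dcay.
move=> ? ->; split => //; rewrite mulr0 oppr0 expR0; field; rewrite gt_eqF //.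
Qed.

Lemma phi_cos d z : 0 < d -> \int[mu]_x (phi d x * cos (x * z)) = pois d z.
Proof.
move=> d0; have [ip Ip] := phi_int d0; have D := dz_gt0 z d0.
have mc : measurable_fun setT (fun x : R => cos (x * z)).
  apply: cont_meas => x; apply: continuous_comp; last exact: continuous_cos.
  by apply: cvgM; [exact: cvg_id|exact: cvg_cst].
have ic : ig mu (fun x => phi d x * cos (x * z)).
  by apply: (ig_Mbd (M := 1)) => // x; exact: cos_bd.
have [|||||] := @even_FTC _ (fun x => phi d x + phi d x * cos (x * z))
    (fun x => - d^-1 * expR (- (d * x)) + G d z x) (0 + 0).
- move=> x; apply: cvgD; first exact: phi_cont.
  apply: cvgM; first exact: phi_cont.
  apply: continuous_comp; last exact: continuous_cos.
  by apply: cvgM; [exact: cvg_id|exact: cvg_cst].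
- move=> x; have := phi_gt0 d x; have := cos_geN1 (x * z); nra.
- by move=> x; rewrite /phi normrN mulNr cosN.
- move=> x x0; apply: (der_eq (derD (derZ _ (expd d x)) (G_der z x d0))).
  by rewrite /phi ger0_norm //; congr (_ + _); field; rewrite gt_eqF.
- apply: cvgD; last exact: G_lim.
  by rewrite -(mulr0 (- d^-1)); apply: cvgMr; exact: expR_dcay.
move=> _; rewrite intD // Ip /G mulr0 oppr0 expR0 mul0r sin0 cos0 => E.
have sol (a b c : R) : a + b = c -> b = c - a by move=> <-; ring.
rewrite (sol _ _ _ E).
rewrite /pois; field; rewrite !gt_eqF //.
Qed.

Lemma phi_sin d z : 0 < d -> \int[mu]_x (phi d x * sin (x * z)) = 0.
Proof.
move=> d0; have [ip _] := phi_int d0.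
have ms : measurable_fun setT (fun x : R => sin (x * z)).
  apply: cont_meas => x; apply: continuous_comp; last exact: continuous_sin.
  by apply: cvgM; [exact: cvg_id|exact: cvg_cst].
have is_ : ig mu (fun x => phi d x * sin (x * z)).
  by apply: (ig_Mbd (M := 1)) => // x; exact: sin_bd.
have := int_opp is_; under eq_int => x do rewrite /phi normrN mulNr sinN mulrN.
rewrite intN // => E; lra.
Qed.

Lemma phi_cas d y z : 0 < d -> \int[mu]_x (phi d x * (cas (x * y) * cas (x * z))) = pois d (y - z).
Proof.
move=> d0; have [ip _] := phi_int d0.
have ic : ig mu (fun x => phi d x * cos (x * (y - z))).
  apply: (ig_Mbd (M := 1)) => //; last by move=> x; exact: cos_bd.
  apply: cont_meas => x; apply: continuous_comp; last exact: continuous_cos.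
  by apply: cvgM; [exact: cvg_id|exact: cvg_cst].
have is_ : ig mu (fun x => phi d x * sin (x * (y + z))).
  apply: (ig_Mbd (M := 1)) => //; last by move=> x; exact: sin_bd.
  apply: cont_meas => x; apply: continuous_comp; last exact: continuous_sin.
  by apply: cvgM; [exact: cvg_id|exact: cvg_cst].
transitivity (\int[mu]_x (phi d x * cos (x * (y - z)) + phi d x * sin (x * (y + z)))).
  apply: eq_int => x; rewrite casM -mulrBr -[x * y + x * z]mulrDr; exact: mulrDr.
by rewrite intD // phi_cos // phi_sin // addr0.
Qed.

Lemma pois_ge0 d z : 0 < d -> 0 <= pois d z.
Proof. by move=> d0; rewrite /pois divr_ge0 ?mulr_ge0 ?ltW // dz_gt0. Qed.

Lemma pois_cont d : 0 < d -> continuous (pois d).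
Proof.
move=> d0 z; apply: cvgM; first exact: cvg_cst.
apply: cvgV; first by rewrite gt_eqF // dz_gt0.
apply: cvgD; first exact: cvg_cst.
by apply: cvgM; exact: cvg_id.
Qed.

Lemma pois_bd d z : 0 < d -> `|pois d z| <= 2 / d.
Proof.
move=> d0; rewrite ger0_norm ?pois_ge0 // /pois ler_pdivrMr ?dz_gt0 //.
rewrite mulrAC ler_pdivlMr //; have := sqr_ge0 z; nra.
Qed.

Lemma pois_int d : 0 < d -> ig mu (pois d) /\ \int[mu]_x pois d x = 2 * pi.
Proof.
move=> d0; have [|||||] := @even_FTC _ (pois d) (fun x => 2 * atan (x / d)) pi.
- exact: pois_cont.
- by move=> x; exact: pois_ge0.
- by move=> x; rewrite /pois sqrrN.
- move=> x x0.
  have H := derZ 2 (@derComp _ atan (fun y => y / d) _ _ _ (is_derive1_atan (x / d)) (derM (derI x) (derC d^-1 x))).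
  apply: (der_eq H).
  have := dz_gt0 x d0 => D.
  rewrite /pois; field; rewrite !gt_eqF //=.
- rewrite (_ : pi = 2 * (pi / 2)); last by field.
  apply: cvgMr; apply: (@cvg_comp _ _ _ (fun x => x / d) atan _ +oo%R); last exact: cvgy_atan.
  by apply: gt0_cvgMly; [rewrite invr_gt0|exact: cvg_id].
by move=> ? ->; split => //; rewrite mul0r atan0 mulr0 subr0.
Qed.

End hartley_kernel.

Section hartley.
Context {R : realType}.
Local Notation mu := (@lebesgue_measure R).
Local Notation RR := (measurableTypeR R * measurableTypeR R)%type.
Implicit Types (f g h : R -> R) (x y z d : R).

(* The Hartley transform, a real-valued substitute for the Fourier transform. *)
Definition T h x := \int[mu]_xi (h xi * cas (x * xi)).

Lemma casx_cont x : continuous (fun y => cas (x * y)).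
Proof.
move=> y; apply: continuous_comp; last exact: cas_cont.
by apply: cvgM; [exact: cvg_cst|exact: cvg_id].
Qed.

Lemma casx_meas x : measurable_fun setT (fun y => cas (x * y)).
Proof. exact: cont_meas (@casx_cont x). Qed.

Lemma ig_cas h x : ig mu h -> ig mu (fun xi => h xi * cas (x * xi)).
Proof.
by move=> ih; apply: (ig_Mbd (M := 2)) => //; [exact: casx_meas|move=> ?; exact: cas_le2].
Qed.

Lemma T_bd h x : ig mu h -> `|T h x| <= 2 * \int[mu]_xi `|h xi|.
Proof.
move=> ih; rewrite -intZ; last exact: ig_norm.
apply: le_norm_int_le; [exact: ig_cas|exact/igZ/ig_norm|].
by move=> xi; rewrite normrM mulrC ler_wpM2r // cas_le2.
Qed.

Lemma T_cont h : ig mu h -> continuous (T h).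
Proof.
move=> ih x; apply/(@cvg_nbhsP _ R^o) => w wx.
have [] := @int_cvg _ _ _ mu (fun n xi => h xi * cas (w n * xi))
    (fun xi => h xi * cas (x * xi)) (fun xi => 2 * `|h xi|) => //.
- by move=> n; exact: ig_meas (ig_cas (w n) ih).
- move=> xi; apply: cvgMr.
  apply: (@continuous_cvg _ _ _ _ _ _ (fun y => cas (y * xi))) => //.
  apply: continuous_comp; last exact: cas_cont.
  by apply: cvgM; [exact: cvg_id|exact: cvg_cst].
- exact/igZ/ig_norm.
- by move=> n xi; rewrite normrM mulrC ler_wpM2r // cas_le2.
Qed.

Lemma T_meas h : ig mu h -> measurable_fun setT (T h).
Proof. by move=> ih; apply: cont_meas; exact: T_cont. Qed.

Lemma TD f g x : ig mu f -> ig mu g -> T (fun xi => f xi + g xi) x = T f x + T g x.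
Proof.
move=> if_ ig_; rewrite /T -intD; [|exact: ig_cas..].
by apply: eq_int => xi; rewrite mulrDl.
Qed.

Lemma TB f g x : ig mu f -> ig mu g -> T (fun xi => f xi - g xi) x = T f x - T g x.
Proof.
move=> if_ ig_; rewrite /T -intB; [|exact: ig_cas..].
by apply: eq_int => xi; rewrite mulrBl.
Qed.

Lemma TZ c f x : ig mu f -> T (fun xi => c * f xi) x = c * T f x.
Proof.
move=> if_; rewrite /T -intZ; last exact: ig_cas.
by apply: eq_int => xi; rewrite mulrA.
Qed.

Lemma T_opp h x : ig mu h -> T (fun xi => h (- xi)) x = T h (- x).
Proof.
move=> ih; rewrite /T -(int_opp (ig_cas (- x) ih)).
by apply: eq_int => xi; rewrite mulrNN.
Qed.

Lemma meas_cas2 : measurable_fun [set: RR] (fun z : RR => cas (z.1 * z.2)).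
Proof.
apply: (measurableT_comp cas_meas).
by apply: measurable_funM; [exact: measurable_fst|exact: measurable_snd].
Qed.

Lemma T_selfadj h f : ig mu h -> ig mu f ->
  \int[mu]_x (T h x * f x) = \int[mu]_xi (h xi * T f xi).
Proof.
move=> ih if_; pose k (z : RR) := f z.1 * (h z.2 * cas (z.1 * z.2)).
have mk : measurable_fun setT k.
  apply: measurable_funM; first exact: (measurableT_comp (ig_meas if_) measurable_fst).
  apply: measurable_funM; last exact: meas_cas2.
  exact: (measurableT_comp (ig_meas ih) measurable_snd).
have ik : ig (mu \x mu)%E k.
  apply: (ig2_le mk (igZ 2 (ig_norm if_)) (ig_norm ih)) => x y.
  rewrite /k /= !normrM -mulrA [leRHS]mulrC -mulrA ler_wpM2l // ler_wpM2l //.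
  exact: cas_le2.
have E := fubini_int ik (fun x => igZ (f x) (ig_cas x ih)) _.
transitivity (\int[mu]_x \int[mu]_y k (x, y)).
  by apply: eq_int => x; rewrite /k /= (intZ _ (ig_cas x ih)) mulrC.
have kE y x : h y * (f x * cas (y * x)) = k (x, y).
  by rewrite /k /= (mulrC y x); ring.
rewrite E; last by move=> y; apply: ig_eq (igZ (h y) (ig_cas y if_)) => x; exact: kE.
apply: eq_int => y; rewrite /T -(intZ _ (ig_cas y if_)).
by apply: eq_int => x; rewrite kE.
Qed.

Section regularized.
Variables (h : R -> R) (d : R).
Hypotheses (ih : ig mu h) (d0 : 0 < d).

Let ip := (phi_int d0).1.

Lemma ig_Tphi : ig mu (fun x => T h x * phi d x).
Proof.
apply: ig_eq (ig_Mbd ip (T_meas ih) (fun x => T_bd x ih)) => x.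
by rewrite mulrC.
Qed.

Lemma T_Tphi y : T (fun x => T h x * phi d x) y = \int[mu]_z (h z * pois d (y - z)).
Proof.
have if_ : ig mu (fun x => phi d x * cas (y * x)) by exact: ig_cas.
transitivity (\int[mu]_x (T h x * (phi d x * cas (y * x)))).
  by apply: eq_int => x; rewrite mulrA.
rewrite T_selfadj //; apply: eq_int => z; congr (_ * _).
rewrite -phi_cas //; apply: eq_int => x.
by rewrite (mulrC y) (mulrC z) mulrA.
Qed.

Lemma T_phi_form g : ig mu g ->
  \int[mu]_x (T g x * (T h x * phi d x)) =
  \int[mu]_y (g y * \int[mu]_z (h z * pois d (y - z))).
Proof.
move=> ig_; rewrite (T_selfadj ig_ ig_Tphi).
by apply: eq_int => y; rewrite T_Tphi.
Qed.

Lemma conv_pois_cont : continuous (fun y => \int[mu]_z (h z * pois d (y - z))).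
Proof.
rewrite (_ : (fun y => _) = T (fun x => T h x * phi d x)).
  exact: T_cont ig_Tphi.
by apply/funext => y; rewrite T_Tphi.
Qed.

Lemma ig_pois y : ig mu (fun z => pois d (y - z)) /\
  \int[mu]_z pois d (y - z) = 2 * pi.
Proof.
have [ipo Ipo] := pois_int d0.
by split; [exact: ig_refl|rewrite int_refl].
Qed.

Lemma pois_refl_cont y : continuous (fun z => pois d (y - z)).
Proof.
move=> z; apply: (@continuous_comp _ _ _ (fun z => y - z) (pois d)); last exact: pois_cont.
by apply: cvgB; [exact: cvg_cst|exact: cvg_id].
Qed.

Lemma ig_Mpois y : ig mu (fun z => h z * pois d (y - z)).
Proof.
apply: (ig_Mbd (M := 2 / d)) => //; first exact: cont_meas (@pois_refl_cont y).
by move=> z; exact: pois_bd.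
Qed.

Lemma conv_pois_bd y : `|\int[mu]_z (h z * pois d (y - z))| <= \int[mu]_z (2 / d * `|h z|).
Proof.
apply: le_norm_int_le; [exact: ig_Mpois|exact/igZ/ig_norm|].
by move=> z; rewrite normrM mulrC ler_wpM2r // pois_bd.
Qed.

Lemma conv_pois_int : (forall x, 0 <= h x) ->
  ig mu (fun y => \int[mu]_z (h z * pois d (y - z))) /\
  \int[mu]_y \int[mu]_z (h z * pois d (y - z)) = 2 * pi * \int[mu]_z h z.
Proof.
move=> h0; pose k (z : RR) := h z.1 * pois d (z.2 - z.1).
have mk : measurable_fun setT k.
  apply: measurable_funM; first exact: (measurableT_comp (ig_meas ih) measurable_fst).
  apply: (measurableT_comp (cont_meas (pois_cont d0))).
  by apply: measurable_funB; [exact: measurable_snd|exact: measurable_fst].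
have sw z y : pois d (y - z) = pois d (z - y) by rewrite /pois -(opprB z y) sqrrN.
have k1 z : ig mu (fun y => k (z, y)).
  by rewrite /k /=; apply: igZ; apply: ig_eq (ig_pois z).1 => y; rewrite sw.
have K1 z : \int[mu]_y k (z, y) = 2 * pi * h z.
  rewrite /k /= intZ; last by apply: ig_eq (ig_pois z).1 => y; rewrite sw.
  by rewrite mulrC; under eq_int => y do rewrite sw; rewrite (ig_pois z).2.
have ik : ig (mu \x mu)%E k.
  apply: (ig2_ge0 mk) => //; first by move=> z; rewrite mulr_ge0 // pois_ge0.
  by apply: ig_eq (igZ (2 * pi) ih) => z; rewrite K1.
have [i1 I1] := fubini1 ik k1; have [i2 I2] := fubini2 ik (fun y => ig_Mpois y).
split; first exact: i2.
rewrite I2 -I1; under eq_int => z do rewrite K1.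
by rewrite intZ.
Qed.

End regularized.

Lemma bessel h : ig mu h -> l2 h ->
  l2 (T h) /\ \int[mu]_x (T h x ^+ 2) <= 2 * pi * \int[mu]_x (h x ^+ 2).
Proof.
move=> ih lh; have [mh h2] := lh.
have B d : 0 < d -> \int[mu]_x (T h x ^+ 2 * phi d x) <= 2 * pi * \int[mu]_x (h x ^+ 2).
  move=> d0; have [i2 I2] := conv_pois_int h2 d0 (fun x => sqr_ge0 _).
  rewrite (_ : \int[mu]_x _ = \int[mu]_x (T h x * (T h x * phi d x))); last first.
    by apply: eq_int => x; rewrite expr2 mulrA.
  rewrite T_phi_form //.
  apply: (@le_trans _ _ (\int[mu]_y (pi * h y ^+ 2 + 2^-1 * \int[mu]_z (h z ^+ 2 * pois d (y - z))))).
    apply: le_int.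
    - apply: (ig_Mbd ih); first exact: cont_meas (conv_pois_cont ih d0).
      by move=> y; exact: conv_pois_bd.
    - by apply: igD; exact: igZ.
    move=> y; have [ipo Ipo] := ig_pois d0 y.
    rewrite -intZ; last exact: ig_Mpois.
    rewrite (_ : pi * h y ^+ 2 = 2^-1 * h y ^+ 2 * \int[mu]_z pois d (y - z)); last by rewrite Ipo; field.
    rewrite -!intZ //; last exact: ig_Mpois.
    rewrite -intD; [|exact: igZ|exact/igZ/ig_Mpois].
    apply: le_int; [exact/igZ/ig_Mpois|by apply: igD; [exact: igZ|exact/igZ/ig_Mpois]|].
    move=> z; have := pois_ge0 (y - z) d0; have := sqr_ge0 (h y - h z).
    set p := pois _ _; nra.
  by rewrite intD ?intZ ?I2 //; [rewrite le_eqVlt; apply/orP; left; apply/eqP; field|exact: igZ|exact: igZ].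
have [iT IT] : ig mu (fun x => T h x ^+ 2) /\ \int[mu]_x (T h x ^+ 2) <= 2 * pi * \int[mu]_x (h x ^+ 2).
  apply: (@int_fatou _ _ _ mu (fun n x => T h x ^+ 2 * phi (harmonic n) x)).
  - move=> n; have n0 : 0 < harmonic n :> R by rewrite /harmonic invr_gt0.
    apply: ig_eq (ig_Mbd (ig_Tphi ih n0) (T_meas ih) (fun x => T_bd x ih)) => x.
    by rewrite expr2 mulrAC.
  - by move=> n x; rewrite mulr_ge0 ?sqr_ge0 // ltW // phi_gt0.
  - move=> x; rewrite -[X in _ --> X]mulr1; apply: cvgMr.
    rewrite -expR0 -oppr0 -(mul0r `|x|).
    apply: (@continuous_cvg _ _ _ _ _ _ (fun y => expR (- (y * `|x|)))); last exact: cvg_harmonic.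
    apply: continuous_comp; last exact: continuous_expR.
    by apply: cvgN; apply: cvgM; [exact: cvg_id|exact: cvg_cst].
  - by move=> n; apply: B; rewrite /harmonic invr_gt0.
by split => //; split => //; exact: T_meas.
Qed.

End hartley.

Section skew_adjointness.
Context {R : realType}.
Local Notation mu := (@lebesgue_measure R).
Local Notation RR := (measurableTypeR R * measurableTypeR R)%type.
Implicit Types (f g h : R -> R) (x y d : R).

Lemma harmonic_gt0 n : 0 < harmonic n :> R.
Proof. by rewrite /harmonic invr_gt0. Qed.

Lemma harmonic_le1 n : harmonic n <= 1 :> R.
Proof. by rewrite /harmonic invf_le1 // ler1n. Qed.

Lemma phi_harmonic x : phi (harmonic n) x @[n --> \oo] --> (1 : R).
Proof.
rewrite -[X in _ --> X]expR0 -oppr0 -(mul0r `|x|).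
apply: (@continuous_cvg _ _ _ _ _ _ (fun y => expR (- (y * `|x|)))); last exact: cvg_harmonic.
apply: continuous_comp; last exact: continuous_expR.
by apply: cvgN; apply: cvgM; [exact: cvg_id|exact: cvg_cst].
Qed.

Lemma pois_harmonic z : z != 0 -> pois (harmonic n) z @[n --> \oo] --> (0 : R).
Proof.
move=> z0; have -> : 0 = pois 0 z by rewrite /pois mulr0 mul0r.
apply: (@continuous_cvg _ _ _ _ _ _ (fun d => pois d z)); last exact: cvg_harmonic.
apply: cvgM; first by apply: cvgM; [exact: cvg_cst|exact: cvg_id].
apply: cvgV; first by rewrite expr0n /= add0r sqrf_eq0.
by apply: cvgD; [apply: cvgM; exact: cvg_id|exact: cvg_cst].
Qed.

Lemma norm_pois_le1 d z : 0 < d -> `|z| * pois d z <= 1.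
Proof.
move=> d0; rewrite /pois mulrA ler_pdivrMr; last by rewrite ltr_pwDl ?exprn_gt0 // sqr_ge0.
rewrite mul1r -(real_normK (num_real z)); have := sqr_ge0 (d - `|z|); nra.
Qed.

Lemma sgn_sqr_bd y z : `|y * `|y| + z * `|z| | <= `|y + z| * (`|y| + `|z|).
Proof.
have [y0|y0] := leP 0 y; have [z0|z0] := leP 0 z.
- by rewrite !ger0_norm ?addr_ge0 ?mulr_ge0 //; nra.
- rewrite (ger0_norm y0) (ltr0_norm z0).
  have -> : y * y + z * - z = (y + z) * (y - z) by ring.
  by rewrite normrM ler_wpM2l // ger0_norm //; nra.
- rewrite (ger0_norm z0) (ltr0_norm y0).
  have -> : y * - y + z * z = (y + z) * (z - y) by ring.
  by rewrite normrM ler_wpM2l // ger0_norm //; nra.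
- rewrite (ltr0_norm y0) (ltr0_norm z0) (ltr0_norm (_ : y + z < 0)); last by lra.
  by rewrite ltr0_norm; nra.
Qed.

(* Hartley form of the skew-adjointness of the operator with symbol xi |xi| *)
Lemma T_skew h : ig mu h -> l2 h -> ig mu (fun xi => xi * h xi) ->
  ig mu (fun xi => xi * `|xi| * h xi) -> l2 (fun xi => xi * `|xi| * h xi) ->
  \int[mu]_x (T h x * T (fun xi => xi * `|xi| * h xi) (- x)) = 0.
Proof.
move=> ih lh i1 ig_ lg; set g := fun xi => _ in ig_ lg *.
have gE xi : g xi = xi * `|xi| * h xi by [].
clearbody g.
pose gm xi := g (- xi); have igm : ig mu gm by exact: ig_opp.
have Tg x : T g (- x) = T gm x by rewrite -T_opp.
have lTh := (bessel ih lh).1.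
have lTg : l2 (T gm).
  have [m i] := (bessel ig_ lg).1.
  split; first exact: T_meas.
  by apply: ig_eq (ig_opp i) => x; rewrite Tg.
have iTT : ig mu (fun x => T h x * T gm x) by exact: l2_mul.
pose k d (z : RR) := h z.1 * g z.2 * pois d (z.1 + z.2).
have mk d : 0 < d -> measurable_fun setT (k d).
  move=> d0; apply: measurable_funM.
    apply: measurable_funM; first exact: (measurableT_comp (ig_meas ih) measurable_fst).
    exact: (measurableT_comp (ig_meas ig_) measurable_snd).
  apply: (measurableT_comp (cont_meas (pois_cont d0))).
  by apply: measurable_funD; [exact: measurable_fst|exact: measurable_snd].
have ik d : 0 < d -> ig (mu \x mu)%E (k d).
  move=> d0; apply: (ig2_le (mk d d0) (igZ (2 / d) (ig_norm ih)) (ig_norm ig_)) => x y.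
  rewrite /k /= (normrM (h x * g y)) (normrM (h x)) mulrC mulrA.
  by apply: ler_wpM2r => //; apply: ler_wpM2r => //; exact: pois_bd.
have mp d x : 0 < d -> measurable_fun setT (fun y => pois d (x + y)).
  move=> d0; apply: cont_meas => y.
  apply: (@continuous_comp _ _ _ (fun y => x + y) (pois d)); last exact: pois_cont.
  by apply: cvgD; [exact: cvg_cst|exact: cvg_id].
have ipg d x : 0 < d -> ig mu (fun y => g y * pois d (x + y)).
  move=> d0; apply: (ig_Mbd (M := 2 / d)) => //; first exact: mp.
  by move=> y; exact: pois_bd.
have k1 d x : 0 < d -> ig mu (fun y => k d (x, y)).
  by move=> d0; apply: ig_eq (igZ (h x) (ipg d x d0)) => y; rewrite /k mulrA.
have J d : 0 < d -> \int[mu]_x (T h x * (T gm x * phi d x)) =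
    \int[(mu \x mu)%E]_z k d z.
  move=> d0; rewrite (T_phi_form igm d0 ih).
  rewrite -(fubini1 (ik d d0) (fun x => k1 d x d0)).2.
  apply: eq_int => x; rewrite -(int_opp (ig_Mpois igm d0 x)) /gm.
  rewrite -(intZ _ _); last by apply: ig_eq (ipg d x d0) => y; rewrite !opprK.
  by apply: eq_int => y; rewrite /k /= !opprK mulrA.
pose s d (z : RR) := 2^-1 * (k d z + k d (z.2, z.1)).
have iks d : 0 < d -> ig (mu \x mu)%E (fun z : RR => k d (z.2, z.1)).
  by move=> d0; exact: ig2_swap (ik d d0).
have Jswap d : 0 < d -> \int[(mu \x mu)%E]_z k d (z.2, z.1) = \int[(mu \x mu)%E]_z k d z.
  move=> d0.
  rewrite -(fubini1 (ik d d0) (fun x => k1 d x d0)).2.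
  by rewrite -(fubini2 (iks d d0) (fun y => k1 d y d0)).2.
have Js d : 0 < d -> \int[(mu \x mu)%E]_z s d z = \int[(mu \x mu)%E]_z k d z.
  move=> d0; rewrite intZ; last exact: (igD (ik d d0) (iks d d0)).
  by rewrite (intD (ik d d0) (iks d d0)) Jswap //; field.
have sE d (y z : R) : s d (y, z) = 2^-1 * (h y * h z * ((y * `|y| + z * `|z|) * pois d (y + z))).
  by rewrite /s /k /= !gE (addrC z y); ring.
have s_bd d (y z : R) : 0 < d -> `|s d (y, z)| <= `|h y| * `|h z| * (`|y| + `|z|).
  move=> d0; rewrite sE (normrM 2^-1) (normrM (h y * h z)) (normrM (h y)) (normrM (_ + _)) (ger0_norm (pois_ge0 _ d0)).
  have := ler_wpM2r (pois_ge0 (y + z) d0) (sgn_sqr_bd y z) => H1.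
  have := ler_wpM2r (addr_ge0 (normr_ge0 y) (normr_ge0 z)) (norm_pois_le1 (y + z) d0).
  rewrite mul1r mulrAC => H2.
  have H := le_trans H1 H2.
  rewrite (gtr0_norm (_ : 0 < 2^-1)) // ?invr_gt0 //.
  set A := `|h y| * `|h z|; have A0 : 0 <= A by rewrite mulr_ge0.
  have := ler_wpM2l A0 H; have : 0 <= A * (`|y| + `|z|) by rewrite !mulr_ge0 // addr_ge0.
  lra.
have idom : ig (mu \x mu)%E (fun z : RR => `|h z.1| * `|h z.2| * (`|z.1| + `|z.2|)).
  apply: ig_eq (igD (ig2_prod (ig_norm i1) (ig_norm ih)) (ig2_prod (ig_norm ih) (ig_norm i1))) => z.
  by rewrite !normrM; ring.
have := @int_cvg _ _ _ (mu \x mu)%E (fun n => s (harmonic n)) (fun=> 0) _ _ _ idom.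
case.
- move=> n; apply: ig_meas; apply: igZ; apply: igD; [apply: ik|apply: iks]; exact: harmonic_gt0.
- move=> [y z]; under eq_fun do rewrite sE.
  have [yz|yz] := eqVneq (y + z) 0.
    have -> : z = - y by lra.
    rewrite normrN mulNr subrr; under eq_fun do rewrite mul0r !mulr0.
    exact: cvg_cst.
  rewrite -(mulr0 2^-1) -(mulr0 (h y * h z)) -(mulr0 (y * `|y| + z * `|z|)).
  by do 3!apply: cvgMr; exact: pois_harmonic.
- by move=> n [y z]; apply: s_bd; exact: harmonic_gt0.
move=> _; have -> : \int[(mu \x mu)%E]_x 0 = 0 :> R by rewrite /Rintegral integral0.
under eq_fun do rewrite Js ?harmonic_gt0 // -J ?harmonic_gt0 //.
move=> L0.
have L1 : \int[mu]_x (T h x * (T gm x * phi (harmonic n) x)) @[n --> \oo]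
    --> \int[mu]_x (T h x * T gm x).
  apply: (int_cvg _ _ (ig_norm iTT) _).2.
  - move=> n; apply: measurable_funM; first exact: lTh.1.
    by apply: measurable_funM; [exact: lTg.1|exact: phi_meas].
  - move=> x; apply: cvgMr; rewrite -[X in _ --> X]mulr1; apply: cvgMr.
    exact: phi_harmonic.
  - move=> n x; rewrite mulrA normrM -[leRHS]mulr1; apply: ler_wpM2l => //.
    by rewrite gtr0_norm ?phi_gt0 // phi_le1 // harmonic_gt0.
under eq_int => x do rewrite Tg.
by rewrite -(cvg_lim _ L1) // (cvg_lim _ L0).
Qed.

End skew_adjointness.

Section fourier_inversion.
Context {R : realType}.
Local Notation mu := (@lebesgue_measure R).
Implicit Types (f g h : R -> R) (x y z d : R).

Lemma l2_weak_cvg0 (u : nat -> R -> R) f : (forall n, l2 (u n)) -> l2 f ->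
  \int[mu]_x (u n x ^+ 2) @[n --> \oo] --> (0 : R) ->
  \int[mu]_x (u n x * f x) @[n --> \oo] --> (0 : R).
Proof.
move=> lu lf u0; pose b := \int[mu]_x (f x ^+ 2).
have L : Num.sqrt (\int[mu]_x (u n x ^+ 2) * b) @[n --> \oo] --> (0 : R).
  rewrite -[X in _ --> X](@sqrtr0 R) -[X in Num.sqrt X](mul0r b).
  by apply: continuous_cvg; [exact: sqrt_continuous|exact: cvgMl].
apply: norm_cvg0; apply: squeeze_cvgr (cvg_cst (0 : R)) L; apply: nearW => n.
rewrite normr_ge0 /= -sqrtr_sqr ler_wsqrtr //.
exact: cauchy_schwarz_int.
Qed.

Lemma pois_approx f x : continuous f -> l2 f ->
  \int[mu]_y (f y * pois (harmonic n) (x - y)) @[n --> \oo] --> 2 * pi * f x.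
Proof.
move=> cf lf; pose g z := f (x - z).
have cg : continuous g.
  move=> z; apply: (@continuous_comp _ _ _ (fun z => x - z) f); last exact: cf.
  by apply: cvgB; [exact: cvg_cst|exact: cvg_id].
have lg : l2 g.
  by split; [exact: cont_meas|exact: ig_refl lf.2].
pose A : set R := `]-1, 1[%classic; pose B : set R := ~` A.
have mA : measurable A by exact: measurable_itv.
have mB : measurable B by exact: measurableC.
have mp n : measurable_fun setT (pois (harmonic n : R)) := cont_meas (pois_cont (harmonic_gt0 n)).
pose i n z := g z * \1_A z * pois (harmonic n) z.
pose o n z := g z * \1_B z * pois (harmonic n) z.
have lp n : l2 (pois (harmonic n : R)).
  apply: (@ig_bd_l2 _ (2 / harmonic n)); first exact: (pois_int (harmonic_gt0 n)).1.
  by move=> z; exact: pois_bd (harmonic_gt0 n).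
have lgA (D : set R) : measurable D -> l2 (fun z => g z * \1_D z).
  by move=> mD; exact: l2_indic.
have split_int n : \int[mu]_y (f y * pois (harmonic n) (x - y)) =
    \int[mu]_z i n z + \int[mu]_z o n z.
  rewrite -intD; [|exact: l2_mul (lgA _ mA) (lp n)|exact: l2_mul (lgA _ mB) (lp n)].
  have il : ig mu (fun y => f y * pois (harmonic n) (x - y)).
    apply: l2_mul => //; split; first exact: cont_meas (@pois_refl_cont _ _ (harmonic_gt0 n) x).
    exact: ig_refl (lp n).2.
  rewrite -(int_refl x il); apply: eq_int => z.
  rewrite /i /o -mulrDl -mulrDr /g subKr; congr (_ * _).
  rewrite -[LHS]mulr1; congr (_ * _); rewrite !indicE /B in_setC.
  by case: (z \in A); rewrite ?addr0 ?add0r.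
under eq_fun do rewrite split_int.
rewrite -(addr0 (2 * pi * f x)); apply: cvgD.
- have [M [_ gM]] : bounded_set (g @` `[-1, 1]%classic).
    apply: compact_bounded; apply: continuous_compact; last exact: segment_compact.
    by apply: continuous_subspaceT => ?; exact: cg.
  have gA z : A z -> `|g z| <= M + 1.
    move=> Az; apply: (gM (M + 1)); first by rewrite ltrDl.
    exists z => //; move: Az; rewrite /A /= !in_itv /= => /andP[a b].
    by rewrite !ltW.
  have M1 : 0 <= M + 1 by apply: le_trans (gA 0 _) => //; rewrite /A /= in_itv /= ltrN10 ltr01.
  have gAbd z : `|g z * \1_A z| <= M + 1.
    rewrite indicE; case: (boolP (z \in A)) => [/set_mem zA|_]; rewrite ?mulr1 ?mulr0 ?normr0 //.
    exact: gA.
  have E n : \int[mu]_z i n z = \int[mu]_t (pois 1 t * (g (harmonic n * t) * \1_A (harmonic n * t))).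
    have n0 : 0 < harmonic n :> R := harmonic_gt0 n.
    have iin : ig mu (i n) by exact: l2_mul (lgA _ mA) (lp n).
    have := int_affine 0 n0 iin => E.
    have -> : \int[mu]_z i n z = harmonic n * \int[mu]_t i n (harmonic n * t + 0).
      by rewrite E mulrA mulfV ?gt_eqF // mul1r.
    rewrite -intZ; last exact: ig_affine.
    apply: eq_int => t; rewrite addr0 /i [RHS]mulrC.
    set a := g _ * _; rewrite mulrCA; congr (_ * _).
    rewrite /pois; field; rewrite !gt_eqF //= ?ltr_pwDl ?exprn_gt0 ?sqr_ge0 //.
  under eq_fun do rewrite E.
  have -> : 2 * pi * f x = \int[mu]_t (pois 1 t * f x).
    have [ip Ip] := @pois_int R 1 ltr01.
    by rewrite -Ip mulrC -intZ //; apply: eq_int => t; rewrite mulrC.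
  apply: (@int_cvg _ _ _ mu
    (fun n t => pois 1 t * (g (harmonic n * t) * \1_A (harmonic n * t)))
    (fun t => pois 1 t * f x) (fun t => (M + 1) * pois 1 t) _ _ _ _).2.
  - move=> n; apply: measurable_funM; first exact: cont_meas (pois_cont ltr01).
    apply: (@measurableT_comp _ _ _ _ _ _ (fun z => g z * \1_A z)).
      exact: (lgA _ mA).1.
    apply: cont_meas => t; apply: cvgM; [exact: cvg_cst|exact: cvg_id].
  - move=> t; apply: cvgMr.
    have ht : harmonic n * t @[n --> \oo] --> (0 : R).
      by rewrite -(mul0r t); apply: cvgMl; exact: cvg_harmonic.
    have E0 : g (harmonic n * t) @[n --> \oo] --> f x.
      by have -> : f x = g 0 by [rewrite /g subr0]; apply: continuous_cvg => //; exact: cg.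
    apply: cvg_trans E0; apply: near_eq_cvg.
    have : \forall n \near \oo, `|harmonic n * t| < 1 by apply: (cvgr0_norm_lt _ ht).
    apply: filterS => n; rewrite ltr_norml => H.
    by rewrite indicE mem_set ?mulr1 // /A /= in_itv.
  - by apply: igZ; exact: (pois_int ltr01).1.
  - move=> n t; rewrite normrM mulrC (ger0_norm (pois_ge0 _ ltr01)).
    by apply: ler_wpM2r; [exact: pois_ge0|exact: gAbd].
- have -> : 0 = \int[mu]_z (0 : R) by rewrite /Rintegral integral0.
  apply: (@int_cvg _ _ _ mu o (fun=> 0) (fun z => `|g z * (2 * pois 1 z)|) _ _ _ _).2.
  - move=> n; apply: measurable_funM; last exact: mp.
    exact: (lgA _ mB).1.
  - move=> z; have [->|z0] := eqVneq z 0.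
      rewrite /o indicE memNset; first by under eq_fun do rewrite mulr0 mul0r; exact: cvg_cst.
      by move=> nA; apply: nA; rewrite /A /= in_itv /= ltrN10 ltr01.
    by rewrite -(mulr0 (g z * \1_B z)); apply: cvgMr; exact: pois_harmonic.
  - apply: ig_norm; apply: l2_mul => //; apply: l2Z.
    by apply: (@ig_bd_l2 _ (2 / 1)); [exact: (pois_int ltr01).1|move=> z; exact: pois_bd].
  - move=> n z; rewrite /o indicE; case: (boolP (z \in B)) => [/set_mem zB|_]; last first.
      by rewrite mulr0 mul0r normr0.
    rewrite mulr1 (normrM (g z) (pois _ _)) (normrM (g z)); apply: ler_wpM2l => //.
    have n0 : 0 < harmonic n :> R := harmonic_gt0 n; have n1 : harmonic n <= 1 :> R := harmonic_le1 n.
    have p0 : 0 <= 2 * pois 1 z by rewrite mulr_ge0 // pois_ge0.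
    rewrite (ger0_norm (pois_ge0 z n0)) (ger0_norm p0).
    have z1 : 1 <= z ^+ 2.
      rewrite leNgt; apply/negP => z1; apply: zB; rewrite /A /= in_itv /= -ltr_norml.
      by rewrite -(@ltr_pXn2r _ 2) ?nnegrE // expr1n real_normK ?num_real.
    rewrite /pois expr1n mulr1 mulrA ler_pdivlMr; last by lra.
    rewrite mulrAC ler_pdivrMr; last by rewrite ltr_pwDl ?exprn_gt0 // sqr_ge0.
    have := sqr_ge0 (harmonic n : R); nra.
Qed.

Lemma hartley_inversion f h x : continuous f -> l2 f -> ig mu h -> l2 h ->
  \int[mu]_xi ((h xi - T (fun y => f y * \1_(`[- n%:R, n%:R]%classic) y) xi) ^+ 2) @[n --> \oo] --> (0 : R) ->
  T h x = 2 * pi * f x.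
Proof.
move=> cf lf ih lh h0.
pose fn n y := f y * \1_(`[- n%:R, n%:R]%classic : set R) y.
have ifn n : ig mu (fn n) by apply: ig_itv; apply: continuous_subspaceT => ?; exact: cf.
have lfn n : l2 (fn n).
  by apply: l2_indic => //; exact: measurable_itv.
have key d : 0 < d -> \int[mu]_xi (h xi * (phi d xi * cas (x * xi))) =
    \int[mu]_y (f y * pois d (x - y)).
  move=> d0; pose p xi := phi d xi * cas (x * xi).
  have ip : ig mu p by apply: ig_cas; exact: (phi_int d0).1.
  have lp : l2 p.
    apply: (@ig_bd_l2 _ 2) => // xi; rewrite normrM (gtr0_norm (phi_gt0 _ _)).
    rewrite -[leRHS]mul1r; apply: ler_pM => //; [exact/ltW/phi_gt0|exact: phi_le1|exact: cas_le2].
  have Tp y : T p y = pois d (x - y).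
    rewrite -phi_cas //; apply: eq_int => xi; by rewrite /p (mulrC x) (mulrC y) mulrA.
  have lpo : l2 (fun y => pois d (x - y)).
    apply: (@ig_bd_l2 _ (2 / d)); [exact: (ig_pois d0 x).1|by move=> y; exact: pois_bd].
  have L1 : \int[mu]_xi (T (fn n) xi * p xi) @[n --> \oo] --> \int[mu]_y (f y * pois d (x - y)).
    under eq_fun do rewrite T_selfadj //.
    apply: (int_cvg _ _ (ig_norm (l2_mul lf lpo)) _).2.
    - by move=> n; apply: measurable_funM; [exact: (lfn n).1|exact: T_meas].
    - move=> y; rewrite Tp; apply: cvgMl; rewrite -[X in _ --> X]mulr1; apply: cvgMr.
      apply: cvg_near_cst; exists (Num.trunc `|y|).+1 => // n /= yn.
      rewrite indicE mem_set //= in_itv /= -ler_norml; apply: ltW.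
      by apply: lt_le_trans (Num.Theory.truncnS_gt _) _; rewrite ler_nat.
    - move=> n y; rewrite Tp !normrM; apply: ler_wpM2r => //.
      by rewrite -[leRHS]mulr1; apply: ler_wpM2l => //; exact: indic_le1.
  have L2 : \int[mu]_xi (T (fn n) xi * p xi) @[n --> \oo] --> \int[mu]_xi (h xi * p xi).
    have lTf n : l2 (T (fn n)) := (bessel (ifn n) (lfn n)).1.
    have lB n : l2 (fun xi => h xi - T (fn n) xi) by exact: l2B.
    have W := l2_weak_cvg0 lB lp h0.
    have E n : \int[mu]_xi (T (fn n) xi * p xi) =
        \int[mu]_xi (h xi * p xi) - \int[mu]_xi ((h xi - T (fn n) xi) * p xi).
      under [in X in _ - X]eq_int do rewrite mulrBl.
      by rewrite intB ?subKr //; exact: l2_mul.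
    under eq_fun do rewrite E.
    set c := \int[mu]_xi (h xi * p xi).
    suff : c - \int[mu]_xi ((h xi - T (fn n) xi) * p xi) @[n --> \oo] --> c - 0 by rewrite subr0.
    by apply: cvgB; [exact: cvg_cst|exact: W].
  by rewrite -(cvg_lim _ L1) // (cvg_lim _ L2).
have L1 : \int[mu]_xi (h xi * (phi (harmonic n) xi * cas (x * xi))) @[n --> \oo] --> T h x.
  apply: (int_cvg _ _ (igZ 2 (ig_norm ih)) _).2.
  - move=> n; apply: measurable_funM; first exact: lh.1.
    by apply: measurable_funM; [exact: phi_meas|exact: casx_meas].
  - move=> xi; apply: cvgMr; rewrite -[X in _ --> X]mul1r; apply: cvgMl; exact: phi_harmonic.
  - move=> n xi; rewrite normrM mulrC; apply: ler_wpM2r => //.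
    rewrite normrM (gtr0_norm (phi_gt0 _ _)) -[leRHS]mul1r.
    apply: ler_pM => //; [exact/ltW/phi_gt0|apply: phi_le1; exact: harmonic_gt0|exact: cas_le2].
have L2 := @pois_approx f x cf lf.
have L3 : \int[mu]_xi (h xi * (phi (harmonic n) xi * cas (x * xi))) @[n --> \oo] --> 2 * pi * f x.
  by under eq_fun do rewrite (key _ (harmonic_gt0 _)); exact: L2.
by rewrite -(cvg_lim _ L1) // (cvg_lim _ L3).
Qed.

Lemma T_der h x : ig mu h -> ig mu (fun xi => xi * h xi) ->
  is_derive x 1 (T h) (T (fun xi => xi * h xi) (- x)).
Proof.
move=> ih i1; pose F y xi := h xi * cas (y * xi).
have dF y xi : is_derive y 1 (F ^~ xi) (h xi * (cas (- (y * xi)) * xi)).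
  apply: derZ; apply: (@derComp _ cas (fun y => y * xi)); first exact: cas_der.
  by apply: (der_eq (derM (derI y) (derC xi y))); rewrite mulr0 add0r mul1r.
pose I : set R := `]x - 1, x + 1[%classic.
have Ix : I x by rewrite /I /= in_itv /= ltrBlDr !ltrDl ltr01.
have E y xi : partial1of2 F y xi = h xi * (cas (- (y * xi)) * xi).
  by rewrite /partial1of2 derive1E; have d := dF y xi; rewrite derive_val.
have [H1 H2 H3] : [/\ forall y, `]x - 1, x + 1[%classic y -> mu.-integrable setT (EFin \o F y),
   (forall y xi, `]x - 1, x + 1[%classic y -> setT xi -> derivable (F ^~ xi) y 1) &
   (forall y xi, `]x - 1, x + 1[%classic y -> setT xi -> `|partial1of2 F y xi| <= 2 * `|xi * h xi|)].
  split.
  - by move=> y _; exact: ig_cas.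
  - by move=> y xi _ _; have d := dF y xi.
  - move=> y xi _ _; rewrite E (_ : _ * _ = cas (- (y * xi)) * (xi * h xi)); last by ring.
    by rewrite (normrM (cas _)); apply: ler_wpM2r => //; exact: cas_le2.
have G0 xi : 0 <= 2 * `|xi * h xi| by rewrite mulr_ge0.
have D := @derivable_under_integral _ _ _ mu F setT measurableT x _ _ Ix H1 H2 _ G0 (igZ 2 (ig_norm i1)) H3.
have V := @differentiation_under_integral _ _ _ mu F setT measurableT x _ _ Ix H1 H2 _ G0 (igZ 2 (ig_norm i1)) H3.
apply: DeriveDef; first exact: D.
rewrite -derive1E V; apply: eq_int => xi; rewrite E.
by rewrite mulNr mulrA mulrAC (mulrC xi).
Qed.

End fourier_inversion.

Section dirichlet_integral.
Context {R : realType}.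
Local Notation mu := (@lebesgue_measure R).
Implicit Types (x y a b : R).

Lemma inv_meas : measurable_fun setT (GRing.inv : R -> R).
Proof.
apply: (@measurable_fun_cvg _ _ R setT (fun n y => y / (harmonic n + y ^+ 2))).
- move=> n; apply: cont_meas => y; apply: cvgM; first exact: cvg_id.
  apply: cvgV; first by rewrite gt_eqF // ltr_pwDl ?harmonic_gt0 // sqr_ge0.
  by apply: cvgD; [exact: cvg_cst|apply: cvgM; exact: cvg_id].
- move=> y _; have [->|y0] := eqVneq y 0.
    by rewrite invr0; under eq_fun do rewrite mul0r; exact: cvg_cst.
  have -> : y^-1 = y / (0 + y ^+ 2) by field.
  apply: cvgM; first exact: cvg_cst.
  apply: cvgV; first by rewrite add0r sqrf_eq0.
  by apply: cvgD; [exact: cvg_harmonic|exact: cvg_cst].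
Qed.

Lemma norm_sin_le x : 0 <= x -> `|sin x| <= x.
Proof.
move=> x0; rewrite ler_norml.
have key (c : R) : `|c| <= 1 -> c * sin x <= x.
  move=> c1; have d (y : R) : is_derive y 1 (fun y => c * sin y - y) (c * cos y - 1).
    exact: derB (derZ c (is_derive_sin y)) (derI y).
  have := @ler0_derive1_nincry _ (fun y => c * sin y - y) 0.
  move=> /(_ _ _ _ 0 x (lexx _) x0); rewrite sin0 mulr0 subr0 subr_le0; apply.
  - by move=> y _; have := d y.
  - move=> y _; rewrite derive1E; have H := d y; rewrite derive_val subr_le0.
    by rewrite (le_trans (ler_norm _)) // normrM mulr_ile1 // cos_bd.
  - by apply: continuous_subspaceT => y; exact: der_cont (d y).
have := key 1; have := key (-1); rewrite normrN normr1 => /(_ (lexx _)) + /(_ (lexx _)).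
lra.
Qed.

Definition sinc y := sin y / y.

Lemma sinc_meas : measurable_fun setT sinc.
Proof. by apply: measurable_funM; [exact: cont_meas (@continuous_sin R)|exact: inv_meas]. Qed.

Let sinc_bd y : 0 <= y -> `|sinc y| <= 1.
Proof.
move=> y0; rewrite normrM normfV (ger0_norm y0).
have [->|yn0] := eqVneq y 0; first by rewrite invr0 mulr0.
by rewrite ler_pdivrMr ?lt_def ?yn0 // mul1r norm_sin_le.
Qed.

Definition chi a b : R -> R := \1_(`]a, b]%classic).

Let chi_meas a b : measurable_fun setT (chi a b).
Proof. by apply: meas_indic; exact: measurable_itv. Qed.

Lemma chiE a b y : chi a b y = ((a < y) && (y <= b))%:R.
Proof. by rewrite /chi indicE mem_setE in_itv. Qed.

Lemma ig_sinc a b : 0 <= a -> ig mu (fun y => sinc y * chi a b y).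
Proof.
move=> a0; apply: (@ig_le _ _ _ mu _ (fun y => 1 * \1_(`[a, b]%classic) y)).
- by apply: measurable_funM; [exact: sinc_meas|exact: chi_meas].
- by apply: ig_itv; apply: continuous_subspaceT => ?; exact: cvg_cst.
- move=> y; rewrite normrM chiE mul1r indicE mem_setE in_itv /=.
  have [ay|//] := ltP a y; rewrite ?normr0 ?mulr0 // (ltW ay) /=.
  have [yb|yb] := leP y b; rewrite ?normr0 ?mulr0 // normr1 mulr1.
  by apply: sinc_bd; exact: le_trans a0 (ltW ay).
Qed.

Definition sin_int a b := \int[mu]_y (sinc y * chi a b y).

Let sin_intD a b c : 0 <= a -> a <= b -> b <= c ->
  sin_int a c = sin_int a b + sin_int b c.
Proof.
move=> a0 ab bc; rewrite /sin_int -intD; [|exact: ig_sinc|apply: ig_sinc; exact: le_trans ab].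
apply: eq_int => y; rewrite -mulrDr !chiE; congr (_ * _).
have [yb|yb] := leP y b; first by rewrite (le_trans yb bc) /= addr0.
by rewrite (le_lt_trans ab yb) andbF add0r.
Qed.

Definition cosq y := cos y / y ^+ 2.

Let cosq_meas : measurable_fun setT cosq.
Proof.
apply: measurable_funM; first exact: cont_meas (@continuous_cos R).
rewrite (_ : (fun _ => _) = fun y : R => y^-1 ^+ 2); last by apply/funext => y; rewrite exprVn.
by apply: measurable_funX; exact: inv_meas.
Qed.

Let cosq_bd a b y : 1 <= a -> `|cosq y * chi a b y| <= pois 1 y.
Proof.
move=> a1; rewrite normrM chiE; have [ay|ay] := ltP a y; last first.
  by rewrite /= normr0 mulr0 pois_ge0.
apply: le_trans (_ : `|cosq y| <= _).
  by case: (y <= b); rewrite ?normr1 ?mulr1 ?normr0 ?mulr0.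
have y1 : 1 < y by exact: le_lt_trans ay.
rewrite /cosq /pois normrM normfV expr1n mulr1 (ger0_norm (sqr_ge0 y)).
rewrite ler_pdivrMr; last by rewrite exprn_gt0 // (lt_trans ltr01).
rewrite mulrAC ler_pdivlMr; last by rewrite ltr_pwDl // sqr_ge0.
have := cos_bd y; have : 1 <= y ^+ 2 by rewrite exprn_ege1 // ltW.
have := normr_ge0 (cos y); nra.
Qed.

Let ig_cosq a b : 1 <= a -> ig mu (fun y => cosq y * chi a b y).
Proof.
move=> a1; apply: (@ig_le _ _ _ mu _ (pois 1)).
- by apply: measurable_funM; [exact: cosq_meas|exact: chi_meas].
- exact: (pois_int ltr01).1.
- by move=> y; exact: cosq_bd.
Qed.

Let sin_int_tail a b : 1 <= a -> a <= b ->
  sin_int a b = cos a / a - cos b / b - \int[mu]_y (cosq y * chi a b y).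
Proof.
move=> a1 ab; have a0 : 0 <= a by exact: le_trans a1.
apply/eqP; rewrite -subr_eq opprK; apply/eqP.
rewrite /sin_int -intD; [|exact: ig_sinc|exact: ig_cosq].
have pos y : a <= y <= b -> y != 0.
  by move=> /andP[ay _]; rewrite gt_eqF // (lt_le_trans ltr01) // (le_trans a1).
have cI : {within `[a, b], continuous (fun y => sinc y + cosq y)}.
  apply: continuous_in_subspaceT => y /set_mem /=; rewrite in_itv /= => /pos y0.
  apply: cvgD; apply: cvgM; [exact: continuous_sin|exact: cvgV|exact: continuous_cos|].
  by apply: cvgV; rewrite ?sqrf_eq0 //; apply: cvgM; exact: cvg_id.
have <- : \int[mu]_(y in `[a, b]) (sinc y + cosq y) = cos a / a - cos b / b.
  have dF y : a <= y <= b -> is_derive y 1 (fun y => - (cos y / y)) (sinc y + cosq y).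
   move=> /pos y0.
   have dv : is_derive y 1 (fun y : R => y^-1) (- y ^- 2).
     by apply: (der_eq (is_deriveV y0 (derI y))); rewrite scaler1.
   apply: (der_eq (derN (derM (is_derive_cos y) dv))).
   by rewrite /sinc /cosq; field.
  by rewrite (FTC_itv ab cI dF) opprK addrC.
rewrite -(@Rintegral_itv_obnd_cbnd _ a (BRight b)).
  by rewrite [RHS]int_restrict; apply: eq_int => y; rewrite mulrDl.
apply/ig_restrict; first exact: measurable_itv.
by apply: ig_eq (igD (ig_sinc b a0) (ig_cosq b a1)) => y; rewrite mulrDl.
Qed.

Lemma sin_int_bd a b : 0 <= a -> a <= b -> `|sin_int a b| <= 3 + 2 * pi.
Proof.
have small a' b' : 0 <= a' -> b' <= 1 -> `|sin_int a' b'| <= 1.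
  move=> a0 b1; have -> : (1 : R) = \int[mu]_y (1 * \1_(`[0, 1]%classic) y).
    rewrite -(int_restrict `[0, 1]%classic (fun=> 1)).
    rewrite (FTC_itv (f := fun=> 1) ler01 _ (fun x _ => derI x)) ?subr0 //.
    by apply: continuous_subspaceT => ?; exact: cvg_cst.
  apply: le_norm_int_le; first exact: ig_sinc.
    by apply: ig_itv; apply: continuous_subspaceT => ?; exact: cvg_cst.
  move=> y; rewrite normrM chiE mul1r indicE mem_setE in_itv /=.
  have [ay|//] := ltP a' y; rewrite ?normr0 ?mulr0 //.
  have y0 : 0 <= y by exact: le_trans a0 (ltW ay).
  have [yb|yb] := leP y b'; rewrite ?normr0 ?mulr0 //= normr1 mulr1.
  by rewrite y0 (le_trans yb) //= sinc_bd.
have big a' b' : 1 <= a' -> a' <= b' -> `|sin_int a' b'| <= 2 + 2 * pi.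
  move=> a1 ab; rewrite sin_int_tail // (le_trans (ler_normB _ _)) //; apply: lerD.
    apply: le_trans (ler_normB _ _) _.
    have c1 y : 1 <= y -> `|cos y / y| <= 1.
      move=> y1; rewrite normrM normfV (ger0_norm (le_trans ler01 y1)).
      by rewrite ler_pdivrMr ?(lt_le_trans ltr01) // mul1r (le_trans (cos_bd _)).
    by have := c1 _ a1; have := c1 _ (le_trans a1 ab); lra.
  have [ip <-] := @pois_int R 1 ltr01.
  by apply: le_norm_int_le => //; [exact: ig_cosq|move=> y; exact: cosq_bd].
move=> a0 ab; have p0 : 0 <= pi :> R := pi_ge0 R.
have [b1|b1] := leP b 1; first by have := small _ _ a0 b1; lra.
have [a1|a1] := leP 1 a; first by have := big _ _ a1 ab; lra.
rewrite (@sin_intD a 1 b a0 (ltW a1) (ltW b1)) (le_trans (ler_normD _ _)) //.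
by have := small _ _ a0 (lexx 1); have := big _ _ (lexx 1) (ltW b1); lra.
Qed.

Definition dirichlet := \int[mu]_y (sinc y * chi 0 1 y) +
  (cos 1 - \int[mu]_y (cosq y * \1_(`]1, +oo[%classic) y)).

Lemma sin_int_cvg (u v : nat -> R) : (forall n, 0 < u n) ->
  u n @[n --> \oo] --> (0 : R) -> v n @[n --> \oo] --> +oo ->
  sin_int (u n) (v n) @[n --> \oo] --> dirichlet.
Proof.
move=> u_gt0 u0 vy.
have ev : \forall n \near \oo,
   sin_int (u n) 1 + (cos 1 - cos (v n) / v n - \int[mu]_y (cosq y * chi 1 (v n) y)) =
   sin_int (u n) (v n).
  have u1 : \forall n \near \oo, `|u n| < 1 by apply: (cvgr0_norm_lt _ u0).
  have v1 : \forall n \near \oo, 1 <= v n by exact: (cvgryPge _).1 vy 1.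
  apply: filterS2 u1 v1 => n u1 v1; rewrite (@sin_intD (u n) 1 (v n)) //.
  - by rewrite (@sin_int_tail 1) ?divr1.
  - exact/ltW/u_gt0.
  - by move: u1; rewrite gtr0_norm // => /ltW.
apply: cvg_trans (near_eq_cvg ev) _; rewrite /dirichlet; apply: cvgD.
- have i1 : ig mu (fun y : R => 1 * \1_(`[0, 1]%classic) y).
    by apply: ig_itv; apply: continuous_subspaceT => ?; exact: cvg_cst.
  apply: (int_cvg _ _ i1 _).2 => [n|y|n y].
  + by apply: measurable_funM; [exact: sinc_meas|exact: chi_meas].
  + apply: cvgMr; rewrite chiE; have [y0|y0] := ltP 0 y; last first.
      rewrite /=; apply: cvg_near_cst; apply: nearW => n; rewrite chiE.
      by rewrite ltNge (le_trans y0) // ltW.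
    apply: cvg_near_cst; have : \forall n \near \oo, `|u n| < y by apply: (cvgr0_norm_lt _ u0).
    by apply: filterS => n; rewrite gtr0_norm // chiE => ->.

  + rewrite normrM chiE mul1r indicE mem_setE in_itv /=.
    have [ay|//] := ltP (u n) y; rewrite ?normr0 ?mulr0 //.
    have y0 : 0 <= y by exact: le_trans (ltW (u_gt0 n)) (ltW ay).
    rewrite y0 /=; case: (y <= 1); rewrite ?normr0 ?mulr0 //= normr1 mulr1.
    exact: sinc_bd.
- apply: cvgB.
    rewrite -[X in _ --> X]subr0; apply: cvgB; first exact: cvg_cst.
    have V : (v n)^-1 @[n --> \oo] --> (0 : R).
      by apply/gtr0_cvgV0 => //; exact: (cvgryPgt _).1 vy 0.
    have V' : `|(v n)^-1| @[n --> \oo] --> (0 : R) by rewrite -(@normr0 _ R); exact: cvg_norm.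
    apply: norm_cvg0; apply: squeeze_cvgr (cvg_cst (0 : R)) V'.
    by apply: nearW => n; rewrite normr_ge0 normrM /= ler_piMl // cos_bd.
  apply: (int_cvg _ _ (pois_int ltr01).1 _).2 => [n|y|n y].
  + by apply: measurable_funM; [exact: cosq_meas|exact: chi_meas].
  + apply: cvgMr; apply: cvg_near_cst.
    have : \forall n \near \oo, y <= v n by exact: (cvgryPge _).1 vy y.
    apply: filterS => n vn.
    by rewrite chiE vn andbT indicE mem_setE in_itv /= andbT.
  + exact: cosq_bd.

Qed.

End dirichlet_integral.

Section hilbert_transform.
Context {R : realType}.
Local Notation mu := (@lebesgue_measure R).
Local Notation RR := (measurableTypeR R * measurableTypeR R)%type.
Implicit Types (f g : R -> R) (x y a b : R).

Local Notation out a := [set y : R | a < `|y|].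

Let outE a y : \1_(out a) y = (a < `|y|)%R%:R :> R.
Proof. by rewrite indicE; congr ((_ : bool)%:R); apply/idP/idP => [/set_mem|/mem_set]. Qed.

Lemma sgr_meas : measurable_fun setT (fun y : R => Num.sg y).
Proof.
apply: (@measurable_fun_cvg _ _ R setT (fun n y => y / (harmonic n + `|y|))).
- move=> n; apply: cont_meas => y; apply: cvgM; first exact: cvg_id.
  apply: cvgV; first by rewrite gt_eqF // ltr_pwDl ?harmonic_gt0.
  by apply: cvgD; [exact: cvg_cst|exact: norm_continuous].
- move=> y _; have [->|y0] := eqVneq y 0.
    by rewrite sgr0; under eq_fun do rewrite mul0r; exact: cvg_cst.
  have -> : Num.sg y = y / (0 + `|y|).
    by rewrite add0r {2}[y]numEsg mulfK // normr_eq0.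
  apply: cvgM; first exact: cvg_cst.
  apply: cvgV; first by rewrite add0r normr_eq0.
  by apply: cvgD; [exact: cvg_harmonic|exact: cvg_cst].
Qed.

Lemma out_meas a : measurable (out a).
Proof.
rewrite (_ : [set _ | _] = (fun y : R => `|y|) @^-1` `]a, +oo[%classic); last first.
  by apply/seteqP; split => y /=; rewrite in_itv /= andbT.
rewrite -[X in measurable X]setTI; apply: (@normr_measurable R setT) => //.
Qed.

Lemma l2_inv_out a : 0 < a -> l2 (fun y => y^-1 * \1_(out a) y).
Proof.
move=> a0.
have m : measurable_fun setT (fun y : R => y^-1 * \1_(out a) y).
  by apply: measurable_funM; [exact: inv_meas|apply: meas_indic; exact: out_meas].
split => //; apply: ig_le (igZ (1 + a ^- 2) (pois_int ltr01).1) _.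
  by apply: measurable_funX.
move=> y; rewrite outE; have [ay|_] := ltP a `|y|; last first.
  by rewrite mulr0 expr0n /= normr0 mulr_ge0 ?pois_ge0 // addr_ge0 // invr_ge0 sqr_ge0.
rewrite mulr1 ger0_norm ?sqr_ge0 // exprVn.
have a2 : 0 < a ^+ 2 by rewrite exprn_gt0.
have y2 : a ^+ 2 <= y ^+ 2.
  by rewrite -(real_normK (num_real y)) lerXn2r ?nnegrE // ltW.
have yp : 0 < y ^+ 2 by exact: lt_le_trans y2.
rewrite /pois expr1n mulr1 mulrA ler_pdivlMr; last by lra.
rewrite mulrC ler_pdivrMr //.
have : 1 <= a ^- 2 * y ^+ 2 by rewrite mulrC ler_pdivlMr ?mul1r.
have : 0 <= a ^- 2 * y ^+ 2 by rewrite mulr_ge0 ?invr_ge0 ?ltW.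
nra.
Qed.

Section kernel.
Variable n : nat.
Let a : R := harmonic n.
Let b : R := n.+1%:R.
Let a0 : 0 < a. Proof. exact: harmonic_gt0. Qed.
Let ab : a <= b. Proof. by rewrite (le_trans (harmonic_le1 n)) // ler1n. Qed.
Let b0 : 0 <= b. Proof. exact: le_trans (ltW a0) ab. Qed.

Definition hker y : R := y^-1 * (chi a b y + chi a b (- y)).

Lemma hkerE y : hker y = y^-1 * \1_(out a) y - y^-1 * \1_(out b) y.
Proof.
rewrite /hker !chiE !outE -mulrBr; congr (_ * _).
have [y0|y0] := leP 0 y.
  rewrite (ger0_norm y0).
  have -> : (a < - y) = false by apply/negbTE; rewrite -leNgt (le_trans _ (ltW a0)) // oppr_le0.
  rewrite /= addr0; have [ya|ya] := ltP a y => /=.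
    by case: ltP; rewrite ?subr0 ?subrr.
  by rewrite ltNge (le_trans ya ab) /= subrr.
rewrite (ltr0_norm y0).
have -> : (a < y) = false by apply/negbTE; rewrite -leNgt (le_trans (ltW y0)) // ltW.
rewrite /= add0r; have [ya|ya] := ltP a (- y) => /=.
  by case: ltP; rewrite ?subr0 ?subrr.
by rewrite ltNge (le_trans ya ab) /= subrr.
Qed.

Lemma hker_odd y : hker (- y) = - hker y.
Proof. by rewrite /hker invrN opprK addrC mulNr. Qed.

Lemma ig_hker : ig mu hker.
Proof.
have ip : ig mu (fun y => a^-1 * \1_(`[-b, b]%classic) y).
  by apply: (@ig_itv R (- b) b (fun=> a^-1)); apply: continuous_subspaceT => ?; exact: cvg_cst.
have ao : forall c : R, 0 < c -> measurable_fun setT (fun y : R => y^-1 * \1_(out c) y).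
  by move=> c c0; exact: (l2_inv_out c0).1.
suff bd y : `|hker y| <= a^-1 * \1_(`[-b, b]%classic) y.
  apply: ig_le ip bd.
  rewrite (_ : hker = fun y => y^-1 * \1_(out a) y - y^-1 * \1_(out b) y).
    by apply: measurable_funB; apply: ao => //; rewrite /b ltr0n.
  by apply/funext => y; rewrite hkerE.
rewrite /hker !chiE normrM indicE mem_setE in_itv /= normfV.
have ai : 0 <= a^-1 by rewrite invr_ge0 ltW.
have H (B : bool) : B -> a^-1 * B%:R = a^-1 by move=> ->; rewrite mulr1.
have [ya|ya] := ltP a y.
  have y0 : 0 < y by exact: lt_trans ya.
  have -> : (a < - y) = false.
    by apply/negbTE; rewrite -leNgt (le_trans _ (ltW a0)) // oppr_le0 ltW.
  rewrite /= addr0; have [yb|yb] := leP y b; last by rewrite normr0 !mulr0 mulr_ge0.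
  rewrite normr1 !mulr1 (gtr0_norm y0) H; last first.
    by rewrite andbT (le_trans _ (ltW y0)) // oppr_le0.
  by rewrite lef_pV2 // ltW.
have [ya'|ya'] := ltP a (- y); last by rewrite /= addr0 normr0 mulr0 mulr_ge0.
have y0 : y < 0 by rewrite -oppr_gt0 (lt_trans a0).
rewrite /= add0r; have [yb|yb] := leP (- y) b; last by rewrite normr0 !mulr0 mulr_ge0.
rewrite normr1 !mulr1 (ltr0_norm y0) H; last first.
  by rewrite lerNl (ltW (lt_le_trans y0 b0)) andbT.
by rewrite lef_pV2 ?ltW // posrE oppr_gt0.
Qed.

Let ig_ksin xi : ig mu (fun y => hker y * sin (y * xi)).
Proof.
apply: (ig_Mbd (M := 1) ig_hker); last by move=> y; exact: sin_bd.
apply: cont_meas => y; apply: continuous_comp; last exact: continuous_sin.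
by apply: cvgM; [exact: cvg_id|exact: cvg_cst].
Qed.

Let ig_kcos xi : ig mu (fun y => hker y * cos (y * xi)).
Proof.
apply: (ig_Mbd (M := 1) ig_hker); last by move=> y; exact: cos_bd.
apply: cont_meas => y; apply: continuous_comp; last exact: continuous_cos.
by apply: cvgM; [exact: cvg_id|exact: cvg_cst].
Qed.

Lemma hker_sin xi : \int[mu]_y (hker y * sin (y * xi)) =
  2 * Num.sg xi * sin_int (a * `|xi|) (b * `|xi|).
Proof.
have pos z : 0 < z -> \int[mu]_y (hker y * sin (y * z)) = 2 * sin_int (a * z) (b * z).
  move=> z0; pose F y := sinc y * chi (a * z) (b * z) y.
  have iF : ig mu F by apply: ig_sinc; rewrite mulr_ge0 // ltW.
  have iFz : ig mu (fun y => z * F (z * y + 0)) by apply: igZ; exact: ig_affine.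
  have E y : hker y * sin (y * z) = z * F (z * y + 0) + z * F (z * (- y) + 0).
    have FE t : z * F (z * t + 0) = sin (t * z) / t * chi a b t.
      rewrite addr0 /F /sinc (mulrC z t) mulrA; congr (_ * _).
        by rewrite invfM mulrCA (mulrC t^-1) mulVKf ?gt_eqF.
      by rewrite !chiE ltr_pM2r // ler_pM2r.
    by rewrite !FE /hker mulNr sinN invrN mulrNN; ring.
  under eq_int do rewrite E.
  rewrite intD //; last exact: ig_opp iFz.
  rewrite (int_opp iFz) intZ; last exact: ig_affine.
  rewrite int_affine // mulrA mulfV ?gt_eqF // mul1r /sin_int -/F.
  by ring.
have [xi0|xi0|<-] := ltgtP 0 xi.
- by rewrite gtr0_sg // gtr0_norm // mulr1 pos.
- rewrite ltr0_sg // ltr0_norm // mulrN1 mulNr -pos ?oppr_gt0 // -intN //.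
  by apply: eq_int => y; rewrite mulrN sinN mulrN opprK.
- rewrite sgr0 mulr0 mul0r; under eq_int do rewrite mulr0 sin0 mulr0.
  by rewrite /Rintegral integral0.
Qed.

Lemma hker_cas x xi : \int[mu]_y (hker y * cas ((x - y) * xi)) =
  - (cas (- x * xi) * (2 * Num.sg xi * sin_int (a * `|xi|) (b * `|xi|))).
Proof.
rewrite -hker_sin.
have E y : hker y * cas ((x - y) * xi) =
    cas (x * xi) * (hker y * cos (y * xi)) - cas (- x * xi) * (hker y * sin (y * xi)).
  by rewrite /cas mulrBl cosB sinB !mulNr cosN sinN; ring.
under eq_int do rewrite E.
rewrite intB; [|exact: igZ|exact: igZ]; rewrite !intZ //.
suff -> : \int[mu]_y (hker y * cos (y * xi)) = 0 by rewrite mulr0 sub0r.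
have := int_opp (ig_kcos xi).
under eq_int do rewrite hker_odd !mulNr cosN.
by rewrite intN // => H; lra.
Qed.

Lemma hker_conv g x : ig mu g ->
  \int[mu]_y (T g (x - y) * hker y) =
  \int[mu]_xi (g xi * - (cas (- x * xi) * (2 * Num.sg xi * sin_int (a * `|xi|) (b * `|xi|)))).
Proof.
move=> ig_; pose k (z : RR) := hker z.1 * (g z.2 * cas ((x - z.1) * z.2)).
have mk : measurable_fun setT k.
  apply: measurable_funM; first exact: (measurableT_comp (ig_meas ig_hker) measurable_fst).
  apply: measurable_funM; first exact: (measurableT_comp (ig_meas ig_) measurable_snd).
  apply: (measurableT_comp cas_meas); apply: measurable_funM; last exact: measurable_snd.
  by apply: measurable_funB; [exact: measurable_cst|exact: measurable_fst].
have ik : ig (mu \x mu)%E k.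
  apply: (ig2_le mk (igZ 2 (ig_norm ig_hker)) (ig_norm ig_)) => y z.
  rewrite /k /= normrM (normrM (g z)) -mulrA [leRHS]mulrC -mulrA ler_wpM2l // ler_wpM2l //.
  exact: cas_le2.
have E := fubini_int ik (fun y => igZ (hker y) (ig_cas (x - y) ig_)) _.
transitivity (\int[mu]_y \int[mu]_z k (y, z)).
  apply: eq_int => y; rewrite /k /= intZ; last exact: ig_cas.
  by rewrite mulrC.
have ic xi : ig mu (fun y => hker y * cas ((x - y) * xi)).
  apply: (ig_Mbd (M := 2) ig_hker); last by move=> y; exact: cas_le2.
  apply: cont_meas => y; apply: (@continuous_comp _ _ _ (fun y => (x - y) * xi) cas); last exact: cas_cont.
  apply: cvgM; last exact: cvg_cst.
  by apply: cvgB; [exact: cvg_cst|exact: cvg_id].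
rewrite E; last first.
  by move=> z; apply: ig_eq (igZ (g z) (ic z)) => y; rewrite /k /= mulrCA.
apply: eq_int => z; rewrite -hker_cas -intZ //.
by apply: eq_int => y; rewrite /k /= mulrCA.
Qed.

Lemma hilbert_trunc_split f x : continuous f -> l2 f ->
  hilbert_trunc f x a = \int[mu]_y (f (x - y) * hker y) +
    \int[mu]_y (f (x - y) * (y^-1 * \1_(out b) y)).
Proof.
move=> cf lf; rewrite /hilbert_trunc int_restrict.
have lfx : l2 (fun y => f (x - y)).
  split; last exact: ig_refl lf.2.
  apply: cont_meas => z; apply: (@continuous_comp _ _ _ (fun z => x - z) f); last exact: cf.
  by apply: cvgB; [exact: cvg_cst|exact: cvg_id].
have b0' : 0 < b by rewrite /b ltr0n.
have E y : f (x - y) / y * \1_(out a) y =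
    f (x - y) * hker y + f (x - y) * (y^-1 * \1_(out b) y).
  by rewrite hkerE; ring.
under eq_int do rewrite E.
rewrite intD //; last by apply: l2_mul => //; exact: l2_inv_out.
apply: l2_mul => //.
rewrite (_ : hker = fun y => y^-1 * \1_(out a) y - y^-1 * \1_(out b) y).
  by apply: l2B; exact: l2_inv_out.
by apply/funext => y; rewrite hkerE.
Qed.

End kernel.

Lemma hilbert_multiplier g x l : ig mu g -> l2 g ->
  hilbert_trunc (T g) x e @[e --> 0^'+] --> l ->
  l = - (2 * dirichlet) * T (fun xi => Num.sg xi * g xi) (- x).
Proof.
move=> ig_ lg Hl; pose f := T g.
have cf : continuous f := T_cont ig_.
have lf : l2 f := (bessel ig_ lg).1.
have lfx : l2 (fun y => f (x - y)).
  split; last exact: ig_refl lf.2.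
  apply: cont_meas => z; apply: (@continuous_comp _ _ _ (fun z => x - z) f); last exact: cf.
  by apply: cvgB; [exact: cvg_cst|exact: cvg_id].
have Hn : hilbert_trunc f x (harmonic n) @[n --> \oo] --> l.
  have := (cvg_at_rightP _ 0 l).1 Hl; apply; split; first exact: harmonic_gt0.
  exact: cvg_harmonic.
have On : \int[mu]_y (f (x - y) * (y^-1 * \1_(out n.+1%:R) y)) @[n --> \oo] --> (0 : R).
  have -> : 0 = \int[mu]_z (0 : R) by rewrite /Rintegral integral0.
  apply: (@int_cvg _ _ _ mu _ _ _ _ _ (ig_norm (l2_mul lfx (l2_inv_out (ltr01 : 0 < 1 :> R)))) _).2.
  - by move=> n; apply: measurable_funM; [exact: lfx.1|apply: (l2_inv_out _).1; rewrite ltr0n].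
  - move=> y; apply: cvg_near_cst; exists (Num.trunc `|y|).+1 => // n /= yn.
    rewrite outE ltNge (_ : _ <= _) ?mulr0 //; apply: ltW.
    by apply: lt_le_trans (Num.Theory.truncnS_gt _) _; rewrite ler_nat ltnW.
  - move=> n y; rewrite !normrM; do 2!apply: ler_wpM2l => //.
    rewrite !outE; have [h|_] := ltP n.+1%:R `|y|; last by rewrite normr0.
    by rewrite (le_lt_trans _ h) // ler1n.
have Q : \int[mu]_y (f (x - y) * hker n y) @[n --> \oo] --> l.
  rewrite -[l]subr0; apply: cvg_trans (cvgB Hn On); apply: near_eq_cvg.
  apply: nearW => n; transitivity (hilbert_trunc f x (harmonic n) -
    \int[mu]_y (f (x - y) * (y^-1 * \1_(out n.+1%:R) y))) => //.
  by rewrite (hilbert_trunc_split n x cf lf) addrK.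
have L : \int[mu]_y (f (x - y) * hker n y) @[n --> \oo] -->
    \int[mu]_xi (g xi * - (cas (- x * xi) * (2 * Num.sg xi * dirichlet))).
  under eq_fun do rewrite hker_conv //.

  have bd n xi : `|cas (- x * xi) * (2 * Num.sg xi * sin_int (harmonic n * `|xi|) (n.+1%:R * `|xi|))|
      <= 2 * (2 * (3 + 2 * pi)).
    rewrite normrM; apply: ler_pM => //; first exact: cas_le2.
    rewrite normrM; apply: ler_pM => //.
      rewrite normrM normr_sg ger0_norm // ler_piMr //.
      by case: (xi != 0); rewrite ?ler01.
    apply: sin_int_bd; first by rewrite mulr_ge0 // ltW // harmonic_gt0.
    by rewrite ler_wpM2r // (le_trans (harmonic_le1 n)) // ler1n.
  apply: (@int_cvg _ _ _ mu _ _ _ _ _ (igZ (2 * (2 * (3 + 2 * pi))) (ig_norm ig_)) _).2.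
  - move=> n; have mm : measurable_fun setT (fun xi : R => \int[mu]_y (hker n y * cas ((x - y) * xi))).
      have ic z xi : ig mu (fun y => hker n y * cas ((z - y) * xi)).
        apply: (ig_Mbd (M := 2) (ig_hker n)); last by move=> y; exact: cas_le2.
        apply: cont_meas => y; apply: (@continuous_comp _ _ _ (fun y => (z - y) * xi) cas); last exact: cas_cont.
        apply: cvgM; last exact: cvg_cst.
        by apply: cvgB; [exact: cvg_cst|exact: cvg_id].
      apply: cont_meas => xi; apply/(@cvg_nbhsP _ R^o) => w wx.
      have [] := @int_cvg _ _ _ mu (fun n0 y => hker n y * cas ((x - y) * w n0))
        (fun y => hker n y * cas ((x - y) * xi)) (fun y => 2 * `|hker n y|) => //.
      + by move=> m; exact: ig_meas (ic x (w m)).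
      + move=> y; apply: cvgMr.
        apply: (@continuous_cvg _ _ _ _ _ _ (fun t => cas ((x - y) * t))) => //.
        exact: casx_cont.
      + by apply: igZ; apply: ig_norm; exact: ig_hker.
      + by move=> m y; rewrite normrM mulrC ler_wpM2r // cas_le2.
    apply: measurable_funM; first exact: ig_meas ig_.
    rewrite (_ : (fun _ => - _) = (fun xi : R => \int[mu]_y (hker n y * cas ((x - y) * xi)))) //.
    by apply/funext => xi; rewrite hker_cas.
  - move=> xi; apply: cvgMr; apply: cvgN; apply: cvgMr.
    have [->|xi0] := eqVneq xi 0.
      by rewrite sgr0 !mulr0 !mul0r; under eq_fun do rewrite mul0r; exact: cvg_cst.
    have p : 0 < `|xi| by rewrite normr_gt0.
    apply: cvgMr; apply: sin_int_cvg.
    + by move=> n; rewrite mulr_gt0 // harmonic_gt0.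
    + by rewrite -(mul0r `|xi|); apply: cvgMl; exact: cvg_harmonic.
    + apply/cvgryPge => A; exists (Num.trunc (`|A| / `|xi|)).+1 => // n /= An.
      apply: le_trans (ler_norm A) _; rewrite -ler_pdivrMr //.
      by apply: (ltW (lt_le_trans (Num.Theory.truncnS_gt _) _)); rewrite ler_nat ltnW.
  - by move=> n xi; rewrite normrM normrN mulrC ler_wpM2r.
rewrite -(cvg_lim _ Q) // (cvg_lim _ L) // /T.
have sg_ : ig mu (fun xi => Num.sg xi * g xi * cas (- x * xi)).
  apply: ig_cas; apply: ig_eq (ig_Mbd (M := 1) ig_ sgr_meas _) => [xi|xi].
    by rewrite mulrC.
  by rewrite normr_sg; case: (xi != 0); rewrite ?ler01.
rewrite -intZ //; apply: eq_int => xi; ring.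
Qed.

End hilbert_transform.

Section fourier_transform.
Context {R : realType}.
Local Notation mu := (@lebesgue_measure R).
Local Notation normc := (@ComplexField.Normc.normc R).
Local Notation Re := (@complex.Re R).
Local Notation Im := (@complex.Im R).
Implicit Types (f g h : R -> R) (F G : R -> R[i]) (x xi : R).

Lemma Lnorm2E f : l2 f -> Lnorm mu 2%:E (EFin \o f) = (Num.sqrt (\int[mu]_x (f x ^+ 2)))%:E.
Proof.
move=> lf; rewrite unlock /=.
have -> : (\int[mu]_x `|(EFin \o f) x| `^ 2 = (\int[mu]_x (f x ^+ 2))%:E)%E.
  rewrite -(ig_EFin lf.2); apply: eq_integral => x _ /=.
  by rewrite powR_mulrn // real_normK ?num_real.
by rewrite poweR_EFin powR12_sqrt // int_ge0 // => x; exact: sqr_ge0.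
Qed.

Lemma Lnorm2_fin f : measurable_fun setT f -> (Lnorm mu 2%:E (EFin \o f) < +oo)%E -> l2 f.
Proof.
move=> mf N; split => //; apply: ge0_igP; first exact: measurable_funX.
  by move=> x; exact: sqr_ge0.
have n2 : (2 : R) != 0 by [].
have -> : (\int[mu]_x (f x ^+ 2)%:E = \int[mu]_x `|(EFin \o f) x| `^ 2)%E.
  by apply: eq_integral => x _ /=; rewrite powR_mulrn // real_normK ?num_real.
by rewrite -poweR_Lnorm //; exact: poweR_lty.
Qed.

Lemma sqrt_cvg0 (I : Type) (D : set_system I) (u : I -> R) : Filter D -> (forall i, 0 <= u i) ->
  (Num.sqrt (u i) @[i --> D] --> (0 : R)) <-> (u i @[i --> D] --> (0 : R)).
Proof.
move=> FD u0; split=> H.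
  have -> : u = (fun i => Num.sqrt (u i) * Num.sqrt (u i)).
    by apply/funext => i; rewrite -expr2 sqr_sqrtr.
  by rewrite -(mulr0 (0 : R)); exact: cvgM.
rewrite -[X in _ --> X](@sqrtr0 R); apply: continuous_cvg => //.
exact: sqrt_continuous.
Qed.

Lemma Lnorm2_cvg0 (f_ : nat -> R -> R) : (forall n, l2 (f_ n)) ->
  (Lnorm mu 2%:E (EFin \o f_ n) @[n --> \oo] --> 0%E) <->
  (\int[mu]_x (f_ n x ^+ 2) @[n --> \oo] --> (0 : R)).
Proof.
move=> lf; under eq_fun do rewrite Lnorm2E //.
rewrite -(sqrt_cvg0 (u := fun n => \int[mu]_x (f_ n x ^+ 2))); last first.
  by move=> n; apply: int_ge0 => x; exact: sqr_ge0.
split; last by move=> H; apply: cvg_EFin; [exact: nearW|exact: H].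
by move=> /fine_cvgP[_].
Qed.

Lemma normcE (z : R[i]) : normc z ^+ 2 = Re z ^+ 2 + Im z ^+ 2.
Proof. by case: z => a b /=; rewrite sqr_sqrtr // addr_ge0 ?sqr_ge0. Qed.

Lemma normc_l2 F : l2 (Re \o F) -> l2 (Im \o F) -> l2 (normc \o F).
Proof.
move=> lr li; have m : measurable_fun setT (normc \o F).
  rewrite (_ : _ \o _ = fun x => Num.sqrt (Re (F x) ^+ 2 + Im (F x) ^+ 2)).
    apply: (measurableT_comp (cont_meas (@sqrt_continuous R))).
    by apply: measurable_funD; apply: measurable_funX; [exact: lr.1|exact: li.1].
  by apply/funext => x /=; case: (F x).
by split => //; apply: ig_eq (igD lr.2 li.2) => x; rewrite /= normcE.
Qed.

Definition trunc_fun n f : R -> R := fun y => f y * \1_(`[- n%:R, n%:R]%classic) y.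

Lemma trunc_fun_l2 n f : l2 f -> ig mu (trunc_fun n f) /\ l2 (trunc_fun n f).
Proof.
move=> lf; have m : measurable (`[- n%:R, n%:R]%classic : set R) by exact: measurable_itv.
have l : l2 (trunc_fun n f) by exact: l2_indic.
split => //; have i1 : ig mu (fun y : R => 1 * \1_(`[- n%:R, n%:R]%classic) y).
  by apply: ig_itv; apply: continuous_subspaceT => ?; exact: cvg_cst.
have l1 : l2 (fun y : R => 1 * \1_(`[- n%:R, n%:R]%classic) y).
  by apply: (ig_bd_l2 (M := 1) i1) => y; rewrite mul1r; exact: indic_le1.
apply: ig_eq (l2_mul lf l1) => y; by rewrite mul1r.
Qed.

Let trR n f xi := 2^-1 * (T (trunc_fun n f) xi + T (trunc_fun n f) (- xi)).
Let trI n f xi := 2^-1 * (T (trunc_fun n f) (- xi) - T (trunc_fun n f) xi).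

Lemma fourier_truncE n f xi : l2 f ->
  fourier_trunc n f xi = Complex (trR n f xi) (trI n f xi).
Proof.
move=> lf; have [i _] := trunc_fun_l2 n lf.
have ic (c : R -> R) : (forall x, `|c x| <= 1) -> continuous c -> ig mu (fun x => trunc_fun n f x * c (xi * x)).
  move=> c1 cc; apply: (ig_Mbd (M := 1) i); last by move=> y; exact: c1.
  apply: cont_meas => z; apply: (@continuous_comp _ _ _ (fun z => xi * z) c); last exact: cc.
  by apply: cvgM; [exact: cvg_cst|exact: cvg_id].
have icos := ic _ (@cos_bd R) (@continuous_cos R).
have isin := ic _ (@sin_bd R) (@continuous_sin R).
have Tp : T (trunc_fun n f) xi = \int[mu]_x (trunc_fun n f x * cos (xi * x)) +
    \int[mu]_x (trunc_fun n f x * sin (xi * x)).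
  by rewrite -intD //; apply: eq_int => x; rewrite -mulrDr.
have Tm : T (trunc_fun n f) (- xi) = \int[mu]_x (trunc_fun n f x * cos (xi * x)) -
    \int[mu]_x (trunc_fun n f x * sin (xi * x)).
  by rewrite -intB //; apply: eq_int => x; rewrite -mulrBr mulNr /cas cosN sinN.
have E (c : R -> R) : \int[mu]_(x in `[- n%:R, n%:R]) (f x * c (xi * x)) =
    \int[mu]_x (trunc_fun n f x * c (xi * x)).
  by rewrite int_restrict; apply: eq_int => x; rewrite /trunc_fun mulrAC.
rewrite /fourier_trunc !E /trR /trI Tp Tm; congr Complex; lra.
Qed.

Lemma T_opp_l2 h : ig mu h -> l2 h -> l2 (fun x => T h (- x)).
Proof.
move=> ih lh; have [m i] := (bessel ih lh).1.
split; last exact: ig_opp i.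
apply: (measurableT_comp m); apply: cont_meas; exact: opp_continuous.
Qed.

Let tr_l2 n f : l2 f -> l2 (trR n f) /\ l2 (trI n f).
Proof.
move=> lf; have [i l] := trunc_fun_l2 n lf.
have a := (bessel i l).1; have b := T_opp_l2 i l.
by split; apply: l2Z; [exact: l2D|exact: l2B].
Qed.

Lemma is_fourierP f F : l2 f -> is_fourier f F <->
  [/\ l2 (Re \o F), l2 (Im \o F),
   \int[mu]_xi ((Re (F xi) - trR n f xi) ^+ 2) @[n --> \oo] --> (0 : R) &
   \int[mu]_xi ((Im (F xi) - trI n f xi) ^+ 2) @[n --> \oo] --> (0 : R)].
Proof.
move=> lf.
have ReB n xi : Re (F xi - fourier_trunc n f xi) = Re (F xi) - trR n f xi.
  by rewrite fourier_truncE //; case: (F xi).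
have ImB n xi : Im (F xi - fourier_trunc n f xi) = Im (F xi) - trI n f xi.
  by rewrite fourier_truncE //; case: (F xi).
have key : l2 (Re \o F) -> l2 (Im \o F) ->
  (Lnorm mu 2%:E (fun xi => (normc (F xi - fourier_trunc n f xi))%:E) @[n --> \oo] --> 0%E) <->
  (\int[mu]_xi ((Re (F xi) - trR n f xi) ^+ 2) @[n --> \oo] --> (0 : R) /\
   \int[mu]_xi ((Im (F xi) - trI n f xi) ^+ 2) @[n --> \oo] --> (0 : R)).
  move=> lr li.
  have lrn n : l2 (fun xi => Re (F xi) - trR n f xi) := l2B lr (tr_l2 n lf).1.
  have lin n : l2 (fun xi => Im (F xi) - trI n f xi) := l2B li (tr_l2 n lf).2.
  have ln n : l2 (normc \o (fun xi => F xi - fourier_trunc n f xi)).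
    apply: normc_l2.
      by rewrite (_ : _ \o _ = fun xi => Re (F xi) - trR n f xi) //; apply/funext => xi /=.
    by rewrite (_ : _ \o _ = fun xi => Im (F xi) - trI n f xi) //; apply/funext => xi /=.
  rewrite (Lnorm2_cvg0 ln).
  have E n : \int[mu]_x ((normc \o (fun xi => F xi - fourier_trunc n f xi)) x ^+ 2) =
     \int[mu]_xi ((Re (F xi) - trR n f xi) ^+ 2) + \int[mu]_xi ((Im (F xi) - trI n f xi) ^+ 2).
    rewrite -intD; [|exact: (lrn n).2|exact: (lin n).2].
    by apply: eq_int => xi /=; rewrite normcE ReB ImB.
  under eq_fun do rewrite E.
  split=> [H|[H1 H2]]; last by rewrite -(addr0 0); exact: cvgD.
  by split; apply: squeeze_cvgr (cvg_cst (0 : R)) H; apply: nearW => n;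
    rewrite int_ge0 ?lerDl ?lerDr ?int_ge0 // => xi; exact: sqr_ge0.
split=> [[/L2P lr /L2P li /(key lr li)[]]|[lr li H1 H2]] //.
by split; [exact/L2P|exact/L2P|exact/(key lr li)].
Qed.

Definition cplx_lin (a b : R) F G xi :=
  Complex (a * Re (F xi) + b * Re (G xi)) (a * Im (F xi) + b * Im (G xi)).

Let sqr_lin_cvg (a b : R) (u v w : nat -> R -> R) :
  (forall n, l2 (u n)) -> (forall n, l2 (v n)) ->
  (forall n x, w n x = a * u n x + b * v n x) ->
  \int[mu]_x (u n x ^+ 2) @[n --> \oo] --> (0 : R) ->
  \int[mu]_x (v n x ^+ 2) @[n --> \oo] --> (0 : R) ->
  \int[mu]_x (w n x ^+ 2) @[n --> \oo] --> (0 : R).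
Proof.
move=> lu lv wE u0 v0.
have B : 2 * a ^+ 2 * \int[mu]_x (u n x ^+ 2) + 2 * b ^+ 2 * \int[mu]_x (v n x ^+ 2) @[n --> \oo] --> (0 : R).
  have := cvgD (cvgM (cvg_cst (2 * a ^+ 2)) u0) (cvgM (cvg_cst (2 * b ^+ 2)) v0).
  by rewrite !mulr0 addr0; apply.
apply: squeeze_cvgr (cvg_cst (0 : R)) B; apply: nearW => n.
rewrite int_ge0 => [/=|x]; last exact: sqr_ge0.
rewrite -!intZ; [|exact: (lv n).2|exact: (lu n).2].
rewrite -intD; [|apply: igZ; exact: (lu n).2|apply: igZ; exact: (lv n).2].
apply: le_int.
- rewrite (_ : (fun x => w n x ^+ 2) = fun x => (a * u n x + b * v n x) ^+ 2).
    by have [] := l2D (l2Z a (lu n)) (l2Z b (lv n)).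
  by apply/funext => x; rewrite wE.
- by apply: igD; apply: igZ; [exact: (lu n).2|exact: (lv n).2].
- move=> x; rewrite wE -subr_ge0 (_ : _ - _ = (a * u n x - b * v n x) ^+ 2) ?sqr_ge0 //.
  by ring.
Qed.

Lemma is_fourier_lin (a b : R) f g F G : l2 f -> l2 g ->
  is_fourier f F -> is_fourier g G ->
  is_fourier (fun x => a * f x + b * g x) (cplx_lin a b F G).
Proof.
move=> lf lg /(is_fourierP _ lf)[fr fi fR fI] /(is_fourierP _ lg)[gr gi gR gI].
have lfg : l2 (fun x => a * f x + b * g x) by apply: l2D; exact: l2Z.
have TE n xi : T (trunc_fun n (fun x => a * f x + b * g x)) xi =
    a * T (trunc_fun n f) xi + b * T (trunc_fun n g) xi.
  have [if_ _] := trunc_fun_l2 n lf; have [ig_ _] := trunc_fun_l2 n lg.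
  rewrite -!TZ // -TD; [|exact: igZ|exact: igZ].
  by congr T; apply/funext => x; rewrite /trunc_fun mulrDl !mulrA.
apply/(is_fourierP _ lfg); split.
- by apply: l2D; exact: l2Z.
- by apply: l2D; exact: l2Z.
- apply: (sqr_lin_cvg (a := a) (b := b) (fun n => l2B fr (tr_l2 n lf).1) (fun n => l2B gr (tr_l2 n lg).1) _ fR gR).
  by move=> n xi /=; rewrite /trR !TE; ring.
- apply: (sqr_lin_cvg (a := a) (b := b) (fun n => l2B fi (tr_l2 n lf).2) (fun n => l2B gi (tr_l2 n lg).2) _ fI gI).
  by move=> n xi /=; rewrite /trI !TE; ring.
Qed.

Lemma fourier_ex f F : is_fourier f F -> is_fourier f (fourier f).
Proof. by move=> H; apply: (@xgetPex _ (fun=> 0) [set g | is_fourier f g]); exists F. Qed.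

(* [Re F - Im F] is the Hartley transform of a function with Fourier transform [F]; the factor
   makes [T] its inverse. *)
Definition hartley F xi := (2 * pi)^-1 * (Re (F xi) - Im (F xi)).

Definition hart f : R -> R := hartley (fourier f).

Lemma hartley_trunc_cvg f F : l2 f -> is_fourier f F ->
  l2 (hartley F) /\
  \int[mu]_xi ((2 * pi * hartley F xi - T (trunc_fun n f) xi) ^+ 2) @[n --> \oo] --> (0 : R).
Proof.
move=> lf /(is_fourierP _ lf)[lr li HR HI]; split.
  by apply: l2Z; exact: l2B.
apply: (sqr_lin_cvg (a := 1) (b := -1) (fun n => l2B lr (tr_l2 n lf).1) (fun n => l2B li (tr_l2 n lf).2) _ HR HI).
move=> n xi; rewrite /hartley mulrA mulfV ?mul1r; last first.
  by apply: mulf_neq0 => //; apply: lt0r_neq0; exact: pi_gt0.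
by rewrite /trR /trI /=; field.
Qed.

Lemma sqr_int0 f x : continuous f -> l2 f -> \int[mu]_x (f x ^+ 2) = 0 -> f x = 0.
Proof.
move=> cf lf f0; apply: contrapT => /eqP fx.
have e0 : 0 < f x ^+ 2 / 2 by rewrite divr_gt0 // exprn_even_gt0.
have cf2 : {for x, continuous (fun y => f y ^+ 2)}.
  by apply: (@continuous_comp _ _ _ f (fun y => y ^+ 2)); [exact: cf|exact: exprn_continuous].
have [d /= d0 Hd] : \forall y \near x, f x ^+ 2 / 2 <= f y ^+ 2.
  have : \forall y \near x, f x ^+ 2 / 2 < f y ^+ 2 by apply: (cvgr_gt _ cf2); lra.
  by apply: filterS => y; exact: ltW.
have : mu `]x - d, x + d[%classic = 0%E.
  apply: (int_eq0_measure0 lf.2 (fun y => sqr_ge0 _) f0 (measurable_itv _) e0) => y /=.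
  rewrite in_itv /= => /andP[y1 y2]; apply: Hd => /=.
  by rewrite ltr_norml; lra.
rewrite lebesgue_measure_itv /= lte_fin (_ : x - d < x + d) ?lerD2l; last by lra.
by move=> [] E; lra.
Qed.

Lemma sqr_int0_T0 h x : ig mu h -> l2 h -> \int[mu]_xi (h xi ^+ 2) = 0 -> T h x = 0.
Proof.
move=> ih lh h0; have [lT] := bessel ih lh; rewrite h0 mulr0 => T0.
apply: sqr_int0 => //; first exact: T_cont.
by apply/eqP; rewrite eq_le T0 int_ge0 // => y; exact: sqr_ge0.
Qed.

Lemma hartley_unique f F G x : l2 f -> is_fourier f F -> is_fourier f G ->
  ig mu (hartley F) -> ig mu (hartley G) -> T (hartley F) x = T (hartley G) x.
Proof.
move=> lf fF fG iF iG; have [lF HF] := hartley_trunc_cvg lf fF.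
have [lG HG] := hartley_trunc_cvg lf fG.
apply/eqP; rewrite -subr_eq0 -TB //; apply/eqP.
apply: sqr_int0_T0; [exact: igB|exact: l2B|].
have lT n : l2 (T (trunc_fun n f)).
  by have [i l] := trunc_fun_l2 n lf; exact: (bessel i l).1.
have H : \int[mu]_xi ((hartley F xi - hartley G xi) ^+ 2) @[n --> \oo] --> (0 : R).
  apply: (sqr_lin_cvg (a := (2 * pi)^-1) (b := - (2 * pi)^-1)
    (w := fun n xi => hartley F xi - hartley G xi)
    (fun n => l2B (l2Z (2 * pi) lF) (lT n)) (fun n => l2B (l2Z (2 * pi) lG) (lT n)) _ HF HG).
  move=> n xi; have gen (c p A B t : R) : c * p = 1 -> A - B = c * (p * A - t) + - c * (p * B - t).
    by move=> e; rewrite [RHS](_ : _ = c * p * (A - B)); [rewrite e mul1r|ring].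
  by apply: gen; apply: mulVf; apply: mulf_neq0 => //; apply: lt0r_neq0; exact: pi_gt0.
have L := cvg_lim (@Rhausdorff R) H; rewrite -L; apply/esym/cvg_lim; first exact: Rhausdorff.
exact: cvg_cst.
Qed.

End fourier_transform.

Section sobolev_weights.
Context {R : realType}.
Local Notation mu := (@lebesgue_measure R).
Local Notation normc := (@ComplexField.Normc.normc R).
Implicit Types (f h p : R -> R) (a b q r s x xi : R).

(* The Japanese bracket [<xi>^r], i.e. the weight of the norm of H^r. *)
Definition japanese r xi := (1 + xi ^+ 2) `^ (r / 2).

Let base_gt0 xi : 0 < 1 + xi ^+ 2.
Proof. by rewrite ltr_pwDl // sqr_ge0. Qed.

Lemma japanese_gt0 r xi : 0 < japanese r xi.
Proof. exact: powR_gt0. Qed.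

Lemma japaneseD a b xi : japanese (a + b) xi = japanese a xi * japanese b xi.
Proof. by rewrite /japanese mulrDl powRD //; apply/implyP => _; rewrite gt_eqF. Qed.

Lemma japanese0 xi : japanese 0 xi = 1.
Proof. by rewrite /japanese mul0r powRr0. Qed.

Lemma le_japanese a b xi : a <= b -> japanese a xi <= japanese b xi.
Proof.
move=> ab; apply: ler_powR; first by rewrite lerDl sqr_ge0.
by rewrite ler_pM2r.
Qed.

Lemma le_japanese1 xi : `|xi| <= japanese 1 xi.
Proof.
rewrite /japanese mul1r powR12_sqrt; last exact/ltW/base_gt0.
by rewrite -sqrtr_sqr ler_wsqrtr // lerDr.
Qed.

Lemma le_japanese2 xi : xi ^+ 2 <= japanese 2 xi.
Proof.
by rewrite /japanese divff // powRr1 ?lerDr // ltW.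
Qed.

Lemma powR_cont r x : 0 < x -> {for x, continuous (fun y => y `^ r)}.
Proof. by move=> x0; exact: der_cont (is_derive1_powR r x0). Qed.

Lemma japanese_meas r : measurable_fun setT (japanese r).
Proof.
apply: cont_meas => x; apply: (@continuous_comp _ _ _ (fun x => 1 + x ^+ 2) (fun y => y `^ (r / 2))).
  by apply: cvgD; [exact: cvg_cst|apply: cvgM; exact: cvg_id].
exact: powR_cont.
Qed.

Let tail q x := (1 + `|x|) `^ (- q).

Let base1_gt0 x : 0 < 1 + `|x|.
Proof. by rewrite ltr_pwDl. Qed.

Let ig_tail q : 1 < q -> ig mu (tail q).
Proof.
move=> q1; have q0 : 0 < q - 1 by rewrite subr_gt0.
have [|||||] := @even_FTC _ (tail q) (fun x => (1 - q)^-1 * (1 + x) `^ (1 - q)) ((1 - q)^-1 * 0) => //.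
- move=> x; apply: (@continuous_comp _ _ _ (fun x => 1 + `|x|) (fun y => y `^ (- q))).
    by apply: cvgD; [exact: cvg_cst|exact: norm_continuous].
  exact: powR_cont.
- by move=> x; exact: powR_ge0.
- by move=> x; rewrite /tail normrN.
- move=> x x0; have p : 0 < 1 + x by rewrite ltr_pwDl.
  have D := @derComp _ (fun y => y `^ (1 - q)) (fun x => 1 + x) x _ _ (is_derive1_powR (1 - q) p) (derD (derC 1 x) (derI x)).
  apply: (der_eq (derZ (1 - q)^-1 D)).
  rewrite add0r mulr1 mulrA mulVf ?mul1r; last by rewrite lt_eqF // subr_lt0.
  by rewrite /tail ger0_norm //; congr (_ `^ _); lra.
- apply: cvgMr; have -> : (fun x => (1 + x) `^ (1 - q)) = (fun x => ((1 + x) `^ (q - 1))^-1).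
    by apply/funext => x; rewrite -powRN opprB.
  apply/gtr0_cvgV0.
    by near=> x; apply: powR_gt0; rewrite ltr_pwDl //; near: x; exact: nbhs_pinfty_ge.
  apply/cvgryPge => A; near=> x.
  have x0 : `|A| `^ (q - 1)^-1 <= 1 + x.
    rewrite -lerBlDl; near: x; apply: nbhs_pinfty_ge; exact: num_real.
  apply: le_trans (ler_norm A) _.
  have -> : `|A| = (`|A| `^ (q - 1)^-1) `^ (q - 1).
    by rewrite -powRrM mulVf ?gt_eqF // powRr1.
  have p0 := le_trans (powR_ge0 _ _) x0.
  by apply: ge0_ler_powR; rewrite ?nnegrE ?powR_ge0 // ltW.
Unshelve. all: by end_near.
Qed.

Lemma japanese_l2 r : 2^-1 < r -> l2 (japanese (- r)).
Proof.
move=> r1; split; first exact: japanese_meas.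
have r0 : 0 < r by apply: lt_trans r1; rewrite invr_gt0.
apply: ig_le (igZ (2 `^ r) (ig_tail (_ : 1 < 2 * r))) _; last first.
- move=> x; rewrite ger0_norm ?sqr_ge0 // expr2 -japaneseD /japanese.
  rewrite (_ : (- r - r) / 2 = - r); last by field.
  rewrite /tail -mulrN powRrM (_ : (1 + `|x|) `^ 2 = (1 + `|x|) ^+ 2); last first.
    by rewrite powR_mulrn // ltW.
  rewrite !powRN ler_pdivlMr; last by rewrite powR_gt0 // exprn_gt0.
  rewrite mulrC ler_pdivrMr; last exact: powR_gt0.
  rewrite -powRM //; last exact: ltW.
  have le : (1 + `|x|) ^+ 2 <= 2 * (1 + x ^+ 2).
    rewrite -(real_normK (num_real x)); have := sqr_ge0 (1 - `|x|); nra.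
  by apply: ge0_ler_powR => //; rewrite ?nnegrE ltW // ?exprn_gt0 // mulr_gt0.
- by move: r1; rewrite -(@ltr_pM2l _ 2) // mulfV.
- by apply: measurable_funX; exact: japanese_meas.
Qed.

Definition snorm s f : R := fine (sobolev_norm s f).

Lemma snorm_ge0 s f : 0 <= snorm s f.
Proof. by rewrite /snorm fine_ge0 // /sobolev_norm Lnorm_ge0. Qed.

Lemma japanese_hart s f : sobolev s f ->
  l2 (fun xi => japanese s xi * hart f xi) /\
  \int[mu]_xi ((japanese s xi * hart f xi) ^+ 2) <= snorm s f ^+ 2.
Proof.
move=> [lf [/L2P fr /L2P fi _] fin].
have ln := normc_l2 fr fi; pose w xi := japanese s xi * normc (fourier f xi).
have mw : measurable_fun setT w by apply: measurable_funM; [exact: japanese_meas|exact: ln.1].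
have lw : l2 w by exact: Lnorm2_fin mw fin.
have nE : snorm s f ^+ 2 = \int[mu]_xi (w xi ^+ 2).
  rewrite /snorm (_ : sobolev_norm s f = Lnorm mu 2%:E (EFin \o w)) // Lnorm2E //=.
  by rewrite sqr_sqrtr // int_ge0 // => x; exact: sqr_ge0.
have le xi : (japanese s xi * hart f xi) ^+ 2 <= w xi ^+ 2.
  rewrite !exprMn; apply: ler_wpM2l; first exact: sqr_ge0.
  rewrite normcE.
  set a := complex.Re _; set b := complex.Im _.
  have p1 : (2 * pi : R)^-1 ^+ 2 <= 2^-1.
    have := @pi_ge2 R => p2; rewrite exprVn lef_pV2 ?posrE //; first by nra.
    by rewrite exprn_gt0 // mulr_gt0 // (lt_le_trans _ p2).
  apply: le_trans (ler_wpM2r (sqr_ge0 _) p1) _; have := sqr_ge0 (a + b); lra.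
have lh : l2 (fun xi => japanese s xi * hart f xi).
  have mh : measurable_fun setT (fun xi => japanese s xi * hart f xi).
    apply: measurable_funM; first exact: japanese_meas.
    by apply: measurable_funM => //; apply: measurable_funB; [exact: fr.1|exact: fi.1].
  apply: (l2_le mh lw) => xi; rewrite -(@ler_pXn2r _ 2) ?nnegrE //.
  by rewrite !real_normK ?num_real.
by split => //; rewrite nE; apply: le_int => //; [exact: lh.2|exact: lw.2].
Qed.

Definition japanese_cst r := Num.sqrt (\int[mu]_xi (japanese (- r) xi ^+ 2)).

Lemma hart_mul s m p f : sobolev s f -> 2^-1 < s - m -> measurable_fun setT p ->
  (forall xi, `|p xi| <= japanese m xi) ->
  [/\ ig mu (fun xi => p xi * hart f xi), l2 (fun xi => p xi * hart f xi),
   \int[mu]_xi `|p xi * hart f xi| <= japanese_cst (s - m) * snorm s f &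
   \int[mu]_xi ((p xi * hart f xi) ^+ 2) <= snorm s f ^+ 2].
Proof.
move=> sf sm mp pm; have [lw nw] := japanese_hart sf.
have mh : measurable_fun setT (fun xi => p xi * hart f xi).
  apply: measurable_funM => //; case: sf => _ [/L2P fr /L2P fi _] _.
  by apply: measurable_funM => //; apply: measurable_funB; [exact: fr.1|exact: fi.1].
have lwn : l2 (fun xi => `|japanese s xi * hart f xi|).
  split; first by apply: measurableT_comp => //; exact: lw.1.
  by apply: ig_eq lw.2 => xi; rewrite real_normK ?num_real.
have lj := japanese_l2 sm.
have iw : ig mu (fun xi => japanese (- (s - m)) xi * `|japanese s xi * hart f xi|).
  exact: l2_mul.
have le1 xi : `|p xi * hart f xi| <= japanese (- (s - m)) xi * `|japanese s xi * hart f xi|.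
  rewrite normrM (normrM (japanese s xi)) (gtr0_norm (japanese_gt0 _ _)) mulrA -japaneseD.
  rewrite (_ : - (s - m) + s = m); last by ring.
  exact: ler_wpM2r.
have le2 xi : `|p xi * hart f xi| <= `|japanese s xi * hart f xi|.
  rewrite normrM (normrM (japanese s xi)) (gtr0_norm (japanese_gt0 _ _)).
  apply: ler_wpM2r => //; apply: le_trans (pm xi) _; apply: le_japanese.
  by rewrite -subr_ge0 ltW // (lt_trans _ sm) // invr_gt0.
have ip : ig mu (fun xi => p xi * hart f xi) by exact: (@ig_le _ _ _ mu _ _ mh iw le1).
have lp : l2 (fun xi => p xi * hart f xi) by exact: l2_le mh lw le2.
split => //.
- apply: le_trans (le_int (ig_norm ip) iw le1) _.
  apply: le_trans (ler_norm _) _; apply: l2_bound => //.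
  + rewrite /japanese_cst sqr_sqrtr // int_ge0 // => xi; exact: sqr_ge0.
  + apply: le_trans nw; rewrite le_eqVlt; apply/orP; left; apply/eqP.
    by apply: eq_int => xi; rewrite real_normK ?num_real.
  + exact: sqrtr_ge0.
  + exact: snorm_ge0.
- apply: le_trans nw; apply: le_int; [exact: lp.2|exact: lw.2|] => xi.
  rewrite -(real_normK (num_real (p xi * _))) -(real_normK (num_real (japanese s xi * _))).
  by rewrite lerXn2r ?nnegrE.
Qed.

Lemma hart_sobolev s f : sobolev s f -> 2^-1 < s ->
  [/\ ig mu (hart f), l2 (hart f),
   \int[mu]_xi `|hart f xi| <= japanese_cst s * snorm s f &
   \int[mu]_xi (hart f xi ^+ 2) <= snorm s f ^+ 2].
Proof.
move=> sf s1; have [||xi|] := @hart_mul s 0 (fun=> 1) f sf.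
- by rewrite subr0.
- exact: measurable_cst.
- by rewrite japanese0 normr1.
rewrite subr0 (_ : (fun xi => 1 * hart f xi) = hart f); last first.
  by apply/funext => xi; rewrite mul1r.
by under eq_int do rewrite mul1r; under [X in X <= _ ^+ 2]eq_int do rewrite mul1r.
Qed.

Lemma sobolev_inversion s f x : sobolev s f -> 2^-1 < s -> continuous f ->
  T (hart f) x = f x.
Proof.
move=> sf s1 cf; have [ih lh _ _] := hart_sobolev sf s1.
case: sf => /L2P lf ff _.
have [_ H] := hartley_trunc_cvg lf ff.
have p0 : 2 * pi != 0 :> R by apply: mulf_neq0 => //; apply: lt0r_neq0; exact: pi_gt0.
apply: (mulfI p0); rewrite -TZ //.
by apply: (hartley_inversion x cf lf _ _ H); [exact: igZ|exact: l2Z].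
Qed.

Definition good h := [/\ ig mu h, l2 h, ig mu (fun xi => xi * h xi) /\ l2 (fun xi => xi * h xi),
  ig mu (fun xi => xi * (xi * h xi)) & l2 (fun xi => xi * (xi * h xi))].

Lemma sobolev_good s f : 5 / 2 < s -> sobolev s f -> good (hart f).
Proof.
move=> s5 sf; have [|ih lh _ _] := hart_sobolev sf; first by lra.
have [||xi|i1 l1 _ _] := @hart_mul s 1 (fun xi => xi) f sf.
- by lra.
- exact: measurable_id.
- exact: le_japanese1.
have [||xi|i2 l2' _ _] := @hart_mul s 2 (fun xi => xi ^+ 2) f sf.
- by lra.
- by apply: measurable_funX; exact: measurable_id.
- by rewrite ger0_norm ?sqr_ge0 //; exact: le_japanese2.
have E : (fun xi => xi ^+ 2 * hart f xi) = (fun xi => xi * (xi * hart f xi)).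
  by apply/funext => xi; rewrite expr2 mulrA.
by rewrite E in i2 l2'.
Qed.

Lemma goodB h1 h2 : good h1 -> good h2 -> good (fun xi => h1 xi - h2 xi).
Proof.
move=> [i0 l0 [i1 l1] i2 l2'] [j0 k0 [j1 k1] j2 k2].
have E1 : (fun xi => xi * (h1 xi - h2 xi)) = (fun xi => xi * h1 xi - xi * h2 xi).
  by apply/funext => xi; rewrite mulrBr.
have E2 : (fun xi => xi * (xi * (h1 xi - h2 xi))) = (fun xi => xi * (xi * h1 xi) - xi * (xi * h2 xi)).
  by apply/funext => xi; rewrite !mulrBr.
split; [exact: igB|exact: l2B| |rewrite E2; exact: igB|rewrite E2; exact: l2B].
by rewrite E1; split; [exact: igB|exact: l2B].
Qed.

Lemma good_sgn h : good h -> ig mu (fun xi => xi * `|xi| * h xi) /\ l2 (fun xi => xi * `|xi| * h xi).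
Proof.
move=> [i0 l0 _ i2 l2'].
have m : measurable_fun setT (fun xi : R => xi * `|xi| * h xi).
  apply: measurable_funM; last exact: l0.1.
  apply: cont_meas => x; apply: cvgM; [exact: cvg_id|exact: norm_continuous].
have E xi : `|xi * `|xi| * h xi| = `|xi * (xi * h xi)|.
  by rewrite !normrM normr_id mulrA.
split; first by apply: (@ig_le _ _ _ mu _ _ m (ig_norm i2)) => xi; rewrite E.
by apply: l2_le m l2' _ => xi; rewrite E.
Qed.

Section representation.
Variables (f h : R -> R).
Hypotheses (gh : good h) (fE : forall x, f x = T h x).

Lemma rep_der1 x : is_derive x 1 f (T (fun xi => xi * h xi) (- x)).
Proof.
have [i0 _ [i1 _] _ _] := gh; rewrite (_ : f = T h); last exact/funext.
exact: T_der.
Qed.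

Lemma rep_der2 x : is_derive x 1 (fun x => T (fun xi => xi * h xi) (- x))
  (- T (fun xi => xi * (xi * h xi)) x).
Proof.
have [_ _ [i1 _] i2 _] := gh.
apply: (der_eq (@derComp _ (T (fun xi => xi * h xi)) (fun x => - x) x _ _ (T_der (- x) i1 i2) (derN (derI x)))).
by rewrite opprK mulrN1.
Qed.

Lemma rep_derive1 : derive1 f = (fun x => T (fun xi => xi * h xi) (- x)).
Proof. by apply/funext => x; rewrite derive1E; have d := rep_der1 x; rewrite derive_val. Qed.

Lemma rep_derive2 : derive1n 2 f = T (fun xi => - (xi * (xi * h xi))).
Proof.
have [_ _ _ i2 _] := gh; apply/funext => x.
rewrite /derive1n /= rep_derive1 derive1E; have d := rep_der2 x; rewrite derive_val.
rewrite -mulN1r -TZ //; congr T; by apply/funext => xi; rewrite mulN1r.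
Qed.

Lemma rep_hilbert x : cvg (hilbert_trunc (derive1n 2 f) x e @[e --> 0^'+]) ->
  hilbert (derive1n 2 f) x = pi^-1 * (2 * dirichlet) * T (fun xi => xi * `|xi| * h xi) (- x).
Proof.
have [_ _ _ i2 l2'] := gh => c.
have [is_ _] := good_sgn gh.
rewrite /hilbert; move: c; rewrite rep_derive2 => c.
rewrite (hilbert_multiplier _ _ c); last 2 first.
- exact: igN.
- rewrite (_ : (fun _ => _) = (fun xi => -1 * (xi * (xi * h xi)))); first exact: l2Z.
  by apply/funext => xi; rewrite mulN1r.
have E xi : Num.sg xi * - (xi * (xi * h xi)) = - (xi * `|xi| * h xi).
  by rewrite (normrEsg xi); ring.
rewrite -mulrA mulNr -mulrN; congr (_ * (_ * _)); rewrite -mulN1r -TZ //.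
  by congr T; apply/funext => xi; rewrite E mulN1r opprK.
by apply: ig_eq (igN is_) => xi; rewrite E.
Qed.

End representation.
End sobolev_weights.

Section energy_tools.
Context {R : realType}.
Local Notation mu := (@lebesgue_measure R).
Implicit Types (F f g : R -> R) (x h : R).

Let half_line F f : ig mu F -> ig mu f -> continuous f ->
  (forall x, is_derive x 1 F (f x)) -> \int[mu]_x (f x * \1_(`[0, +oo[%classic) x) = - F 0.
Proof.
move=> iF if_ cf dF.
have cF : continuous F by move=> x; exact: der_cont (dF x).
pose k n x := ((1 - x / n.+1%:R) * f x - n.+1%:R^-1 * F x) * \1_(`[0, n.+1%:R]%classic : set R) x.
have n0 n : 0 < n.+1%:R :> R by rewrite ltr0n.
have kc n : continuous (fun x => (1 - x / n.+1%:R) * f x - n.+1%:R^-1 * F x).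
  move=> x; apply: cvgB; apply: cvgM; [|exact: cf|exact: cvg_cst|exact: cF].
  by apply: cvgB; [exact: cvg_cst|apply: cvgM; [exact: cvg_id|exact: cvg_cst]].
have kE n : \int[mu]_x k n x = - F 0.
  have dG x : 0 <= x <= n.+1%:R -> is_derive x 1 (fun x => (1 - x / n.+1%:R) * F x)
      ((1 - x / n.+1%:R) * f x - n.+1%:R^-1 * F x).
    move=> _; have D := derM (derB (derC 1 x) (derM (derI x) (derC n.+1%:R^-1 x))) (dF x).
    by apply: (der_eq D); ring.
  have cI : {within `[0, n.+1%:R], continuous (fun x => (1 - x / n.+1%:R) * f x - n.+1%:R^-1 * F x)}.
    by apply: continuous_subspaceT => x; exact: kc.
  have := FTC_itv (ltW (n0 n)) cI dG.
  rewrite mul0r subr0 mul1r divff ?gt_eqF // subrr mul0r sub0r => <-.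
  by rewrite [RHS]int_restrict.

suff H : \int[mu]_x k n x @[n --> \oo] --> \int[mu]_x (f x * \1_(`[0, +oo[%classic) x).
  rewrite -(cvg_lim (@Rhausdorff R) H); apply/cvg_lim; first exact: Rhausdorff.
  by under eq_fun do rewrite kE; exact: cvg_cst.
apply: (int_cvg _ _ (igD (ig_norm if_) (ig_norm iF)) _).2.
- move=> n; apply: measurable_funM; first exact: cont_meas (kc n).
  by apply: meas_indic; exact: measurable_itv.
- have h0 : n.+1%:R^-1 @[n --> \oo] --> (0 : R) by exact: cvg_harmonic.
  move=> x; apply: cvgM.
    rewrite -[X in _ --> X]subr0; apply: cvgB.
      rewrite -[X in _ --> X]mul1r; apply: cvgM; last exact: cvg_cst.
      rewrite -[X in _ --> X]subr0; apply: cvgB; first exact: cvg_cst.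
      by rewrite -(mulr0 x); apply: cvgM; [exact: cvg_cst|exact: h0].
    by rewrite -(mul0r (F x)); apply: cvgM; [exact: h0|exact: cvg_cst].
  apply: cvg_near_cst; exists (Num.trunc `|x|).+1 => // n /= xn.
  rewrite !indicE !mem_setE !in_itv /= andbT; congr ((_ : bool)%:R).
  have [x0|//] := leP 0 x; rewrite (le_trans (ler_norm x)) //.
  by apply: ltW; apply: lt_le_trans (Num.Theory.truncnS_gt _) _; rewrite ler_nat ltnW.
- move=> n x; rewrite /k indicE mem_setE in_itv /=.
  have [/andP[x0 xn]|_] := boolP (0 <= x <= n.+1%:R); last first.
    by rewrite mulr0 normr0 addr_ge0.
  rewrite mulr1 (le_trans (ler_normB _ _)) // lerD //.
    rewrite normrM ler_piMl // ger0_norm ?subr_ge0 ?ler_pdivrMr ?mul1r //.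
    by rewrite gerBl divr_ge0.
  by rewrite normrM ler_piMl // ger0_norm ?invr_ge0 // invf_le1 // ler1n.
Qed.

Lemma int_derivative0 F f : ig mu F -> ig mu f -> continuous f ->
  (forall x, is_derive x 1 F (f x)) -> \int[mu]_x f x = 0.
Proof.
move=> iF if_ cf dF; have H := half_line iF if_ cf dF.
have cfo : continuous (fun x => - f (- x)).
  move=> x; apply: cvgN; apply: (@continuous_comp _ _ _ (fun x => - x) f); [exact: opp_continuous|exact: cf].
have dFo x : is_derive x 1 (fun x => F (- x)) (- f (- x)).
  by apply: (der_eq (@derComp _ F (fun x => - x) x _ _ (dF (- x)) (derN (derI x)))); rewrite mulrN1.
have H2 := half_line (ig_opp iF) (igN (ig_opp if_)) cfo dFo.
have m1 : measurable (`[0, +oo[%classic : set R) by exact: measurable_itv.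
have m2 : measurable (`]-oo, 0]%classic : set R) by exact: measurable_itv.
have m3 : measurable ([set 0] : set R) by exact: measurable_set1.
have H3 : \int[mu]_x (f x * \1_(`]-oo, 0]%classic) x) = F 0.
  have i2 : ig mu (fun x => f x * \1_(`]-oo, 0]%classic) x) by exact: ig_indic.
  rewrite -(int_opp i2) -[RHS]opprK -[X in - F X]oppr0 -H2 -intN.
    apply: eq_int => x; rewrite mulNr opprK; congr (_ * _).
    by rewrite !indicE !mem_setE !in_itv /= andbT oppr_le0.
  exact: ig_indic m1 (igN (ig_opp if_)).
have H4 : \int[mu]_x (f x * \1_([set 0]) x) = 0.
  by rewrite -int_restrict Rintegral_set1.
have E x : f x = f x * \1_(`[0, +oo[%classic) x + f x * \1_(`]-oo, 0]%classic) x - f x * \1_([set 0]) x.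
  rewrite -mulrDr -mulrBr -[LHS]mulr1; congr (_ * _).
  rewrite !indicE !mem_setE !in_itv /= andbT.
  have -> : (x \in [set 0]) = (x == 0) by apply/idP/eqP => [/set_mem|->]; rewrite ?inE.
  by have [x0|x0|x0] := ltgtP 0 x => /=; ring.
rewrite (eq_int mu E) intB; [|by apply: igD; exact: ig_indic|exact: ig_indic].
by rewrite intD; [rewrite H H3 H4; lra|exact: ig_indic..].
Qed.

Lemma gronwall0 (a b K : R) (E E' : R -> R) : a <= b ->
  {within `[a, b], continuous E} ->
  (forall t, a < t < b -> is_derive t 1 E (E' t)) ->
  (forall t, a < t < b -> E' t <= K * E t) ->
  (forall t, a <= t <= b -> 0 <= E t) -> E a = 0 ->
  forall t, a <= t <= b -> E t = 0.
Proof.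
move=> ab cE dE KE E0 Ea t /andP[at_ tb].
pose G t := E t * expR (- (K * t)).
have de x : is_derive x 1 (fun x => expR (- (K * x))) (expR (- (K * x)) * - K).
  apply: (@derComp _ expR (fun x => - (K * x))).
  by apply: (der_eq (derN (derZ K (derI x)))); rewrite mulr1.
have dG x : x \in `]a, b[ -> is_derive x 1 G (E x * (expR (- (K * x)) * - K) + E' x * expR (- (K * x))).
  by rewrite in_itv /= => xab; exact: derM (dE x xab) (de x).
have : G t <= G a.
  apply: (@ler0_derive1_nincr _ G a b) => //.
  - by move=> x /dG d.
  - move=> x xab; rewrite derive1E; have d := dG x xab; rewrite derive_val.
    rewrite (_ : _ + _ = expR (- (K * x)) * (E' x - K * E x)); last by ring.
    apply: mulr_ge0_le0; first exact: expR_ge0.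
    by rewrite subr_le0 KE //; move: xab; rewrite in_itv.
  - apply/subspace_continuousP => x Ax; apply: cvgM.
      by move/subspace_continuousP: cE; apply.
    by apply: cvg_within_filter; exact: der_cont (de x).
rewrite /G Ea mul0r => G0; apply/eqP; rewrite eq_le E0 ?at_ ?tb // andbT.
by move: G0; rewrite pmulr_lle0 // expR_gt0.
Qed.

Lemma sqr_int_derive (W : R -> R -> R) (t : R) g :
  (\forall h \near 0^', l2 (W (t + h))) -> l2 (W t) -> l2 g ->
  \int[mu]_x ((h^-1 * (W (t + h) x - W t x) - g x) ^+ 2) @[h --> 0^'] --> (0 : R) ->
  is_derive t 1 (fun t => \int[mu]_x (W t x ^+ 2)) (2 * \int[mu]_x (W t x * g x)).
Proof.
move=> lWh lW lg H; pose E t := \int[mu]_x (W t x ^+ 2).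
pose d h := \int[mu]_x ((h^-1 * (W (t + h) x - W t x) - g x) ^+ 2).
pose a := \int[mu]_x (W t x ^+ 2); pose b := \int[mu]_x (g x ^+ 2).
have a0 : 0 <= a by apply: int_ge0 => x; exact: sqr_ge0.
have b0 : 0 <= b by apply: int_ge0 => x; exact: sqr_ge0.
have d0 h : 0 <= d h by apply: int_ge0 => x; exact: sqr_ge0.
suff L : (h : R)^-1 *: (E (h *: 1 + t) - E t) @[h --> 0^'] --> 2 * \int[mu]_x (W t x * g x).
  apply: DeriveDef; first by apply/cvg_ex; eexists; exact: L.
  by apply/cvg_lim; [exact: Rhausdorff|exact: L].
have bd : \forall h \near 0^', `|h^-1 *: (E (h *: 1 + t) - E t) - 2 * \int[mu]_x (W t x * g x)| <=
    2 * Num.sqrt (d h * a) + `|h| * (2 * d h + 2 * b).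
  have hn0 : \forall h \near (0 : R)^', h != 0 by exact: nbhs_dnbhs_neq.
  near=> h; have h0 : h != 0 by near: h.
  have lh : l2 (W (t + h)) by near: h.
  pose q x := h^-1 * (W (t + h) x - W t x).
  have lq : l2 q by apply: l2Z; exact: l2B.
  have lqg : l2 (fun x => q x - g x) by exact: l2B.
  have -> : h *: 1 + t = t + h by rewrite scaler1 addrC.
  have -> : h^-1 *: (E (t + h) - E t) = 2 * \int[mu]_x (q x * W t x) + h * \int[mu]_x (q x ^+ 2).
    rewrite /E -intB; [|exact: lh.2|exact: lW.2].
    rewrite -[LHS]/(h^-1 * _) -!intZ; [|exact: lq.2|exact: l2_mul|exact: igB lh.2 lW.2].
    rewrite -intD; [|by apply: igZ; exact: l2_mul|exact: igZ lq.2].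
    by apply: eq_int => x; rewrite /q; field.
  rewrite addrAC -mulrBr -intB; [|exact: l2_mul|exact: l2_mul].
  have -> : \int[mu]_x (q x * W t x - W t x * g x) = \int[mu]_x ((q x - g x) * W t x).
    by apply: eq_int => x; ring.
  rewrite (le_trans (ler_normD _ _)) // lerD //.
    rewrite normrM ger0_norm // ler_wpM2l // -sqrtr_sqr ler_wsqrtr //.
    exact: cauchy_schwarz_int.
  rewrite normrM ler_wpM2l // ger0_norm; last by apply: int_ge0 => x; exact: sqr_ge0.
  rewrite /d /b -!intZ; [|exact: lg.2|exact: lqg.2].
  rewrite -intD; [|exact: igZ lqg.2|exact: igZ lg.2].
  apply: le_int; [exact: lq.2|by apply: igD; apply: igZ; [exact: lqg.2|exact: lg.2]|].
  by move=> x; rewrite -/(q x); have := sqr_ge0 (q x - 2 * g x); lra.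
have B : 2 * Num.sqrt (d h * a) + `|h| * (2 * d h + 2 * b) @[h --> 0^'] --> (0 : R).
  have hz : h @[h --> (0 : R)^'] --> (0 : R) by apply: cvg_within.
  have nh : `|h| @[h --> (0 : R)^'] --> (0 : R) by rewrite -[X in _ --> X](@normr0 _ R); exact: (cvg_norm hz).
  have s0 : Num.sqrt (d h * a) @[h --> 0^'] --> (0 : R).
    have da : d h * a @[h --> 0^'] --> (0 : R).
      by rewrite -[X in _ --> X](mul0r a); apply: cvgM; [exact: H|exact: cvg_cst].
    rewrite -[X in _ --> X](@sqrtr0 R); apply: continuous_cvg => //.
    exact: sqrt_continuous.
  have := cvgD (cvgM (cvg_cst (2 : R)) s0) (cvgM nh (cvgD (cvgM (cvg_cst (2 : R)) H) (cvg_cst (2 * b)))).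
  by rewrite mulr0 mul0r addr0; apply.
apply/cvgrPdist_lt => e e0.
have Be : \forall h \near 0^', `|2 * Num.sqrt (d h * a) + `|h| * (2 * d h + 2 * b)| < e.
  by apply: (cvgr0_norm_lt _ B).
near=> h; rewrite distrC; apply: le_lt_trans (_ : _ <= 2 * Num.sqrt (d h * a) + `|h| * (2 * d h + 2 * b)) _.
  by near: h.
by apply: le_lt_trans (ler_norm _) _; near: h.
Unshelve. all: by end_near.
Qed.

End energy_tools.

Section sobolev_curves.
Context {R : realType}.
Local Notation mu := (@lebesgue_measure R).
Implicit Types (f g : R -> R) (r s x t : R).

Local Opaque fourier.

Lemma sobolev_lin3 r c f1 f0 g : 2^-1 < r ->
  sobolev r f1 -> sobolev r f0 -> sobolev r g ->
  (sobolev_norm r (fun x => (c * (f1 x - f0 x) - g x)%R) < +oo)%E ->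
  sobolev r (fun x => c * (f1 x - f0 x) - g x) /\
  forall x, T (hart (fun x => c * (f1 x - f0 x) - g x)) x =
    c * (T (hart f1) x - T (hart f0) x) - T (hart g) x.
Proof.
move=> r1 s1 s0 sg fin.
have [i1 l1 _ _] := hart_sobolev s1 r1; have [i0 l0 _ _] := hart_sobolev s0 r1.
have [ig_ lg _ _] := hart_sobolev sg r1.
case: s1 => /L2P m1 F1 _; case: s0 => /L2P m0 F0 _; case: sg => /L2P mg Fg _.
set D := fun x => _ in fin *.
have lc : l2 (fun x => c * f1 x + - c * f0 x) by apply: l2D; exact: l2Z.
have DE : D = fun x => 1 * (c * f1 x + - c * f0 x) + -1 * g x.
  by apply/funext => x; rewrite /D; ring.
have lD : l2 D by rewrite DE; apply: l2D; exact: l2Z.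
have FD := is_fourier_lin 1 (-1) lc mg (is_fourier_lin c (- c) m1 m0 F1 F0) Fg.
rewrite -DE in FD.
have sD : sobolev r D by split => //; [exact/L2P|exact: fourier_ex FD].
split=> // x; have [iD _ _ _] := hart_sobolev sD r1.
have E : hartley (cplx_lin 1 (-1) (cplx_lin c (- c) (fourier f1) (fourier f0)) (fourier g)) =
    fun xi => c * (hart f1 xi - hart f0 xi) - hart g xi.
  apply/funext => xi; rewrite /hart /hartley /cplx_lin /=.
  case: (fourier f1 xi) => a1 b1; case: (fourier f0 xi) => a0 b0; case: (fourier g xi) => a b /=.
  ring.
have iE : ig mu (fun xi => c * (hart f1 xi - hart f0 xi)) by exact: (igZ c (igB i1 i0)).
have iC : ig mu (hartley (cplx_lin 1 (-1) (cplx_lin c (- c) (fourier f1) (fourier f0)) (fourier g))).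
  by rewrite E; exact: (igB iE ig_).
transitivity (T (fun xi => c * (hart f1 xi - hart f0 xi) - hart g xi) x).
  by rewrite -E; exact: (hartley_unique x lD (fourier_ex FD) FD iD iC).
by rewrite (TB x iE ig_) (TZ c x (igB i1 i0)) (TB x i1 i0).
Qed.

Lemma snorm_cvg (J : Type) (F : set_system J) (FF : Filter F) s (f_ : J -> R -> R) :
  sobolev_norm s (f_ i) @[i --> F] --> 0%E ->
  (\forall i \near F, (sobolev_norm s (f_ i) < +oo)%E) /\
  snorm s (f_ i) @[i --> F] --> (0 : R).
Proof.
move=> /fine_cvgP[fin c]; split; last exact: c.
by apply: filterS fin => i; rewrite fin_numE => /andP[_]; rewrite ltey.
Qed.

Lemma sobolev_sub_bounds s f g : 5 / 2 < s -> sobolev s f -> sobolev s g ->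
  continuous f -> continuous g -> (sobolev_norm s (fun x => (f x - g x)%R) < +oo)%E ->
  \int[mu]_x ((f x - g x) ^+ 2) <= 2 * pi * snorm s (fun x => f x - g x) ^+ 2 /\
  forall x, `|derive1 f x - derive1 g x| <= 2 * (japanese_cst (s - 1) * snorm s (fun x => f x - g x)).
Proof.
move=> s5 sf sg cf cg fin; have s1 : 2^-1 < s by lra.
have sD : sobolev s (fun x => f x - g x).
  case: (sf) (sg) => /L2P lf Ff _ [/L2P lg Fg _].
  have := is_fourier_lin 1 (-1) lf lg Ff Fg.
  have -> : (fun x => 1 * f x + -1 * g x) = (fun x => f x - g x).
    by apply/funext => x; ring.
  by move=> FD; split => //; [apply/L2P; exact: l2B|exact: fourier_ex FD].
set D := fun x => f x - g x in fin sD *.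
have cD : continuous D by move=> x; apply: cvgB; [exact: cf|exact: cg].
have gD := sobolev_good s5 sD.
have DE x : D x = T (hart D) x by rewrite (sobolev_inversion _ sD s1).
have [iD lD _ nD] := hart_sobolev sD s1.
split.
  rewrite (_ : (fun x => D x ^+ 2) = (fun x => T (hart D) x ^+ 2)); last first.
    by apply/funext => x; rewrite DE.
  apply: le_trans (bessel iD lD).2 _; apply: ler_wpM2l => //.
  by rewrite mulr_ge0 // pi_ge0.
move=> x; have df := rep_der1 (sobolev_good s5 sf) (fun x => esym (sobolev_inversion x sf s1 cf)) x.
have dg := rep_der1 (sobolev_good s5 sg) (fun x => esym (sobolev_inversion x sg s1 cg)) x.
have dD := rep_der1 gD DE x.
have -> : derive1 f x - derive1 g x = derive1 D x.
  by rewrite !derive1E (@derive_val _ _ _ _ _ _ _ df) (@derive_val _ _ _ _ _ _ _ dg)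
    (@derive_val _ _ _ _ _ _ _ (derB df dg)).
rewrite (rep_derive1 gD DE); case: gD => _ _ [i1 _] _ _.
apply: le_trans (T_bd _ i1) _; apply: ler_wpM2l => //.
have [||xi|_ _ n1 _] := @hart_mul _ s 1 (fun xi => xi) D sD => //.
- by lra.
- exact: le_japanese1.
Qed.

Section solution.
Variables (Tm s : R) (u : R -> R -> R).
Hypotheses (s5 : 5 / 2 < s) (uBO : BO_solution Tm u)
  (uC : C_sobolev `[0, Tm] s u) (uC1 : C1_sobolev `]0, Tm[ (s - 2) u).

Let inT t : 0 <= t <= Tm -> `[0, Tm]%classic t.
Proof. by rewrite /= in_itv. Qed.

Let s1 : 2^-1 < s. Proof. by move: s5; lra. Qed.

Lemma slice_cont t : 0 <= t <= Tm -> continuous (u ^~ t).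
Proof.
move=> tT x; have [d _ _ _ _] := uBO x tT.
by apply: differentiable_continuous; apply/derivable1_diffP.
Qed.

Lemma slice_good t : 0 <= t <= Tm -> good (hart (u ^~ t)).
Proof. by move=> tT; apply: (sobolev_good s5); exact: uC.1 (inT tT). Qed.

Lemma slice_T t : 0 <= t <= Tm -> forall x, u x t = T (hart (u ^~ t)) x.
Proof.
move=> tT x; rewrite (sobolev_inversion _ (uC.1 _ (inT tT)) s1) //.
exact: slice_cont.
Qed.

Lemma slice_l2 t : 0 <= t <= Tm -> l2 (u ^~ t).
Proof. by move=> tT; have [/L2P] := uC.1 _ (inT tT). Qed.

Let near_bounds t0 : 0 <= t0 <= Tm ->
  snorm s (fun x => u x t - u x t0) @[t --> within `[0, Tm]%classic (nbhs t0)] --> (0 : R) /\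
  \forall t \near within `[0, Tm]%classic (nbhs t0),
    \int[mu]_x ((u x t - u x t0) ^+ 2) <= 2 * pi * snorm s (fun x => u x t - u x t0) ^+ 2 /\
    forall x, `|derive1 (u ^~ t) x - derive1 (u ^~ t0) x| <=
      2 * (japanese_cst (s - 1) * snorm s (fun x => u x t - u x t0)).
Proof.
move=> tT; have [fin c] := snorm_cvg _ (uC.2 t0 (inT tT)); split=> //.
have inside : \forall t \near within `[0, Tm]%classic (nbhs t0), `[0, Tm]%classic t.
  exact: withinT.
apply: filterS2 fin inside => t ft; rewrite /= in_itv /= => tT'.
exact: (sobolev_sub_bounds s5 (uC.1 t (inT tT')) (uC.1 t0 (inT tT)) (slice_cont tT') (slice_cont tT) ft).
Qed.

Lemma slice_sqr_cvg t0 : 0 <= t0 <= Tm ->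
  \int[mu]_x ((u x t - u x t0) ^+ 2) @[t --> within `[0, Tm]%classic (nbhs t0)] --> (0 : R).
Proof.
move=> tT; have [c b] := near_bounds tT.
have c2 : snorm s (fun x => u x t - u x t0) * snorm s (fun x => u x t - u x t0)
    @[t --> within `[0, Tm]%classic (nbhs t0)] --> (0 : R).
  by rewrite -[X in _ --> X](mulr0 (0 : R)); exact: (cvgM c c).
have L : 2 * pi * (snorm s (fun x => u x t - u x t0) * snorm s (fun x => u x t - u x t0))
    @[t --> within `[0, Tm]%classic (nbhs t0)] --> (0 : R).
  by rewrite -[X in _ --> X](mulr0 (2 * pi : R)); apply: cvgM; [exact: cvg_cst|exact: c2].
apply: squeeze_cvgr (cvg_cst (0 : R)) L.
apply: filterS b => t [H _]; rewrite int_ge0 => [/=|x]; last exact: sqr_ge0.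
by rewrite -expr2.
Qed.

Lemma slice_der_bound : exists2 K, 0 <= K &
  forall t, 0 <= t <= Tm -> forall x, `|derive1 (u ^~ t) x| <= K.
Proof.
pose P K t := 0 <= t <= Tm -> forall x, `|derive1 (u ^~ t) x| <= K.
have near_cov : \forall K \near +oo, `[0, Tm]%classic `<=` P K.
  apply: ((compact_near_coveringP _).1 (@segment_compact R 0 Tm) R _ P) => t0.
  rewrite /= in_itv /= => tT; have [c b] := near_bounds tT.
  pose M := 2 * \int[mu]_xi `|xi * hart (u ^~ t0) xi| + 2 * (japanese_cst (s - 1) * 1).
  exists ([set t | P M t], [set K | M <= K]).
    split => /=; last exact: nbhs_pinfty_ge (num_real _).
    have c1 : \forall t \near within `[0, Tm]%classic (nbhs t0), snorm s (fun x => u x t - u x t0) < 1.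
      have : \forall t \near within `[0, Tm]%classic (nbhs t0), `|snorm s (fun x => u x t - u x t0)| < 1.
        by apply: (cvgr0_norm_lt _ c).
      by apply: filterS => t; rewrite ger0_norm // snorm_ge0.
    have H : \forall t \near within `[0, Tm]%classic (nbhs t0), forall x, `|derive1 (u ^~ t) x| <= M.
      apply: filterS2 b c1 => t [_ bt] nt x.
      rewrite -[derive1 (u ^~ t) x](subrK (derive1 (u ^~ t0) x)) addrC.
      rewrite (le_trans (ler_normD _ _)) // lerD //.
        rewrite (rep_derive1 (slice_good tT) (slice_T tT)).
        by apply: T_bd; case: (slice_good tT) => _ _ [].
      apply: le_trans (bt x) _; apply: ler_wpM2l => //; apply: ler_wpM2l; last exact: ltW.
      exact: sqrtr_ge0.
    by apply: filterS H => t H tT'; apply: H; exact: inT.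
  by move=> [t K] /= [Pt MK] tT' x; apply: le_trans (Pt tT' x) MK.
have [K [K0 HK]] : exists K, 0 <= K /\ `[0, Tm]%classic `<=` P K.
  apply: (@filter_ex _ (pinfty_nbhs R)).
  by apply: filterI => //; exact: nbhs_pinfty_ge (num_real _).
by exists K => // t tT; exact: HK (inT tT) tT.
Qed.

Lemma time_increments_interior t : 0 < t < Tm -> time_increments Tm t = 0^'.
Proof.
move=> /andP[t0 tT].
have H : \forall h \near (0 : R)^', 0 <= t + h <= Tm.
  apply: nbhs_dnbhs; exists (Num.min t (Tm - t)) => /=; first by rewrite lt_min t0 subr_gt0.
  by move=> h /=; rewrite sub0r normrN lt_min !ltr_norml => /andP[/andP[a b] /andP[c d]]; lra.
apply/funext => A; apply/propext; split => [HA|HA].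
  have HA' : \forall h \near (0 : R)^', 0 <= t + h <= Tm -> A h := HA.
  by apply: filterS2 HA' H => h + Hh; apply.
by apply: filterS HA.
Qed.

Lemma slice_time_deriv t : 0 < t < Tm ->
  l2 (fun x => time_deriv Tm u x t) /\
  \int[mu]_x ((h^-1 * (u x (t + h) - u x t) - time_deriv Tm u x t) ^+ 2) @[h --> 0^'] --> (0 : R).
Proof.
move=> tT; have r1 : 2^-1 < s - 2 by move: s5; lra.
have tTc : 0 <= t <= Tm by case/andP: tT => a b; rewrite !ltW.
have tin : `]0, Tm[%classic t by rewrite /= in_itv.
have [sv [v [[vs _] dv]]] := uC1.
have {}dv := dv t tin; have [fin c] := snorm_cvg _ dv.
set D := fun h : R => (fun x => h^-1 * (u x (t + h) - u x t) - v x t) in fin c *.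
have inside : \forall h \near (0 : R)^', 0 < t + h < Tm.
  case/andP: tT => t0 tT.
  apply: nbhs_dnbhs; exists (Num.min t (Tm - t)) => /=; first by rewrite lt_min t0 subr_gt0.
  by move=> h /=; rewrite sub0r normrN lt_min !ltr_norml => /andP[/andP[a b] /andP[e d]]; lra.
have key : \forall h \near (0 : R)^', sobolev (s - 2) (D h) /\
    forall x, T (hart (D h)) x = h^-1 * (u x (t + h) - u x t) - T (hart (v ^~ t)) x.
  apply: filterS2 fin inside => h fh hin.
  have hin' : `]0, Tm[%classic (t + h) by rewrite /= in_itv.
  have hc : 0 <= t + h <= Tm by case/andP: hin => a b; rewrite !ltW.
  have [sD TD] := sobolev_lin3 r1 (sv _ hin') (sv _ tin) (vs _ tin) fh.
  by split=> [|x]; [exact: sD|rewrite (slice_T hc x) (slice_T tTc x); exact: TD].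
have J0 : 0 <= japanese_cst (s - 2) by exact: sqrtr_ge0.
have utE x : time_deriv Tm u x t = T (hart (v ^~ t)) x.
  rewrite /time_deriv time_increments_interior //; apply: cvg_lim; first exact: Rhausdorff.
  apply/cvgrPdist_lt => e e0.
  have L : 2 * japanese_cst (s - 2) * snorm (s - 2) (D h) @[h --> 0^'] --> (0 : R).
    by rewrite -[X in _ --> X](mulr0 (2 * japanese_cst (s - 2))); apply: cvgM; [exact: cvg_cst|exact: c].
  have Le : \forall h \near (0 : R)^', `|2 * japanese_cst (s - 2) * snorm (s - 2) (D h)| < e.
    by apply: (cvgr0_norm_lt _ L).
  apply: filterS2 key Le => h [sD TD] le; rewrite distrC -TD.
  apply: le_lt_trans le; apply: le_trans (ler_norm _).
  have [iD _ n1 _] := hart_sobolev sD r1.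
  by rewrite -mulrA; apply: le_trans (T_bd x iD) _; apply: ler_wpM2l.
have [iv lv _ _] := hart_sobolev (vs _ tin) r1.
split; first by under eq_fun do rewrite utE; exact: (bessel iv lv).1.
have c2 : snorm (s - 2) (D h) * snorm (s - 2) (D h) @[h --> 0^'] --> (0 : R).
  by rewrite -[X in _ --> X](mulr0 (0 : R)); exact: (cvgM c c).
have L : 2 * pi * (snorm (s - 2) (D h) * snorm (s - 2) (D h)) @[h --> 0^'] --> (0 : R).
  by rewrite -[X in _ --> X](mulr0 (2 * pi : R)); apply: cvgM; [exact: cvg_cst|exact: c2].
apply: squeeze_cvgr (cvg_cst (0 : R)) L.
apply: filterS key => h [sD TD]; rewrite int_ge0 => [/=|x]; last exact: sqr_ge0.
have [iD lD _ n2] := hart_sobolev sD r1.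
rewrite (_ : (fun x => _) = (fun x => T (hart (D h)) x ^+ 2)); last first.
  by apply/funext => x; rewrite TD utE.
apply: le_trans (bessel iD lD).2 _; rewrite -expr2; apply: ler_wpM2l => //.
by rewrite mulr_ge0 // pi_ge0.
Qed.

Lemma slice_equation t x : 0 <= t <= Tm -> time_deriv Tm u x t =
  pi^-1 * (2 * dirichlet) * T (fun xi => xi * `|xi| * hart (u ^~ t) xi) (- x)
  - u x t * derive1 (u ^~ t) x.
Proof.
move=> tT; have [_ _ c _ E] := uBO x tT.
rewrite -(rep_hilbert (slice_good tT) (slice_T tT) c); lra.
Qed.

End solution.
End sobolev_curves.

Section moments.
Context {R : realType}.
Local Notation mu := (@lebesgue_measure R).
Variables (f : R -> R) (a : R).
Hypotheses (cf : continuous f) (lf : l2 f) (a0 : 0 < a)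
  (f_supp : forall z, `|z| < a -> f z = 0).
Implicit Types (x y z : R).

Local Notation out b := [set z : R | b < `|z|].

Let M z := `|f z * (z^-1 * \1_(out (a / 2)) z)|.

Let a2 : 0 < a / 2. Proof. exact: divr_gt0. Qed.

Let a2a : a / 2 < a. Proof. by rewrite ltr_pdivrMr // ltr_pMr // ltr1n. Qed.

Let ig_M : ig mu M.
Proof. by apply: ig_norm; apply: l2_mul => //; exact: l2_inv_out. Qed.

Let ME z : M z = `|f z| * `|z|^-1.
Proof.
rewrite /M normrM normrM normfV; have [za|za] := ltP `|z| a.
  by rewrite f_supp // normr0 !mul0r.
congr (_ * _); rewrite indicE mem_set ?normr1 ?mulr1 //=; exact: lt_le_trans a2a za.
Qed.

Definition cauchy_kernel n x z := f z * (z^-1) ^+ n * (x - z)^-1.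

Let f_meas : measurable_fun setT f. Proof. exact: lf.1. Qed.

Let ker_meas n x : measurable_fun setT (cauchy_kernel n x).
Proof.
apply: measurable_funM.
  by apply: measurable_funM => //; apply: measurable_funX; exact: inv_meas.
apply: (measurableT_comp inv_meas); apply: cont_meas => z.
by apply: cvgB; [exact: cvg_cst|exact: cvg_id].
Qed.

Let inv_bd n z : a <= `|z| -> `|(z^-1) ^+ n| <= a^-1 ^+ n.
Proof.
move=> za; rewrite normrX normfV lerXn2r ?nnegrE ?invr_ge0 // ?(ltW a0) //.
by rewrite lef_pV2 // posrE // (lt_le_trans a0).
Qed.

Let ker_bd n x z : `|x| < a / 2 -> `|cauchy_kernel n x z| <= 2 * a^-1 ^+ n * M z.
Proof.
move=> xa; rewrite ME /cauchy_kernel; have [za|za] := ltP `|z| a.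
  by rewrite f_supp // !mul0r normr0 mul0r mulr0.
have z0 : 0 < `|z| by exact: lt_le_trans za.
have xz : `|z| / 2 <= `|x - z|.
  rewrite distrC; apply: le_trans (lerB_dist z x).
  by move: xa za; rewrite ltr_pdivlMr // ler_pdivrMr // mulrBl; lra.
rewrite normrM normrM normfV.
rewrite (_ : 2 * _ * _ = `|f z| * a^-1 ^+ n * (2 * `|z|^-1)); last by ring.
apply: ler_pM; rewrite ?mulr_ge0 ?invr_ge0 //.
  by apply: ler_wpM2l => //; exact: inv_bd.
have -> : 2 * `|z|^-1 = (`|z| / 2)^-1 by rewrite invfM invrK mulrC.
by rewrite lef_pV2 ?posrE ?divr_gt0 // (lt_le_trans _ xz) ?divr_gt0.
Qed.

Let ig_ker n x : `|x| < a / 2 -> ig mu (cauchy_kernel n x).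
Proof.
move=> xa; apply: (@ig_le _ _ _ mu _ _ (ker_meas n x) (igZ (2 * a^-1 ^+ n) ig_M)) => z.
exact: ker_bd.
Qed.

Lemma hilbert_trunc_far x e : `|x| < a / 2 -> 0 < e < a / 2 ->
  hilbert_trunc f x e = \int[mu]_z (cauchy_kernel 0 x z).
Proof.
move=> xa /andP[e0 ea]; rewrite -(int_refl x (ig_ker 0 xa)) /hilbert_trunc int_restrict.
apply: eq_int => y; rewrite /cauchy_kernel expr0 mulr1 subKr.
have [ya|ya] := ltP e `|y|; first by rewrite indicE mem_set ?mulr1.
rewrite f_supp ?mul0r //; apply: le_lt_trans (ler_normB _ _) _.
have -> : a = a / 2 + a / 2 by field.
by apply: ltrD => //; exact: le_lt_trans ea.
Qed.

Definition moment n := \int[mu]_z (f z * (z^-1) ^+ n.+1).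

Let mom_meas n : measurable_fun setT (fun z => f z * (z^-1) ^+ n.+1).
Proof. by apply: measurable_funM => //; apply: measurable_funX; exact: inv_meas. Qed.

Lemma ig_moment n : ig mu (fun z => f z * (z^-1) ^+ n.+1).
Proof.
apply: (@ig_le _ _ _ mu _ _ (mom_meas n) (igZ (a^-1 ^+ n) ig_M)) => z.
rewrite ME; have [za|za] := ltP `|z| a; first by rewrite f_supp // !mul0r normr0 mul0r mulr0.
rewrite exprSr !normrM mulrA normfV [leRHS]mulrA; apply: ler_wpM2r; first by rewrite invr_ge0.
by rewrite mulrC; apply: ler_wpM2r => //; exact: inv_bd.
Qed.

Let ker_rec n x : `|x| < a / 2 -> \int[mu]_z cauchy_kernel n x z =
  - moment n + x * \int[mu]_z cauchy_kernel n.+1 x z.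
Proof.
move=> xa; rewrite -intN; last exact: ig_moment.
rewrite -intZ; last exact: ig_ker.
rewrite -intD; [|exact: igN (ig_moment n)|exact/igZ/ig_ker].
apply: eq_int => z; rewrite /cauchy_kernel; have [za|za] := ltP `|z| a.
  by rewrite f_supp // !mul0r mulr0 oppr0 addr0.
have z0 : z != 0 by rewrite -normr_gt0 (lt_le_trans a0).
have xz : x - z != 0.
  rewrite subr_eq0; apply/eqP => E; move: xa; rewrite E ltNge (le_trans _ za) //.
  exact: ltW.
by rewrite exprS; field; rewrite z0 xz.
Qed.

Lemma moment0 (g : R -> R) : continuous g ->
  (forall x, `|x| < a / 2 -> g x = \int[mu]_z cauchy_kernel 0 x z) ->
  (forall N : nat, (0 < N)%N -> exists c : R, \forall r \near 0^'+,
     (\int[mu]_(x in [set x | (`|x| <= r)%R]) ((g x) ^+ 2)%:E <= (c * r ^+ N)%:E)%E) ->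
  forall n, moment n = 0.
Proof.
move=> cg gE van.
have key n : (forall x, `|x| < a / 2 -> g x = x ^+ n * \int[mu]_z cauchy_kernel n x z) ->
    moment n = 0.
  move=> gn; apply: contrapT => /eqP m0; set m := moment n in m0.
  have [c Hc] := van (2 * n + 2)%N (ltac:(by rewrite addn2)).
  pose B := \int[mu]_z (2 * a^-1 ^+ n.+1 * M z).
  have FB x : `|x| < a / 2 -> `|\int[mu]_z cauchy_kernel n.+1 x z| <= B.
    move=> xa; apply: le_norm_int_le; [exact: ig_ker|exact: igZ|].
    by move=> z; exact: ker_bd.
  have B0 : 0 <= B.
    by apply: le_trans (FB 0 _) => //; rewrite normr0.
  have mp : 0 < `|m| by rewrite normr_gt0.
  pose d : R := `|m| / (2 * (B + 1)).
  have d0 : 0 < d by rewrite divr_gt0 // mulr_gt0 // ltr_wpDl.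
  pose L : R := (`|m| / 2) ^+ 2 * 2^-1 ^+ (2 * n + 1).
  have L0 : 0 < L by rewrite mulr_gt0 // exprn_gt0 // ?divr_gt0 // invr_gt0.
  have low (r : R) : 0 < r -> r < a / 2 -> r < d ->
      ((L * r ^+ (2 * n + 1))%:E <= \int[mu]_(x in [set x | (`|x| <= r)%R]) ((g x) ^+ 2)%:E)%E.
    move=> r0 ra rd.
    pose J : set R := `[r / 2, r]%classic.
    have mr : measurable J by exact: measurable_itv.
    have mb : measurable ([set x | `|x| <= r] : set R).
      rewrite (_ : [set _ | _] = `[- r, r]%classic); first exact: measurable_itv.
      by apply/seteqP; split => x /=; rewrite in_itv /= ler_norml.
    have mg : measurable_fun setT (fun x => (g x ^+ 2)%:E).
      by apply/measurable_EFinP; apply: measurable_funX; exact: cont_meas.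
    pose C : R := (`|m| / 2) ^+ 2 * (r / 2) ^+ (2 * n).
    have H1 : ((L * r ^+ (2 * n + 1))%:E <= \int[mu]_(x in J) C%:E)%E.
      have muJ : mu J = (r / 2)%:E.
        rewrite lebesgue_measure_itv /= lte_fin (_ : r / 2 < r); last first.
          by rewrite ltr_pdivrMr // ltr_pMr // ltr1n.
        by rewrite -EFinD; congr EFin; field.
      have -> : (\int[mu]_(x in J) C%:E = C%:E * mu J)%E by exact: integral_cst.
      rewrite muJ -EFinM lee_fin /C /L le_eqVlt; apply/orP; left; apply/eqP.
      by rewrite -mulrA -exprMn -[RHS]mulrA -exprSr addn1 (mulrC r).
    have H2 : (\int[mu]_(x in J) C%:E <=
        \int[mu]_(x in J) ((g x) ^+ 2)%:E)%E.
      apply: ge0_le_integral => //.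
      - by move=> x _; rewrite lee_fin /C mulr_ge0 // ?sqr_ge0 // exprn_ge0 // divr_ge0 // ltW.
      - exact: measurable_funTS.
      move=> x; rewrite /J /= in_itv /= => /andP[x1 x2]; rewrite lee_fin.
      have x0 : 0 < x by apply: lt_le_trans x1; rewrite divr_gt0.
      have xa : `|x| < a / 2 by rewrite gtr0_norm // (le_lt_trans x2).
      rewrite gn // exprMn /C mulrC; apply: ler_pM.
      + by rewrite exprn_ge0 // divr_ge0 // ltW.
      + exact: sqr_ge0.
      + by rewrite -exprM mulnC lerXn2r ?nnegrE ?divr_ge0 // ltW.
      have F : `|m| / 2 <= `|\int[mu]_z cauchy_kernel n x z|.
        rewrite ker_rec // -/m addrC distrC.
        apply: le_trans (lerB_dist _ _).
        have : `|x * \int[mu]_z cauchy_kernel n.+1 x z| <= `|m| / 2.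
          rewrite normrM (gtr0_norm x0); apply: le_trans (_ : d * (B + 1) <= _).
            apply: ler_pM => //; [exact: ltW|exact: le_trans x2 (ltW rd)|].
            by apply: le_trans (FB x xa) _; rewrite lerDl.
          rewrite /d invfM mulrA divfK //; apply: lt0r_neq0; exact: ltr_wpDl.
        lra.
      by rewrite -[leRHS]real_normK ?num_real // lerXn2r ?nnegrE.
    apply: le_trans H1 (le_trans H2 _); apply: ge0_subset_integral => //.
    - exact: measurable_funTS.
    - by move=> x _; rewrite lee_fin sqr_ge0.
    move=> x; rewrite /J /= in_itv /= => /andP[x1 x2]; rewrite ger0_norm //.
    by apply: le_trans x1; rewrite divr_ge0 // ltW.
  have small : \forall r \near (0 : R)^'+, L <= c * r.
    have r1 : \forall r \near (0 : R)^'+, r < a / 2 by exact: nbhs_right_lt.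
    have r2 : \forall r \near (0 : R)^'+, r < d by exact: nbhs_right_lt.
    have r3 : \forall r \near (0 : R)^'+, 0 < r by exact: nbhs_right_gt.
    near=> r; have r0 : 0 < r by near: r.
    have : ((L * r ^+ (2 * n + 1))%:E <= (c * r ^+ (2 * n + 2))%:E)%E.
      by apply: le_trans (low r r0 _ _) _; near: r.
    rewrite lee_fin (_ : (2 * n + 2 = (2 * n + 1).+1)%N); last by rewrite addn2 addn1.
    by rewrite exprS mulrA ler_pM2r // exprn_gt0.
  have : L <= 0.
    have cz : c * r @[r --> (0 : R)^'+] --> (0 : R).
      rewrite -[X in _ --> X](mulr0 c); apply: cvgM; first exact: cvg_cst.
      exact: cvg_at_right_filter cvg_id.
    rewrite -(cvg_lim (@Rhausdorff R) cz).
    by apply: limr_ge => //; apply/cvg_ex; eexists; exact: cz.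
  by rewrite leNgt L0.
have pow n x : `|x| < a / 2 -> g x = x ^+ n * \int[mu]_z cauchy_kernel n x z.
  elim: n x => [|n IH] x xa; first by rewrite expr0 mul1r gE.
  rewrite IH // ker_rec // (key n IH) oppr0 add0r exprSr.
  by rewrite mulrA.
by move=> n; apply: key => x; exact: pow.
Unshelve. all: by end_near.
Qed.

(* The moments are the integrals of [f z / z] against the monomials in [1 / z], hence against the
   powers of a quadratic polynomial in [1 / z] which peaks at [1 / z0]. *)
Lemma moments_eq0 : (forall n, moment n = 0) -> forall z, f z = 0.
Proof.
move=> m0 z0; apply: contrapT => /eqP fz0.
have z0a : a <= `|z0| by rewrite leNgt; apply/negP => /f_supp E; rewrite E eqxx in fz0.
have z0p : 0 < `|z0| by exact: lt_le_trans z0a.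
have z0n : z0 != 0 by rewrite -normr_gt0.
pose y0 := z0^-1; pose C := a ^+ 2 / 8.
have C0 : 0 < C by rewrite divr_gt0 // exprn_gt0.
pose q y := 1 - C * (y - y0) ^+ 2.
pose psi z := f z * z^-1.
have ipsi : ig mu psi.
  by apply: ig_eq (ig_moment 0) => z; rewrite expr1.
have Q k : forall n, ig mu (fun z => psi z * (z^-1) ^+ n * q (z^-1) ^+ k) /\
    \int[mu]_z (psi z * (z^-1) ^+ n * q (z^-1) ^+ k) = 0.
  elim: k => [|k IH] n.
    have E : (fun z => psi z * (z^-1) ^+ n * q (z^-1) ^+ 0) = (fun z => f z * (z^-1) ^+ n.+1).
      by apply/funext => z; rewrite expr0 mulr1 /psi exprS mulrA.
    by rewrite E; split; [exact: ig_moment|exact: m0].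
  have [i0 I0] := IH n; have [i1 I1] := IH n.+1; have [i2 I2] := IH n.+2.
  have E : (fun z => psi z * (z^-1) ^+ n * q (z^-1) ^+ k.+1) =
      (fun z => (1 - C * y0 ^+ 2) * (psi z * (z^-1) ^+ n * q (z^-1) ^+ k) +
       (2 * C * y0) * (psi z * (z^-1) ^+ n.+1 * q (z^-1) ^+ k) +
       (- C) * (psi z * (z^-1) ^+ n.+2 * q (z^-1) ^+ k)).
    apply/funext => z; rewrite !exprS; set t := q (z^-1) ^+ k.
    by rewrite /q; ring.
  rewrite E; split; first by apply: igD; [apply: igD; exact: igZ|exact: igZ].
  rewrite intD; [|by apply: igD; exact: igZ|exact: igZ].
  by rewrite intD; [rewrite !intZ // I0 I1 I2; ring|exact: igZ..].
pose c := Num.sg (psi z0).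
have psi0 : 0 < c * psi z0.
  by rewrite /c -normrEsg normr_gt0 mulf_neq0 // invr_neq0.
pose eta := c * psi z0 / 2.
have eta0 : 0 < eta by rewrite divr_gt0.
have cpsi : {for z0, continuous (fun z => c * psi z)}.
  by apply: cvgM; [exact: cvg_cst|apply: cvgM; [exact: cf|exact: cvgV]].
have [d /= d0 Hd] : \forall z \near z0, eta < c * psi z.
  by apply: (cvgr_gt _ cpsi); rewrite /eta ltr_pdivrMr // ltr_pMr // ltr1n.
pose rho := d / ((d + `|z0|) * `|z0|).
have rho0 : 0 < rho by rewrite divr_gt0 // mulr_gt0 // addr_gt0.
have far z : a <= `|z| -> d <= `|z - z0| -> rho <= `|z^-1 - y0|.
  move=> za zd; have zp : 0 < `|z| by exact: lt_le_trans za.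
  have zn : z != 0 by rewrite -normr_gt0.
  have -> : z^-1 - y0 = (z0 - z) * (z^-1 * z0^-1) by rewrite /y0; field; rewrite zn z0n.
  rewrite !normrM !normfV distrC /rho invfM mulrA [leLHS]mulrA ler_pM2r ?invr_gt0 //.
  rewrite ler_pdivrMr; last exact: addr_gt0.
  rewrite mulrAC ler_pdivlMr //.
  have : `|z| <= `|z - z0| + `|z0| by rewrite -{1}[z](subrK z0) ler_normD.
  have := normr_ge0 z0; nra.
have near_bd z : a <= `|z| -> (z^-1 - y0) ^+ 2 <= 4 * a^-1 ^+ 2.
  move=> za; have b1 := inv_bd 1 za; have b2 := inv_bd 1 z0a; rewrite !expr1 in b1 b2.
  rewrite -real_normK ?num_real // (_ : 4 * a^-1 ^+ 2 = (2 * a^-1) ^+ 2); last by ring.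
  rewrite lerXn2r ?nnegrE ?mulr_ge0 ?invr_ge0 ?(ltW a0) //.
  by rewrite (le_trans (ler_normB _ _)) //; rewrite /y0; lra.
have q_ge z : a <= `|z| -> 2^-1 <= q z^-1.
  move=> za; rewrite /q; have := ler_wpM2l (ltW C0) (near_bd z za).
  have -> : C * (4 * a^-1 ^+ 2) = 2^-1 by rewrite /C; field; exact: lt0r_neq0.
  lra.
have q_le1 z : q z^-1 <= 1 by rewrite /q gerBl mulr_ge0 ?sqr_ge0 // ltW.
pose th1 := Num.max 2^-1 (1 - C * rho ^+ 2).
have th1_lt1 : th1 < 1.
  by rewrite gt_max invf_lt1 // ltr1n /= gtrBl mulr_gt0 // exprn_gt0.
have th1_gt0 : 0 < th1 by rewrite lt_max invr_gt0 ltr0n.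
have q_far z : a <= `|z| -> d <= `|z - z0| -> q z^-1 <= th1.
  move=> za zd; rewrite le_max; apply/orP; right; rewrite /q lerB // ler_pM2l //.
  rewrite -[leRHS]real_normK ?num_real // lerXn2r ?nnegrE ?(ltW rho0) //.
  exact: far.
pose th2 := (1 + th1) / 2.
have th12 : th1 < th2 by rewrite /th2; lra.
have th2_gt0 : 0 < th2 by exact: lt_trans th12.
have cq : {for z0, continuous (fun z => q z^-1)}.
  apply: cvgB; first exact: cvg_cst.
  apply: cvgM; first exact: cvg_cst.
  by apply: cvgM; (apply: cvgB; [exact: cvgV|exact: cvg_cst]).
have [d' /= d'0 Hd'] : \forall z \near z0, th2 < q z^-1.
  apply: (cvgr_gt _ cq); rewrite /q /y0 subrr expr0n /= mulr0 subr0 /th2; lra.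
pose e := Num.min d d' / 2.
have m0' : 0 < Num.min d d' by rewrite lt_min d0.
have e0 : 0 < e by exact: divr_gt0.
have em : e < Num.min d d' by rewrite /e ltr_pdivrMr // ltr_pMr // ltr1n.
have [ed ed'] : e < d /\ e < d' by move: em; rewrite lt_min => /andP.
pose S : set R := `[z0 - e, z0 + e]%classic.
have mS : measurable S by exact: measurable_itv.
pose V := \int[mu]_z (1 * \1_S z); pose B := \int[mu]_z `|psi z|.
have iV : ig mu (fun z : R => 1 * \1_S z).
  by apply: ig_itv; apply: continuous_subspaceT => ?; exact: cvg_cst.
have V0 : 0 < V.
  have muS : mu S = (z0 + e - (z0 - e))%:E.
    by rewrite lebesgue_measure_itv /= lte_fin (_ : z0 - e < z0 + e) //; lra.
  rewrite /V -(int_restrict S (fun=> 1)) /Rintegral.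
  have -> : (\int[mu]_(x in S) 1%:E = 1%:E * mu S)%E by exact: integral_cst.
  by rewrite mul1e muS /=; lra.
have low k : eta * th2 ^+ k * V <= th1 ^+ k * B.
  have [i0 I0] := Q k 0%N.
  rewrite -subr_le0 -[leRHS](mulr0 c) -I0 /V /B -!intZ //; last exact: ig_norm.
  rewrite -intB; [|exact: igZ|exact/igZ/ig_norm].
  apply: le_int; [by apply: igB; [exact: igZ|exact/igZ/ig_norm]|exact: igZ|] => z.
  rewrite expr0 mulr1 mul1r mulrA.
  have th1k : 0 <= th1 ^+ k by rewrite exprn_ge0 // ltW.
  have th2k : 0 <= th2 ^+ k by rewrite exprn_ge0 // ltW.
  have [za|za] := ltP `|z| a.
    have -> : psi z = 0 by rewrite /psi f_supp // mul0r.
    have -> : \1_S z = 0 :> R.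
      rewrite indicE memNset // /S /= in_itv /= => /andP[s1 s2].
      have : eta < c * psi z.
        by apply: Hd => /=; rewrite ltr_norml; lra.
      by rewrite /psi f_supp // mul0r mulr0 ltNge ltW.
    by rewrite normr0 !mulr0 mul0r subr0.
  have qk : 0 <= q z^-1 ^+ k by rewrite exprn_ge0 // (le_trans _ (q_ge z za)) // invr_ge0.
  have [zd|zd] := ltP `|z - z0| d; last first.
    have -> : \1_S z = 0 :> R.
      rewrite indicE memNset // /S /= in_itv /= => /andP[s1 s2].
      move: zd; rewrite leNgt => /negP; apply.
      by rewrite ltr_norml; lra.
    rewrite mulr0 sub0r -mulNr.
    have : `|c * psi z * q z^-1 ^+ k| <= th1 ^+ k * `|psi z|.
      rewrite normrM mulrC; apply: ler_pM => //.
        rewrite ger0_norm // lerXn2r ?nnegrE ?(ltW th1_gt0) //; last exact: q_far.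
        by rewrite (le_trans _ (q_ge z za)) // invr_ge0.
      rewrite normrM ler_piMl // /c normr_sg; by case: (_ != 0).
    by rewrite mulNr ler_norml => /andP[].
  have pz : eta < c * psi z by apply: Hd => /=; rewrite distrC.
  have [zS|zS] := boolP (z \in S); last first.
    rewrite indicE (negbTE zS) mulr0 sub0r.
    apply: (@le_trans _ _ 0); first by rewrite oppr_le0 mulr_ge0.
    by rewrite mulr_ge0 // ltW // (lt_trans eta0).
  rewrite indicE zS mulr1; apply: (@le_trans _ _ (eta * th2 ^+ k)).
    by rewrite gerBl mulr_ge0.
  apply: ler_pM => //; [exact: ltW|exact: ltW|].
  rewrite lerXn2r ?nnegrE ?(ltW th2_gt0) //; first by rewrite (le_trans _ (q_ge z za)) // invr_ge0.
  apply: ltW; apply: Hd' => /=; move: zS => /set_mem; rewrite /S /= in_itv /= => /andP[s1 s2].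
  by rewrite ltr_norml; lra.
have lim0 : (th1 / th2) ^+ k * B @[k --> \oo] --> (0 : R).
  rewrite -[X in _ --> X](mul0r B); apply: cvgM; last exact: cvg_cst.
  apply: cvg_expr; rewrite ger0_norm; last by rewrite divr_ge0 // ltW.
  by rewrite ltr_pdivrMr // mul1r.
have : eta * V <= 0.
  rewrite -(cvg_lim (@Rhausdorff R) lim0); apply: limr_ge.
    by apply/cvg_ex; eexists; exact: lim0.
  apply: nearW => k; rewrite expr_div_n [leRHS]mulrAC ler_pdivlMr ?exprn_gt0 //.
  by rewrite [leLHS]mulrAC; exact: low.
by rewrite leNgt mulr_gt0.
Qed.

End moments.

Section estimates.
Context {R : realType}.
Local Notation mu := (@lebesgue_measure R).
Implicit Types (f g h : R -> R) (x a K : R).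

Lemma good_derive2 h f : good h -> (forall x, f x = T h x) ->
  continuous (derive1n 2 f) /\ l2 (derive1n 2 f).
Proof.
move=> gh fE; rewrite (rep_derive2 gh fE); case: gh => _ _ _ i2 l2'.
have lN : l2 (fun xi => - (xi * (xi * h xi))).
  rewrite (_ : (fun _ => _) = (fun xi => -1 * (xi * (xi * h xi)))); first exact: l2Z.
  by apply/funext => xi; rewrite mulN1r.
split; first exact: T_cont (igN i2).
exact: (bessel (igN i2) lN).1.
Qed.

Lemma good_derive2B h1 h2 f1 f2 x : good h1 -> good h2 ->
  (forall x, f1 x = T h1 x) -> (forall x, f2 x = T h2 x) ->
  derive1n 2 (fun x => f1 x - f2 x) x = derive1n 2 f1 x - derive1n 2 f2 x.
Proof.
move=> g1 g2 E1 E2; have g12 := goodB g1 g2.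
have E12 y : f1 y - f2 y = T (fun xi => h1 xi - h2 xi) y.
  by rewrite E1 E2 TB //; [case: g1|case: g2].
rewrite (rep_derive2 g12 E12) (rep_derive2 g1 E1) (rep_derive2 g2 E2).
case: g1 => _ _ _ i1 _; case: g2 => _ _ _ i2 _.
rewrite -TB; [|exact: igN|exact: igN].
by congr T; apply/funext => xi; ring.
Qed.

Lemma good_eq0 h f a : good h -> (forall x, f x = T h x) -> 0 < a ->
  (forall x, `|x| < a -> f x = 0) -> (forall x, derive1n 2 f x = 0) ->
  forall x, f x = 0.
Proof.
move=> gh fE a0 f0 f2 x.
have d2 (y : R) : is_derive y 1 (fun x => T (fun xi => xi * h xi) (- x)) 0.
  apply: (der_eq (rep_der2 gh y)); rewrite -(f2 y) /derive1n /= (rep_derive1 gh fE) derive1E.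
  by have d := rep_der2 gh y; rewrite derive_val.
pose c := T (fun xi => xi * h xi) (- 0).
have d1 (y : R) : is_derive y 1 f c.
  by apply: (der_eq (rep_der1 gh fE y)); exact: is_derive_0_is_cst d2.
have d0 (y : R) : is_derive y 1 (fun y => f y - c * y) 0.
  by apply: (der_eq (derB (d1 y) (derZ c (derI y)))); rewrite mulr1 subrr.
have E (y : R) : f y - c * y = 0.
  by rewrite (is_derive_0_is_cst y 0 d0) f0 ?normr0 // mulr0 subr0.
have : c * (a / 2) = 0.
  have := E (a / 2); rewrite f0; first by rewrite sub0r => /eqP; rewrite oppr_eq0 => /eqP.
  by rewrite gtr0_norm ?divr_gt0 // ltr_pdivrMr // ltr_pMr // ltr1n.
move=> /eqP; rewrite mulf_eq0 => /orP[/eqP c0|]; last by rewrite gt_eqF // divr_gt0.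
by have := E x; rewrite c0 mul0r subr0.
Qed.

Lemma vanish_derive f a : (forall x, `|x| < a -> f x = 0) ->
  forall x, `|x| < a -> derive1 f x = 0.
Proof.
move=> f0 x xa; rewrite derive1E (@near_eq_derive _ _ _ f (fun=> 0)) ?derive_cst //.
exists (a - `|x|) => /=; first by rewrite subr_gt0.
move=> y /= xy; apply: f0; rewrite -[y](subKr x).
by rewrite (le_lt_trans (ler_normB _ _)) // -ltrBrDl.
Qed.

Lemma hilbert_truncB f1 f2 x (e : R) : 0 < e ->
  continuous f1 -> l2 f1 -> continuous f2 -> l2 f2 ->
  hilbert_trunc (fun y => f1 y - f2 y) x e = hilbert_trunc f1 x e - hilbert_trunc f2 x e.
Proof.
move=> e0 c1 l1 c2 l2'.
have E f : hilbert_trunc f x e = \int[mu]_y (f (x - y) / y * \1_[set y : R | e < `|y|] y).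
  by rewrite /hilbert_trunc int_restrict.
rewrite !E.
have i f : continuous f -> l2 f -> ig mu (fun y => f (x - y) / y * \1_[set y : R | e < `|y|] y).
  move=> cf lf; have lfx : l2 (fun y => f (x - y)).
    split; last exact: ig_refl lf.2.
    apply: cont_meas => z; apply: (@continuous_comp _ _ _ (fun z => x - z) f); last exact: cf.
    by apply: cvgB; [exact: cvg_cst|exact: cvg_id].
  by apply: ig_eq (l2_mul lfx (l2_inv_out e0)) => y; rewrite mulrA.
rewrite -intB; [|exact: i|exact: i].
by apply: eq_int => y; rewrite !mulrBl.
Qed.

Lemma energy_estimate h1 h2 f1 f2 (C K : R) : good h1 -> good h2 ->
  (forall x, f1 x = T h1 x) -> (forall x, f2 x = T h2 x) ->
  (forall x, `|derive1 f1 x| <= K) -> (forall x, `|derive1 f2 x| <= K) ->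
  2 * \int[mu]_x ((f1 x - f2 x) *
    ((C * T (fun xi => xi * `|xi| * h1 xi) (- x) - f1 x * derive1 f1 x) -
     (C * T (fun xi => xi * `|xi| * h2 xi) (- x) - f2 x * derive1 f2 x))) <=
  3 * K * \int[mu]_x ((f1 x - f2 x) ^+ 2).
Proof.
move=> g1 g2 E1 E2 K1 K2; pose h xi := h1 xi - h2 xi; pose w x := f1 x - f2 x.
have gh : good h by exact: goodB.
have [ih1 lh1 [xh1 _] _ _] := g1; have [ih2 lh2 [xh2 _] _ _] := g2.
have [ih lh [xh lxh] _ _] := gh; have [sh lsh] := good_sgn gh.
have wE x : w x = T h x by rewrite /w E1 E2 TB.
have d1 x := rep_der1 g1 E1 x; have d2 x := rep_der1 g2 E2 x; have dw x := rep_der1 gh wE x.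
pose H x := T (fun xi => xi * `|xi| * h xi) (- x).
pose w' x := derive1 w x; pose f1' x := derive1 f1 x; pose f2' x := derive1 f2 x.
have w'E x : w' x = f1' x - f2' x.
  rewrite /w' /f1' /f2' !derive1E; have e1 := d1 x; have e2 := d2 x.
  by have e := derB e1 e2; rewrite !derive_val.
have cT k : ig mu k -> continuous (fun x => T k (- x)).
  move=> ik x; apply: (@continuous_comp _ _ _ (fun x => - x) (T k)); first exact: opp_continuous.
  exact: T_cont.
have cf1' : continuous f1' by rewrite /f1' (rep_derive1 g1 E1); exact: cT.
have cf2' : continuous f2' by rewrite /f2' (rep_derive1 g2 E2); exact: cT.
have cw' : continuous w' by rewrite /w' (rep_derive1 gh wE); exact: cT.
have lw : l2 w by rewrite (_ : w = T h); [exact: (bessel ih lh).1|exact/funext].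
have lw' : l2 w' by rewrite /w' (rep_derive1 gh wE); exact: T_opp_l2.
have lH : l2 H by exact: T_opp_l2.
have [B Bf1] : exists B, forall x, `|f1 x| <= B.
  by exists (2 * \int[mu]_xi `|h1 xi|) => x; rewrite E1; exact: T_bd.
have cf1 : continuous f1 by move=> x; exact: der_cont (d1 x).
have cw : continuous w by move=> x; exact: der_cont (dw x).
have iA : ig mu (fun x => w x * H x) by exact: l2_mul.
have lf1w' : l2 (fun x => w' x * f1 x) by exact: (l2_Mbd lw' (cont_meas cf1) Bf1).
have iB : ig mu (fun x => w x * (w' x * f1 x)) by exact: l2_mul.
have iD : ig mu (fun x => w x ^+ 2 * f2' x) by exact: (ig_Mbd lw.2 (cont_meas cf2') K2).
have iE : ig mu (fun x => w x ^+ 2 * f1' x) by exact: (ig_Mbd lw.2 (cont_meas cf1') K1).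
have iF : ig mu (fun x => w x ^+ 2 * f1 x) by exact: (ig_Mbd lw.2 (cont_meas cf1) Bf1).
have ibp : \int[mu]_x (w x ^+ 2 * f1' x + 2 * (w x * (w' x * f1 x))) = 0.
  apply: (int_derivative0 iF (igD iE (igZ 2 iB))).
    move=> x; apply: cvgD.
      by apply: cvgM; [apply: cvgM; exact: cw|exact: cf1'].
    apply: cvgM; first exact: cvg_cst.
    by apply: cvgM; [exact: cw|apply: cvgM; [exact: cw'|exact: cf1]].
  move=> x; have e1 : is_derive x 1 f1 (f1' x).
    by apply: (der_eq (d1 x)); rewrite /f1' (rep_derive1 g1 E1).
  have ew : is_derive x 1 w (w' x).
    by apply: (der_eq (dw x)); rewrite /w' (rep_derive1 gh wE).
  by apply: (der_eq (derM (derM ew ew) e1)); ring.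
rewrite intD // in ibp; last exact: igZ.
rewrite intZ // in ibp.
have skew : \int[mu]_x (w x * H x) = 0.
  under eq_int do rewrite wE.
  exact: T_skew.
have -> : \int[mu]_x ((f1 x - f2 x) *
    ((C * T (fun xi => xi * `|xi| * h1 xi) (- x) - f1 x * derive1 f1 x) -
     (C * T (fun xi => xi * `|xi| * h2 xi) (- x) - f2 x * derive1 f2 x))) =
  \int[mu]_x (C * (w x * H x) - w x * (w' x * f1 x) - w x ^+ 2 * f2' x).
  apply: eq_int => x; rewrite w'E.
  have [s1 _] := good_sgn g1; have [s2 _] := good_sgn g2.
  have -> : H x = T (fun xi => xi * `|xi| * h1 xi) (- x) - T (fun xi => xi * `|xi| * h2 xi) (- x).
    by rewrite -TB //; congr T; apply/funext => xi; rewrite /h mulrBr.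
  by rewrite /w /f1' /f2'; ring.
have iAB : ig mu (fun x => C * (w x * H x) - w x * (w' x * f1 x)) by exact: igB (igZ C iA) iB.
rewrite intB // intB //; last exact: igZ.
rewrite intZ // skew mulr0.
have e1 : \int[mu]_x (w x ^+ 2 * f1' x) <= K * \int[mu]_x (w x ^+ 2).
  rewrite -intZ; last exact: lw.2.
  apply: le_int => //; first exact: igZ lw.2.
  by move=> x; rewrite mulrC ler_wpM2r ?sqr_ge0 // (le_trans (ler_norm _)).
have e2 : - (K * \int[mu]_x (w x ^+ 2)) <= \int[mu]_x (w x ^+ 2 * f2' x).
  rewrite -mulNr -intZ; last exact: lw.2.
  apply: le_int => //; first exact: igZ lw.2.
  move=> x; rewrite [leRHS]mulrC; apply: ler_wpM2r; first exact: sqr_ge0.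
  by have := K2 x; rewrite ler_norml => /andP[].
rewrite -/w; move: ibp e1 e2; set A := \int[mu]_x (w x ^+ 2 * f1' x).
set D := \int[mu]_x (w x ^+ 2 * f2' x); set Q := \int[mu]_x (w x * (w' x * f1 x)).
set W := \int[mu]_x (w x ^+ 2); lra.
Qed.

End estimates.

Section uniqueness.
Context {R : realType}.
Local Notation mu := (@lebesgue_measure R).
Variables (Tm s : R) (u1 u2 : R -> R -> R).
Hypotheses (Tm0 : 0 < Tm) (s5 : 5 / 2 < s)
  (BO1 : BO_solution Tm u1) (BO2 : BO_solution Tm u2)
  (C1 : C_sobolev `[0, Tm] s u1) (C2 : C_sobolev `[0, Tm] s u2)
  (D1 : C1_sobolev `]0, Tm[ (s - 2) u1) (D2 : C1_sobolev `]0, Tm[ (s - 2) u2).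

Let w t x := u1 x t - u2 x t.
Let E t := \int[mu]_x (w t x ^+ 2).

Let lw t : 0 <= t <= Tm -> l2 (w t).
Proof.
move=> tT; have a := slice_l2 C1 tT; have b := slice_l2 C2 tT.
exact: l2B a b.
Qed.

Let sqr_sum_le (f g : R -> R) : l2 f -> l2 g ->
  \int[mu]_x ((f x - g x) ^+ 2) <= 2 * \int[mu]_x (f x ^+ 2) + 2 * \int[mu]_x (g x ^+ 2).
Proof.
move=> lf lg; rewrite -!intZ; [|exact: lg.2|exact: lf.2].
rewrite -intD; [|exact: igZ lf.2|exact: igZ lg.2].
apply: le_int; [exact: (l2B lf lg).2|exact: igD (igZ 2 lf.2) (igZ 2 lg.2)|].
by move=> x; have := sqr_ge0 (f x + g x); lra.
Qed.

Let sum_cvg0 (J : Type) (F : set_system J) (FF : Filter F) (a b : J -> R) :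
  a i @[i --> F] --> (0 : R) -> b i @[i --> F] --> (0 : R) ->
  2 * a i + 2 * b i @[i --> F] --> (0 : R).
Proof.
move=> a0 b0; have -> : (0 : R) = 2 * 0 + 2 * 0 by rewrite !mulr0 addr0.
by apply: cvgD; (apply: cvgM; [exact: cvg_cst|]).
Qed.

Let E_cont : {within `[0, Tm], continuous E}.
Proof.
apply/subspace_continuousP => t0 /=; rewrite in_itv /= => tT.
have c1 := slice_sqr_cvg s5 BO1 C1 tT; have c2 := slice_sqr_cvg s5 BO2 C2 tT.
have cB : 2 * \int[mu]_x ((u1 x t - u1 x t0) ^+ 2) + 2 * \int[mu]_x ((u2 x t - u2 x t0) ^+ 2)
    @[t --> within `[0, Tm]%classic (nbhs t0)] --> (0 : R) by apply: sum_cvg0.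
pose d t := \int[mu]_x ((w t x - w t0 x) ^+ 2).
have inside : \forall t \near within `[0, Tm]%classic (nbhs t0), `[0, Tm]%classic t.
  exact: withinT.
have d0 : d t @[t --> within `[0, Tm]%classic (nbhs t0)] --> (0 : R).
  apply: squeeze_cvgr (cvg_cst (0 : R)) cB.
  apply: filterS inside => t; rewrite /= in_itv /= => tT'.
  rewrite int_ge0 => [/=|x]; last exact: sqr_ge0.
  have l1 : l2 (fun x => u1 x t - u1 x t0) by exact: l2B (slice_l2 C1 tT') (slice_l2 C1 tT).
  have l2' : l2 (fun x => u2 x t - u2 x t0) by exact: l2B (slice_l2 C2 tT') (slice_l2 C2 tT).
  apply: le_trans (sqr_sum_le l1 l2'); rewrite le_eqVlt; apply/orP; left; apply/eqP.
  by apply: eq_int => x; rewrite /w; ring.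
pose B t := d t + 2 * Num.sqrt (E t0 * d t).
have B0 : B t @[t --> within `[0, Tm]%classic (nbhs t0)] --> (0 : R).
  have ed : E t0 * d t @[t --> within `[0, Tm]%classic (nbhs t0)] --> (0 : R).
    by rewrite -[X in _ --> X](mulr0 (E t0)); apply: cvgM; [exact: cvg_cst|exact: d0].
  have sq : Num.sqrt (E t0 * d t) @[t --> within `[0, Tm]%classic (nbhs t0)] --> (0 : R).
    rewrite -[X in _ --> X](@sqrtr0 R); apply: continuous_cvg => //.
    exact: sqrt_continuous.
  have sq2 : 2 * Num.sqrt (E t0 * d t) @[t --> within `[0, Tm]%classic (nbhs t0)] --> (0 : R).
    by rewrite -[X in _ --> X](mulr0 (2 : R)); apply: cvgM; [exact: cvg_cst|exact: sq].
  by rewrite -[X in _ --> X](addr0 (0 : R)); exact: (cvgD d0 sq2).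
apply/cvgrPdist_lt => e e0.
have Be : \forall t \near within `[0, Tm]%classic (nbhs t0), `|B t| < e by apply: (cvgr0_norm_lt _ B0).
apply: filterS2 Be inside => t Be; rewrite /= in_itv /= => tT'.
rewrite distrC; apply: le_lt_trans Be; apply: le_trans (ler_norm _).
have l0 := lw tT; have lt := lw tT'.
have ld : l2 (fun x => w t x - w t0 x) by exact: l2B lt l0.
have -> : E t - E t0 = d t + 2 * \int[mu]_x (w t0 x * (w t x - w t0 x)).
  rewrite /E /d -intB; [|exact: lt.2|exact: l0.2].
  rewrite -intZ; last exact: l2_mul.
  rewrite -intD; [|exact: ld.2|by apply: igZ; exact: l2_mul].
  by apply: eq_int => x; ring.
rewrite (le_trans (ler_normD _ _)) // lerD //.
  by rewrite ger0_norm // int_ge0 // => x; exact: sqr_ge0.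
rewrite normrM ger0_norm // ler_wpM2l // -sqrtr_sqr ler_wsqrtr //.
exact: cauchy_schwarz_int.
Qed.

Lemma solutions_eq : (forall x, u1 x 0 = u2 x 0) ->
  forall x t, 0 <= t <= Tm -> u1 x t = u2 x t.
Proof.
move=> u0 x t tT.
have [K1 K10 HK1] := slice_der_bound s5 BO1 C1.
have [K2 K20 HK2] := slice_der_bound s5 BO2 C2.
pose K := K1 + K2.
have E0 : E t = 0.
  apply: (@gronwall0 _ 0 Tm (3 * K) E
    (fun t => 2 * \int[mu]_x (w t x * (time_deriv Tm u1 x t - time_deriv Tm u2 x t)))) => //.
  - exact: ltW.
  - move=> r rT; have rc : 0 <= r <= Tm by case/andP: rT => a b; rewrite !ltW.
    have [l1 d1] := slice_time_deriv s5 BO1 C1 D1 rT.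
    have [l2' d2] := slice_time_deriv s5 BO2 C2 D2 rT.
    have inside : \forall h \near (0 : R)^', 0 <= r + h <= Tm.
      case/andP: rT => r0 rT.
      apply: nbhs_dnbhs; exists (Num.min r (Tm - r)) => /=; first by rewrite lt_min r0 subr_gt0.
      by move=> h /=; rewrite sub0r normrN lt_min !ltr_norml => /andP[/andP[a b] /andP[e d]]; lra.
    apply: sqr_int_derive => //.
    + by apply: filterS inside => h; exact: lw.
    + exact: lw.
    + exact: l2B l1 l2'.
    + apply: squeeze_cvgr (cvg_cst (0 : R)) (sum_cvg0 _ d1 d2).
      apply: filterS inside => h hT.
      rewrite int_ge0 => [/=|y]; last exact: sqr_ge0.
      have q1 : l2 (fun x => h^-1 * (u1 x (r + h) - u1 x r) - time_deriv Tm u1 x r).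
        by apply: l2B => //; apply: l2Z; exact: l2B (slice_l2 C1 hT) (slice_l2 C1 rc).
      have q2 : l2 (fun x => h^-1 * (u2 x (r + h) - u2 x r) - time_deriv Tm u2 x r).
        by apply: l2B => //; apply: l2Z; exact: l2B (slice_l2 C2 hT) (slice_l2 C2 rc).
      apply: le_trans (sqr_sum_le q1 q2); rewrite le_eqVlt; apply/orP; left; apply/eqP.
      by apply: eq_int => y; rewrite /w; ring.
  - move=> r rT; have rc : 0 <= r <= Tm by case/andP: rT => a b; rewrite !ltW.
    have B1 y : `|derive1 (u1 ^~ r) y| <= K by apply: le_trans (HK1 r rc y) _; rewrite lerDl.
    have B2 y : `|derive1 (u2 ^~ r) y| <= K by apply: le_trans (HK2 r rc y) _; rewrite lerDr.
    have := energy_estimate (pi^-1 * (2 * dirichlet)) (slice_good s5 C1 rc) (slice_good s5 C2 rc)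
      (slice_T s5 BO1 C1 rc) (slice_T s5 BO2 C2 rc) B1 B2.
    apply: le_trans; rewrite le_eqVlt; apply/orP; left; apply/eqP; congr (2 * _).
    apply: eq_int => y; rewrite (slice_equation s5 BO1 C1 y rc) (slice_equation s5 BO2 C2 y rc).
    by [].
  - by move=> r _; apply: int_ge0 => y; exact: sqr_ge0.
  - rewrite /E /w; under eq_int do rewrite u0 subrr expr0n /=.
    by rewrite /Rintegral integral0.
apply/eqP; rewrite -subr_eq0; apply/eqP.
apply: (@sqr_int0 _ (w t) x _ (lw tT) E0) => y.
by apply: cvgB; [exact: (slice_cont BO1 tT)|exact: (slice_cont BO2 tT)].
Qed.

End uniqueness.

(* On [|x| < a] the two equations at time 0 differ only by the Hilbert transform of
   [derive1n 2 (f1 - f2)], a function supported outside of that interval. *)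
Section initial_data.
Context {R : realType}.
Local Notation mu := (@lebesgue_measure R).
Variables (h1 h2 f1 f2 d : R -> R) (a : R).
Local Notation H h := (fun x => pi^-1 * (2 * dirichlet) * T (fun xi => xi * `|xi| * h xi) (- x)).
Hypotheses (g1 : good h1) (g2 : good h2)
  (E1 : forall x, f1 x = T h1 x) (E2 : forall x, f2 x = T h2 x)
  (c1 : forall x, cvg (hilbert_trunc (derive1n 2 f1) x e @[e --> 0^'+]))
  (c2 : forall x, cvg (hilbert_trunc (derive1n 2 f2) x e @[e --> 0^'+]))
  (a0 : 0 < a) (f12 : forall x, `|x| < a -> f1 x = f2 x)
  (dE : forall x, d x = H h1 x - f1 x * derive1 f1 x - (H h2 x - f2 x * derive1 f2 x))
  (van : forall N : nat, (0 < N)%N -> exists c : R,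
     \forall r \near 0^'+,
       (\int[mu]_(x in [set x : R | (`|x| <= r)%R]) ((d x) ^+ 2)%:E <= (c * r ^+ N)%:E)%E).

Let w x := f1 x - f2 x.
Let gw := goodB g1 g2.

Let wE x : w x = T (fun xi => h1 xi - h2 xi) x.
Proof.
have [i1 _ _ _ _] := g1; have [i2 _ _ _ _] := g2.
by rewrite /w E1 E2 TB.
Qed.

Let w0 x : `|x| < a -> w x = 0.
Proof. by move=> xa; rewrite /w f12 // subrr. Qed.

Let f := derive1n 2 w.

Let f0 x : `|x| < a -> f x = 0.
Proof. by move=> xa; apply: (vanish_derive _ xa) => y; exact: (vanish_derive w0). Qed.

Let q x := H h1 x - H h2 x.

Let q_cont : continuous q.
Proof.
have [s1 _] := good_sgn g1; have [s2 _] := good_sgn g2.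
have cT k : ig mu k -> continuous (fun x => pi^-1 * (2 * dirichlet) * T k (- x)).
  move=> ik x; apply: cvgM; first exact: cvg_cst.
  apply: (@continuous_comp _ _ _ (fun x => - x) (T k)); first exact: opp_continuous.
  exact: T_cont.
by move=> x; apply: cvgB; [exact: (cT _ s1)|exact: (cT _ s2)].
Qed.

Let qE x : `|x| < a / 2 -> pi * q x = \int[mu]_z cauchy_kernel f 0 x z.
Proof.
move=> xa; have [cf lf] := good_derive2 gw wE.
have [cf1 lf1] := good_derive2 g1 E1; have [cf2 lf2] := good_derive2 g2 E2.
have p0 : pi != 0 :> R by apply: lt0r_neq0; exact: pi_gt0.
have limE h g : good h -> (forall x, g x = T h x) ->
    cvg (hilbert_trunc (derive1n 2 g) x e @[e --> 0^'+]) ->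
    hilbert_trunc (derive1n 2 g) x e @[e --> 0^'+] --> pi * H h x.
  by move=> gh gE c; rewrite -(rep_hilbert gh gE c) /hilbert mulVKf //; exact: c.
have L : hilbert_trunc (derive1n 2 f1) x e - hilbert_trunc (derive1n 2 f2) x e
    @[e --> 0^'+] --> pi * q x.
  have -> : pi * q x = pi * H h1 x - pi * H h2 x by exact: mulrBr.
  by apply: cvgB; [exact: (limE _ _ g1 E1 (@c1 x))|exact: (limE _ _ g2 E2 (@c2 x))].
rewrite -(cvg_lim (@Rhausdorff R) L); apply: cvg_lim; first exact: Rhausdorff.
apply: cvg_near_cst.
have e0 : \forall e \near (0 : R)^'+, 0 < e by exact: nbhs_right_gt.
have ea : \forall e \near (0 : R)^'+, e < a / 2 by apply: nbhs_right_lt; exact: divr_gt0.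
apply: filterS2 e0 ea => e e0 ea.
rewrite -(hilbert_trunc_far lf a0 f0 xa (e := e)) ?e0 //.
rewrite (_ : derive1n 2 w = fun y => derive1n 2 f1 y - derive1n 2 f2 y); last first.
  by apply/funext => y; exact: good_derive2B g1 g2 E1 E2.
exact: (esym (hilbert_truncB x e0 cf1 lf1 cf2 lf2)).
Qed.

Let dqE x : `|x| < a -> d x = q x.
Proof.
move=> xa; rewrite dE.
have e : derive1 f1 x = derive1 f2 x.
  apply/eqP; rewrite -subr_eq0 -[X in _ == X](vanish_derive w0 xa); apply/eqP.
  have e1 := rep_der1 g1 E1 x; have e2 := rep_der1 g2 E2 x.
  by rewrite !derive1E; have e := derB e1 e2; rewrite !derive_val.
by rewrite e f12 // /q; ring.
Qed.

Lemma initial_data_eq x : f1 x = f2 x.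
Proof.
have [cf lf] := good_derive2 gw wE.
have cpq : continuous (fun x => pi * q x).
  by move=> y; apply: cvgM; [exact: cvg_cst|exact: q_cont].
have van' N : (0 < N)%N -> exists c : R, \forall r \near 0^'+,
     (\int[mu]_(x in [set x | (`|x| <= r)%R]) ((pi * q x) ^+ 2)%:E <= (c * r ^+ N)%:E)%E.
  move=> N0; have [c Hc] := van N0; exists (pi ^+ 2 * c).
  have ra : \forall r \near (0 : R)^'+, r < a by exact: nbhs_right_lt.
  apply: filterS2 Hc ra => r Hc ra.
  have mb : measurable ([set x | `|x| <= r] : set R).
    rewrite (_ : [set _ | _] = `[- r, r]%classic); first exact: measurable_itv.
    by apply/seteqP; split => y /=; rewrite in_itv /= ler_norml.
  have -> : (\int[mu]_(x in [set x | (`|x| <= r)%R]) ((pi * q x) ^+ 2)%:E =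
      (pi ^+ 2)%:E * \int[mu]_(x in [set x | (`|x| <= r)%R]) ((q x) ^+ 2)%:E)%E.
    rewrite -ge0_integralZl_EFin //.
    - by apply: eq_integral => y _; rewrite -EFinM exprMn.
    - by move=> y _; rewrite lee_fin sqr_ge0.
    - apply: measurable_funTS; apply/measurable_EFinP; apply: measurable_funX.
      exact: (cont_meas q_cont).
    - exact: sqr_ge0.
  rewrite -mulrA [X in (_ <= X)%E]EFinM; apply: lee_wpmul2l; first by rewrite lee_fin sqr_ge0.
  have -> : (\int[mu]_(x in [set x | (`|x| <= r)%R]) ((q x) ^+ 2)%:E =
      \int[mu]_(x in [set x | (`|x| <= r)%R]) ((d x) ^+ 2)%:E)%E.
    by apply: eq_integral => y /set_mem /= yr; rewrite dqE // (le_lt_trans yr).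
  exact: Hc.
have f_eq0 := moments_eq0 cf lf a0 f0 (moment0 lf a0 f0 cpq qE van').
by apply/eqP; rewrite -subr_eq0; apply/eqP; exact: (good_eq0 gw wE a0 w0 f_eq0).
Qed.

End initial_data.

Theorem theorem1p9 (R : realType) (T s : R) (u1 u2 : R -> R -> R)
  (T_gt0 : 0 < T) (s_gt : 5 / 2 < s)
  (u1_BO : BO_solution T u1) (u2_BO : BO_solution T u2)
  (u1_C : C_sobolev `[0, T] s u1) (u2_C : C_sobolev `[0, T] s u2)
  (u1_C1 : C1_sobolev `]0, T[ (s - 2) u1)
  (u2_C1 : C1_sobolev `]0, T[ (s - 2) u2)
  (I : set R) (I_open : open I) (I0 : I 0)
  (u12_I : forall x, I x -> u1 x 0 = u2 x 0)
  (vanish : forall N : nat, (0 < N)%N -> exists c : R,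
     \forall r \near 0^'+,
       (\int[lebesgue_measure]_(x in [set x : R | (`|x| <= r)%R])
          ((time_deriv T u1 x 0 - time_deriv T u2 x 0) ^+ 2)%:E
        <= (c * r ^+ N)%:E)%E) :
  forall x t : R, 0 <= t <= T -> u1 x t = u2 x t.
Proof.
move=> x t tT; apply: (solutions_eq T_gt0 s_gt u1_BO u2_BO u1_C u2_C u1_C1 u2_C1) tT => y.
have t0 : 0 <= (0 : R) <= T by rewrite lexx ltW.
have [a /= a0 aI] := open_nbhs_nbhs (conj I_open I0).
apply: (initial_data_eq (slice_good s_gt u1_C t0) (slice_good s_gt u2_C t0)
  (slice_T s_gt u1_BO u1_C t0) (slice_T s_gt u2_BO u2_C t0) _ _ a0 _ _ vanish).
- by move=> z; case: (u1_BO z 0 t0).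
- by move=> z; case: (u2_BO z 0 t0).
- by move=> z za; apply: u12_I; apply: aI; rewrite /= sub0r normrN.
- move=> z; rewrite (slice_equation s_gt u1_BO u1_C z t0) (slice_equation s_gt u2_BO u2_C z t0).
  by [].
Qed.
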